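(* Let $a\geq b\geq c>0$ be real numbers. The smallest non-zero eigenvalue of the Laplace--Beltrami operator on $\mathrm{SO}(3)$ endowed with the left-invariant metric $g_{(a,b,c)}$ is $$\lambda_1(\mathrm{SO}(3),g_{(a,b,c)})=4(b^2+c^2),$$ and its multiplicity is three if $a>b$, six if $a=b>c$, and nine if $a=b=c$.
   Context: In $\mathfrak{su}(2)$ set $X_1=\begin{pmatrix} i&0\\0&-i\end{pmatrix}$, $X_2=\begin{pmatrix}0&1\\-1&0\end{pmatrix}$, $X_3=\begin{pmatrix}0&i\\i&0\end{pmatrix}$. The group $\mathrm{SO}(3)$ is identified with $\mathrm{SU}(2)/\{\pm I_2\}$, so its Lie algebra is $\mathfrak{su}(2)$. For positive reals $a,b,c$, $g_{(a,b,c)}$ denotes the left-invariant Riemannian metric on $\mathrm{SO}(3)$ whose inner product on $\mathfrak{su}(2)$ (the tangent space at the identity) has $\{aX_1,bX_2,cX_3\}$ as an orthonormal basis. The Laplace--Beltrami operator is taken with the sign convention making it non-negative; its eigenvalues on a compact connected Riemannian manifold $(M,g)$, counted with multiplicity, are $0=\lambda_0(M,g)<\lambda_1(M,g)\leq\lambda_2(M,g)\leq\cdots$. *)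

(* Defs.v *)
From HB Require Import structures.
From mathcomp Require Import all_boot all_order all_algebra.
From mathcomp Require Import sesquilinear spectral complex.
From mathcomp Require Import all_classical all_reals all_analysis.
From mathcomp Require Import ring lra.

Set Implicit Arguments.
Unset Strict Implicit.
Unset Printing Implicit Defensive.

Import Order.TTheory GRing.Theory Num.Theory.
Import numFieldNormedType.Exports.

Local Open Scope quotient_scope.
Local Open Scope classical_set_scope.
Local Open Scope complex_scope.
Local Open Scope sesquilinear_scope.
Local Open Scope ring_scope.

Section SU2.
Variable R : realType.

Definition mx2 (p q r s : R[i]) : 'M[R[i]]_2 :=
  \matrix_(j < 2, k < 2)
    if j == 0 then (if k == 0 then p else q) else (if k == 0 then r else s).

Definition X1 : 'M[R[i]]_2 := mx2 (0 +i* 1) 0 0 (0 -i* 1).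
Definition X2 : 'M[R[i]]_2 := mx2 0 1 (- 1) 0.
Definition X3 : 'M[R[i]]_2 := mx2 0 (0 +i* 1) (0 +i* 1) 0.

(* [su2] is the Lie algebra su(2), in coordinates with respect to the real    *)
(* basis (X1, X2, X3).                                                        *)
Definition su2 := 'rV[R]_3.

Definition su2mx (v : su2) : 'M[R[i]]_2 :=
  (v 0 0)%:C *: X1 + (v 0 1)%:C *: X2 + (v 0 2%:R)%:C *: X3.

Definition su2coord (M : 'M[R[i]]_2) : su2 :=
  \row_(j < 3) [:: complex.Im (M 0 0); complex.Re (M 0 1); complex.Im (M 0 1)]`_j.

Definition su2bracket (u v : su2) : su2 :=
  su2coord (su2mx u *m su2mx v - su2mx v *m su2mx u).

Lemma su2mxE v : su2mx v =
  mx2 (0 +i* v 0 0) (v 0 1 +i* v 0 2%:R) (- v 0 1 +i* v 0 2%:R) (0 -i* v 0 0).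
Proof.
apply/matrixP => j k; rewrite !mxE.
case: ifP => _; case: ifP => _; apply/eqP; rewrite eq_complex /=;
  apply/andP; split; apply/eqP; ring.
Qed.

Lemma row3P (u v : su2) :
  u 0 0 = v 0 0 -> u 0 1 = v 0 1 -> u 0 2%:R = v 0 2%:R -> u = v.
Proof.
move=> h0 h1 h2; apply/rowP => -[[|[|[|//]]] Hi].
- by rewrite (_ : Ordinal Hi = 0)//; apply/val_inj.
- by rewrite (_ : Ordinal Hi = 1)//; apply/val_inj.
- by rewrite (_ : Ordinal Hi = 2%:R)//; apply/val_inj.
Qed.

Lemma su2mxK : cancel su2mx su2coord.
Proof. by move=> v; apply: row3P; rewrite su2mxE !mxE. Qed.

Lemma ord2P (P : 'I_2 -> Prop) : P 0 -> P 1 -> forall j, P j.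
Proof.
move=> P0 P1 -[[|[|//]] Hj].
- by rewrite (_ : Ordinal Hj = 0)//; apply/val_inj.
- by rewrite (_ : Ordinal Hj = 1)//; apply/val_inj.
Qed.

Lemma mul_mx2 p q r s p' q' r' s' : mx2 p q r s *m mx2 p' q' r' s' =
  mx2 (p * p' + q * r') (p * q' + q * s') (r * p' + s * r') (r * q' + s * s').
Proof.
apply/matrixP; apply: ord2P; apply: ord2P;
  by rewrite !mxE big_ord_recl big_ord1 !mxE.
Qed.

Lemma det_mx2 p q r s : \det (mx2 p q r s) = p * s - q * r.
Proof.
rewrite (expand_det_row _ 0) big_ord_recl big_ord1 /cofactor !det_mx11 !mxE /=.
by rewrite expr0 expr1; ring.
Qed.

Lemma su2_skew_traceless (M : 'M[R[i]]_2) : M^t* = - M -> \tr M = 0 ->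
  su2mx (su2coord M) = M.
Proof.
move=> /matrixP hM; rewrite /mxtrace big_ord_recl big_ord1.
rewrite (_ : lift _ _ = 1); last exact/val_inj.
move: (hM 0 0) (hM 0 1) (hM 1 0); rewrite !mxE.
rewrite su2mxE => h00 h01 h10 htr.
apply/matrixP; apply: ord2P; apply: ord2P; rewrite !mxE /=.
all: move: h00 h01 h10 htr.
all: case: (M 0 0) (M 0 1) (M 1 0) (M 1 1) => [p p'] [q q'] [r r'] [s s'].
all: do 4 (move=> /eqP; rewrite eq_complex /= => /andP[/eqP ? /eqP ?]).
all: by apply/eqP; rewrite eq_complex /=; apply/andP; split; apply/eqP; lra.
Qed.

Lemma su2bracketE u v :
  su2mx (su2bracket u v) = su2mx u *m su2mx v - su2mx v *m su2mx u.
Proof.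
apply: su2_skew_traceless.
  rewrite !su2mxE !mul_mx2; apply/matrixP; apply: ord2P; apply: ord2P;
    rewrite !mxE /=; apply/eqP; rewrite eq_complex /=;
    by apply/andP; split; apply/eqP; ring.
by rewrite linearB /= mxtrace_mulC subrr.
Qed.

Definition is_SU2 (g : 'M[R[i]]_2) : bool := (g \is unitarymx) && (\det g == 1).

Record SU2 := MkSU2 { SU2val :> 'M[R[i]]_2; SU2valP : is_SU2 SU2val }.
HB.instance Definition _ := [isSub for SU2val].
HB.instance Definition _ := [Choice of SU2 by <:].

Lemma is_SU2M (g h : SU2) : is_SU2 (val g *m val h).
Proof.
case: g h => [g /andP[ug /eqP dg]] [h /andP[uh /eqP dh]] /=.
by rewrite /is_SU2 mul_unitarymx//= det_mulmx dg dh mulr1.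
Qed.

Definition SU2mul (g h : SU2) : SU2 := MkSU2 (is_SU2M g h).

Definition expmx (M : 'M[R[i]]_2) : 'M[R[i]]_2 :=
  \matrix_(j, k)
    (limn (series (fun n => complex.Re ((M ^+ n) j k) / n`!%:R)) +i*
     limn (series (fun n => complex.Im ((M ^+ n) j k) / n`!%:R))).

Definition su2norm (v : su2) : R :=
  Num.sqrt (v 0 0 ^+ 2 + v 0 1 ^+ 2 + v 0 2%:R ^+ 2).

Lemma su2norm0 v : su2norm v = 0 -> v = 0.
Proof.
move=> /eqP; rewrite sqrtr_eq0 => h.
have := sqr_ge0 (v 0 0); have := sqr_ge0 (v 0 1); have := sqr_ge0 (v 0 2%:R).
move=> h2 h1 h0; apply: row3P; rewrite mxE; apply/eqP; rewrite -sqrf_eq0;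
  apply/eqP; lra.
Qed.

Lemma su2norm_sqr v :
  su2norm v ^+ 2 = v 0 0 ^+ 2 + v 0 1 ^+ 2 + v 0 2%:R ^+ 2.
Proof. by rewrite sqr_sqrtr// !addr_ge0// sqr_ge0. Qed.

Lemma su2mx_sqr v : su2mx v ^+ 2 = ((- su2norm v ^+ 2)%:C)%:M.
Proof.
rewrite su2norm_sqr expr2 -mulmxE su2mxE mul_mx2.
apply/matrixP; apply: ord2P; apply: ord2P; rewrite !mxE /=;
  apply/eqP; rewrite eq_complex /=; apply/andP; split; apply/eqP; ring.
Qed.

Lemma su2mxX v n : su2mx v ^+ n =
  ((- su2norm v ^+ 2) ^+ n./2)%:C *: (if odd n then su2mx v else 1%:M).
Proof.
rewrite -[in LHS](odd_double_half n) exprD -mul2n exprM su2mx_sqr.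
have -> k : ((- su2norm v ^+ 2)%:C)%:M ^+ k =
            ((- su2norm v ^+ 2) ^+ k)%:C%:M :> 'M[R[i]]_2.
  by rewrite !rmorphXn.
rewrite -[_%:M]scalemx1 -scalerAr mulr1.
by case: (odd n).
Qed.

Lemma expmx_su2 v : su2norm v != 0 -> expmx (su2mx v) =
  (cos (su2norm v))%:C%:M + (sin (su2norm v) / su2norm v)%:C *: su2mx v.
Proof.
move=> v0; set r := su2norm v in v0 *.
have key (A B : R) :
  limn (series (fun n => (- r ^+ 2) ^+ n./2 * (if odd n then B else A) / n`!%:R))
    = cos r * A + sin r / r * B.
  rewrite (_ : (fun n => _) = A *: cos_coeff r + (B / r) *: sin_coeff r).
    have hc := @is_cvg_series_cos_coeff _ r.
    have hs := @is_cvg_series_sin_coeff _ r.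
    rewrite lim_seriesD; [|exact: is_cvg_seriesZ..].
    rewrite !lim_seriesZ//.
    by rewrite cos.unlock sin.unlock /GRing.scale /=; ring.
  apply/funext => n; rewrite !fctE /cos_coeff /sin_coeff /GRing.scale /=.
  rewrite [in RHS](_ : r ^+ n = r ^+ odd n * (r ^+ 2) ^+ n./2); last first.
    by rewrite -exprM mul2n -exprD odd_double_half.
  rewrite -exprnP [in LHS]exprNn; have n0 : (n`!%:R : R) != 0 by rewrite pnatr_eq0 -lt0n fact_gt0.
  case: ifPn => on /=; last by rewrite expr0; field; rewrite n0 v0.
  have -> : n.-1./2 = n./2 by rewrite -[in LHS](odd_double_half n) on /= doubleK.
  by rewrite expr1; field; rewrite n0 v0.
apply/matrixP => j k; rewrite [LHS]mxE.
have E n : ((su2mx v ^+ n) j k) =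
    ((- r ^+ 2) ^+ n./2)%:C * (if odd n then su2mx v j k else (1%:M : 'M[R[i]]_2) j k).
  by rewrite su2mxX [LHS]mxE; case: ifP.
rewrite (_ : (fun n => complex.Re _ / _) = (fun n => (- r ^+ 2) ^+ n./2 *
   (if odd n then complex.Re (su2mx v j k)
    else complex.Re ((1%:M : 'M[R[i]]_2) j k)) / n`!%:R)); last first.
  apply/funext => n; rewrite E; case: ifP => _; congr (_ / _);
    by case: ((_ : 'M[R[i]]_2) j k) => x y /=; ring.
rewrite (_ : (fun n => complex.Im _ / _) = (fun n => (- r ^+ 2) ^+ n./2 *
   (if odd n then complex.Im (su2mx v j k)
    else complex.Im ((1%:M : 'M[R[i]]_2) j k)) / n`!%:R)); last first.
  apply/funext => n; rewrite E; case: ifP => _; congr (_ / _);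
    by case: ((_ : 'M[R[i]]_2) j k) => x y /=; ring.
rewrite !key -[(cos r)%:C%:M]scalemx1 [RHS]mxE [X in _ = X + _]mxE [X in _ = _ + X]mxE.
case: ((1%:M : 'M[R[i]]_2) j k) (su2mx v j k) => x y [x' y'].
by apply/eqP; rewrite eq_complex /=; apply/andP; split; apply/eqP; ring.
Qed.

Lemma is_SU2_mx2 (p q : R[i]) :
  (complex.Re p ^+ 2 + complex.Im p ^+ 2) +
  (complex.Re q ^+ 2 + complex.Im q ^+ 2) = 1 ->
  is_SU2 (mx2 p q (- q^*) p^*).
Proof.
case: p q => [x y] [z t] /= h; apply/andP; split.
  apply/unitarymxP; rewrite (_ : _ ^t* = mx2 (x -i* y) (- z -i* t) (z -i* t) (x +i* y)).
    rewrite mul_mx2; apply/matrixP; apply: ord2P; apply: ord2P; rewrite !mxE /=;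
      by apply/eqP; rewrite eq_complex /=; apply/andP; split; apply/eqP; lra.
  by apply/matrixP; apply: ord2P; apply: ord2P; rewrite !mxE /=;
      apply/eqP; rewrite eq_complex /=; apply/andP; split; apply/eqP; ring.
by rewrite det_mx2 eq_complex /=; apply/andP; split; apply/eqP; lra.
Qed.

Lemma expmx0 : expmx 0 = 1%:M.
Proof.
have key (A : R) : limn (series (fun n => (0 ^+ n : R) * A / n`!%:R)) = A.
  rewrite (_ : (fun n => _) = A *: exp_coeff (0 : R)).
    rewrite lim_seriesZ; last exact: is_cvg_series_exp_coeff.
    have := @expR0 R; rewrite /expR => ->.
    by rewrite /GRing.scale /= mulr1.
  by apply/funext => n; rewrite !fctE /exp_coeff /GRing.scale /=; ring.
have E n : (0 : 'M[R[i]]_2) ^+ n = (0 ^+ n : R)%:C *: 1%:M.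
  by case: n => [|n]; rewrite ?expr0 ?scale1r// !exprS !mul0r scale0r.
apply/matrixP => j k; rewrite [LHS]mxE.
rewrite (_ : (fun n => complex.Re _ / _) = (fun n => (0 ^+ n : R) *
   complex.Re ((1%:M : 'M[R[i]]_2) j k) / n`!%:R)); last first.
  apply/funext => n; rewrite E mxE; congr (_ / _);
    by case: ((_ : 'M[R[i]]_2) j k) => x y /=; ring.
rewrite (_ : (fun n => complex.Im _ / _) = (fun n => (0 ^+ n : R) *
   complex.Im ((1%:M : 'M[R[i]]_2) j k) / n`!%:R)); last first.
  apply/funext => n; rewrite E mxE; congr (_ / _);
    by case: ((_ : 'M[R[i]]_2) j k) => x y /=; ring.
by rewrite !key; case: (_ j k).
Qed.

Lemma is_SU2_1 : is_SU2 1%:M.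
Proof.
apply/andP; split; last by rewrite det1.
by apply/unitarymxP; rewrite trmx1 map_mx1 mulmx1.
Qed.

Lemma expmx_SU2 v : is_SU2 (expmx (su2mx v)).
Proof.
have [/eqP/su2norm0 ->|v0] := boolP (su2norm v == 0).
  rewrite (_ : su2mx 0 = 0) ?expmx0 ?is_SU2_1//.
  by rewrite /su2mx !mxE !scale0r !addr0.
rewrite expmx_su2//; set r := su2norm v in v0 *.
rewrite (_ : _ + _ = mx2 (cos r +i* (sin r / r * v 0 0))
  ((sin r / r * v 0 1) +i* (sin r / r * v 0 2%:R))
  (- ((sin r / r * v 0 1) +i* (sin r / r * v 0 2%:R))^*)
  ((cos r +i* (sin r / r * v 0 0))^*)).
  apply: is_SU2_mx2 => /=.
  have := su2norm_sqr v; rewrite -/r => h.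
  have e : (sin r / r) ^+ 2 * r ^+ 2 = sin r ^+ 2 by rewrite -exprMn divfK.
  by rewrite -[RHS](cos2Dsin2 r) -e h; ring.
rewrite su2mxE; apply/matrixP; apply: ord2P; apply: ord2P; rewrite !mxE /=;
  by apply/eqP; rewrite eq_complex /=; apply/andP; split; apply/eqP; ring.
Qed.

Definition SU2exp (v : su2) : SU2 := MkSU2 (expmx_SU2 v).

Definition eq_sign (g h : SU2) : bool :=
  (val g == val h) || (val g == - val h).

Lemma eq_sign_refl : reflexive eq_sign.
Proof. by move=> g; rewrite /eq_sign eqxx. Qed.

Lemma eq_sign_sym : symmetric eq_sign.
Proof.
move=> g h; rewrite /eq_sign [val h == val g]eq_sym; congr (_ || _).
by rewrite -eqr_oppLR eq_sym.
Qed.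

Lemma eq_sign_trans : transitive eq_sign.
Proof.
move=> h g k /orP[] /eqP hg /orP[] /eqP hk; rewrite /eq_sign hg hk ?opprK eqxx//;
  exact: orbT.
Qed.

Canonical eq_sign_equiv := EquivRel eq_sign eq_sign_refl eq_sign_sym eq_sign_trans.

Definition SO3 := {eq_quot eq_sign}.

(* Independent of the chosen representatives, see [SO3mul_pi].                *)
Definition SO3mul (p q : SO3) : SO3 := \pi_SO3 (SU2mul (repr p) (repr q)).

Lemma SO3mul_pi (g h : SU2) :
  SO3mul (\pi_SO3 g) (\pi_SO3 h) = \pi_SO3 (SU2mul g h).
Proof.
apply/eqP; rewrite eqmodE /= /eq_sign /=.
have K (x : SU2) : val (repr (\pi_SO3 x)) = val x \/
                   val (repr (\pi_SO3 x)) = - val x.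
  have /eqP := reprK (\pi_SO3 x); rewrite eqmodE /= /eq_sign.
  by case/orP => /eqP; [left|right].
by case: (K g) (K h) => [->|->] [->|->];
  rewrite ?mulmxN ?mulNmx ?opprK eqxx ?orbT.
Qed.

Definition SO3exp (v : su2) : SO3 := \pi_SO3 (SU2exp v).

(* Vector fields are given by their left trivialization: [V : SO3 -> su2]     *)
(* stands for the field whose value at p is the image of V p under the        *)
(* differential at the identity of the left translation by p. Constant maps   *)
(* are the left-invariant fields.                                             *)

Definition Dfield (W : normedModType R) (V : SO3 -> su2) (F : SO3 -> W) (p : SO3) : W :=
  derive1 (fun t : R => F (SO3mul p (SO3exp (t *: V p)))) 0.

(* In the left trivialization the first two terms differentiate the           *)
(* coefficients; the last one is the bracket of left-invariant fields.        *)
Definition Lie (V W : SO3 -> su2) (p : SO3) : su2 :=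
  Dfield V W p - Dfield W V p + su2bracket (V p) (W p).

Definition SU2amb (g : SU2) : 'M[R]_2 * 'M[R]_2 :=
  (map_mx (@complex.Re R) (val g), map_mx (@complex.Im R) (val g)).

Fixpoint Ck (V : normedModType R) (k : nat) (U : set V) (F : V -> R) : Prop :=
  if k is k'.+1 then
    (forall x, U x -> differentiable F x) /\
    (forall v, Ck k' U (fun x => 'D_v F x))
  else forall x, U x -> {for x, continuous F}.

(* SU(2) is an embedded submanifold of M_2(C) = R^8 and SU(2) -> SO(3) is a   *)
(* local diffeomorphism.                                                      *)
Definition smooth (f : SO3 -> R) : Prop :=
  forall g : SU2, exists (U : set ('M[R]_2 * 'M[R]_2)) (F : 'M[R]_2 * 'M[R]_2 -> R),
    [/\ open U, U (SU2amb g), forall k, Ck k U F &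
        forall h : SU2, U (SU2amb h) -> f (\pi_SO3 h) = F (SU2amb h)].

End SU2.

Section Metric.
Variables (R : realType) (a b c : R).
Local Notation su2 := (su2 R).
Local Notation SO3 := (SO3 R).

Definition weight (j : 'I_3) : R := [:: a; b; c]`_j.

Definition metric (u v : su2) : R := \sum_(j < 3) u 0 j * v 0 j / weight j ^+ 2.

Definition frame (j : 'I_3) : su2 := weight j *: delta_mx 0 j.

Lemma frameE : 0 < a -> 0 < b -> 0 < c ->
  [/\ su2mx (frame 0) = a%:C *: X1 R, su2mx (frame 1) = b%:C *: X2 R,
      su2mx (frame 2%:R) = c%:C *: X3 R
    & forall j k, metric (frame j) (frame k) = (j == k)%:R].
Proof.
move=> a0 b0 c0; split; rewrite /su2mx /frame ?mxE /weight /=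
  ?mulr0 ?mulr1 ?scale0r ?add0r ?addr0//.
move=> j k.
have s0 : weight j != 0.
  by rewrite /weight; case: j => -[|[|[|]]]//= _; rewrite gt_eqF.
rewrite /metric (bigD1 j)//= big1 => [|l lj]; rewrite !mxE eqxx /=; last first.
  by rewrite (negbTE lj) mulr0 !mul0r.
have [<-|jk] := eqVneq j k; last by rewrite !(mulr0, mul0r) addr0.
by rewrite -/(weight j) eqxx addr0 !mulr1 -expr2 divff// expf_neq0.
Qed.

Definition inner (V W : SO3 -> su2) (p : SO3) : R := metric (V p) (W p).

(* twice the inner product of nabla_V W with Z, by the Koszul formula *)
Definition koszul (V W Z : SO3 -> su2) (p : SO3) : R :=
  Dfield V (inner W Z : SO3 -> R^o) p + Dfield W (inner Z V : SO3 -> R^o) p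
  - Dfield Z (inner V W : SO3 -> R^o) p
  + inner (Lie V W) Z p - inner (Lie W Z) V p + inner (Lie Z V) W p.

(* Levi-Civita connection and gradient, expanded in the orthonormal frame.    *)
Definition nabla (V W : SO3 -> su2) (p : SO3) : su2 :=
  \sum_(j < 3) (koszul V W (cst (frame j)) p / 2) *: frame j.

Definition grad (f : SO3 -> R) (p : SO3) : su2 :=
  \sum_(j < 3) Dfield (cst (frame j)) (f : SO3 -> R^o) p *: frame j.

(* trace of v |-> nabla_v V *)
Definition divergence (V : SO3 -> su2) (p : SO3) : R :=
  \sum_(j < 3) inner (nabla (cst (frame j)) V) (cst (frame j)) p.

Definition laplace (f : SO3 -> R) (p : SO3) : R := - divergence (grad f) p.

Definition eigenspace (lambda : R) : set (SO3 -> R) :=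
  [set f | smooth f /\ forall p, laplace f p = lambda * f p].

Definition is_eigenvalue (lambda : R) : Prop :=
  exists2 f, eigenspace lambda f & exists p, f p != 0.

Definition is_lambda1 (lambda : R) : Prop :=
  [/\ is_eigenvalue lambda, lambda != 0 &
      forall mu, is_eigenvalue mu -> mu != 0 -> lambda <= mu].

Definition multiplicity (lambda : R) (n : nat) : Prop :=
  exists e : 'I_n -> SO3 -> R,
    (forall x : 'I_n -> R,
        (forall p, \sum_j x j * e j p = 0) -> forall j, x j = 0) /\
    eigenspace lambda =
      [set f | exists x : 'I_n -> R, forall p, f p = \sum_j x j * e j p].

End Metric.

(* Main.v *)
Require Import Defs.
From HB Require Import structures.
From mathcomp Require Import all_boot all_order all_algebra.
From mathcomp Require Import sesquilinear spectral complex.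
From mathcomp Require Import all_classical all_reals all_analysis.
From mathcomp Require Import ring lra.

Set Implicit Arguments.
Unset Strict Implicit.
Unset Printing Implicit Defensive.

Import Order.TTheory GRing.Theory Num.Theory.
Import numFieldNormedType.Exports.

Local Open Scope quotient_scope.
Local Open Scope classical_set_scope.
Local Open Scope complex_scope.
Local Open Scope sesquilinear_scope.
Local Open Scope ring_scope.

(** The group SO(3) is the quotient of the unit quaternions by the signs, and the
    Laplacian of the left-invariant metric is minus the sum of the squares
    [a^2 X1^2 + b^2 X2^2 + c^2 X3^2] of left-invariant fields ([laplaceE]), the
    Koszul terms cancelling in an orthonormal frame. It is therefore the action of
    an element of the enveloping algebra, and the spectrum is found representation
    by representation. On the representation of dimension [k + 1], with [k] even,
    the operator is at least [b^2 (k (k + 2) - m^2) + c^2 m^2] on the weight space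
    of weight [m] of X3, hence at least [2 k b^2 + k^2 c^2] since [|m| <= k]. For
    [k >= 4] this is at least [8 b^2 + 16 c^2], more than [4 (b^2 + c^2)]; for [k = 2], the
    adjoint representation, the three eigenvalues are computed explicitly, each
    occurring in a column of three matrix entries ([eigfun_rot]). The smallest is
    [4 (b^2 + c^2)], and the multiplicity is three times the number of columns
    where it is attained.

    The analytic content is that smooth eigenfunctions are detected by these
    representations. A direct proof replaces the general theory.

    - An invariant mean [haar] is built by von Neumann's method: averages of left
      translates of a continuous function come uniformly close to a constant
      ([lmean_ex]), which is unique because left and right averages commute
      ([lmean_rmean]). It is right invariant, so derivatives along left-invariant
      fields have mean zero ([haar_isder]), and the operator is symmetric
      ([eigfun_green]).

    - Pairing an eigenfunction with the monomials of degree [k] in the eigenvectors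
      of X3 gives an eigenvector of a finite band matrix, symmetric for binomial
      weights, which vanishes when the eigenvalue is below the bound above
      ([ladder_eigen0], [eigfun_ortho]).

    - After subtraction of its projection onto the constants and the adjoint
      entries, an eigenfunction is thus orthogonal to all even representations
      ([high_ortho]). By the Clebsch-Gordan rule it is orthogonal to the even
      powers of every linear form ([ortho_power]). The powers of the inner product
      with a unit quaternion [h] concentrate at [h] and its opposite, with moments
      known exactly, so the function vanishes at [h] ([localize]). Hence
      eigenfunctions of eigenvalue below [8 b^2 + 16 c^2] lie in the ten-dimensional
      span of the constants and the adjoint entries ([eigfun_low]). *)

(** * The group SU(2) in quaternionic coordinates *)

Section Quaternions.
Variable R : realType.
Local Notation G := (SU2 R).

Definition x0 (p : G) : R := complex.Re (val p 0 0).
Definition x1 (p : G) : R := complex.Im (val p 0 0).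
Definition x2 (p : G) : R := complex.Re (val p 0 1).
Definition x3 (p : G) : R := complex.Im (val p 0 1).

Definition quat (a b c d : R) : 'M[R[i]]_2 :=
  mx2 (a +i* b) (c +i* d) (- c +i* d) (a -i* b).

Lemma complexP (z w : R[i]) :
  complex.Re z = complex.Re w -> complex.Im z = complex.Im w -> z = w.
Proof. by case: z w => [a b] [c d] /= -> ->. Qed.

Lemma mx2_eta (M : 'M[R[i]]_2) : M = mx2 (M 0 0) (M 0 1) (M 1 0) (M 1 1).
Proof. by apply/matrixP; apply: ord2P; apply: ord2P; rewrite !mxE. Qed.

Lemma mx2_inj (p q r s p' q' r' s' : R[i]) :
  mx2 p q r s = mx2 p' q' r' s' -> [/\ p = p', q = q', r = r' & s = s'].
Proof.
move=> /matrixP h; split;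
  [move: (h 0 0)|move: (h 0 1)|move: (h 1 0)|move: (h 1 1)]; by rewrite !mxE.
Qed.

(** For a matrix of determinant one the inverse is the adjugate; comparing it
    with the conjugate transpose ties the second row to the first one. *)
Lemma valE (p : G) : val p = quat (x0 p) (x1 p) (x2 p) (x3 p).
Proof.
case: p => M; rewrite /x0 /x1 /x2 /x3 /= => /andP[/unitarymxP uM /eqP].
rewrite {1}(mx2_eta M) det_mx2 => dM.
have MN : M *m mx2 (M 1 1) (- M 0 1) (- M 1 0) (M 0 0) = 1%:M.
  rewrite {1}(mx2_eta M) mul_mx2; apply/matrixP; apply: ord2P; apply: ord2P;
    rewrite !mxE /= -1?dM ?mulr1n ?mulr0n; ring.
have E : M ^t* = mx2 (M 1 1) (- M 0 1) (- M 1 0) (M 0 0).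
  by rewrite -[LHS]mulmx1 -MN mulmxA (mulmx1C uM) mul1mx.
move: E; rewrite [LHS]mx2_eta => /mx2_inj; rewrite !mxE => -[h1 h2 h3 h4].
rewrite {1}(mx2_eta M) /quat -h1.
have -> : M 1 0 = - (M 0 1)^* by rewrite h3 opprK.
case: (M 0 0) (M 0 1) => [x y] [z t] /=.
by congr mx2; apply: complexP => //=; rewrite opprK.
Qed.

Lemma sumsq1 (p : G) : x0 p ^+ 2 + x1 p ^+ 2 + x2 p ^+ 2 + x3 p ^+ 2 = 1.
Proof.
have /andP[_ /eqP] := valP p; rewrite valE det_mx2 => /eqP.
rewrite eq_complex /= => /andP[/eqP h _]; lra.
Qed.

Lemma is_SU2_quat a b c d : a ^+ 2 + b ^+ 2 + c ^+ 2 + d ^+ 2 = 1 ->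
  is_SU2 (quat a b c d).
Proof.
move=> h; rewrite (_ : quat a b c d = mx2 (a +i* b) (c +i* d)
  (- (c +i* d)^*) ((a +i* b)^*)); first by apply: is_SU2_mx2 => /=; lra.
by rewrite /quat; congr mx2; apply: complexP => /=; rewrite ?opprK.
Qed.

Lemma SU2P (p q : G) :
  x0 p = x0 q -> x1 p = x1 q -> x2 p = x2 q -> x3 p = x3 q -> p = q.
Proof. by move=> h0 h1 h2 h3; apply/val_inj; rewrite !valE h0 h1 h2 h3. Qed.

Definition mkSU2 a b c d (h : a ^+ 2 + b ^+ 2 + c ^+ 2 + d ^+ 2 = 1) : G :=
  MkSU2 (is_SU2_quat h).

Lemma mkSU2E a b c d (h : a ^+ 2 + b ^+ 2 + c ^+ 2 + d ^+ 2 = 1) :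
  [/\ x0 (mkSU2 h) = a, x1 (mkSU2 h) = b, x2 (mkSU2 h) = c & x3 (mkSU2 h) = d].
Proof. by rewrite /x0 /x1 /x2 /x3 /= !mxE. Qed.

Local Notation "p ** q" := (SU2mul p q) (at level 40, left associativity).

(** Quaternion multiplication. *)
Lemma mulE (p q : G) :
  [/\ x0 (p ** q) = x0 p * x0 q - x1 p * x1 q - x2 p * x2 q - x3 p * x3 q,
      x1 (p ** q) = x0 p * x1 q + x1 p * x0 q + x2 p * x3 q - x3 p * x2 q,
      x2 (p ** q) = x0 p * x2 q - x1 p * x3 q + x2 p * x0 q + x3 p * x1 q &
      x3 (p ** q) = x0 p * x3 q + x1 p * x2 q - x2 p * x1 q + x3 p * x0 q].
Proof.
have E : val (p ** q) = val p *m val q by [].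
have E0 : val (p ** q) 0 0 = (x0 p * x0 q - x1 p * x1 q - x2 p * x2 q - x3 p * x3 q)
    +i* (x0 p * x1 q + x1 p * x0 q + x2 p * x3 q - x3 p * x2 q).
  by rewrite E !valE mul_mx2 !mxE; apply: complexP => /=; ring.
have E1 : val (p ** q) 0 1 = (x0 p * x2 q - x1 p * x3 q + x2 p * x0 q + x3 p * x1 q)
    +i* (x0 p * x3 q + x1 p * x2 q - x2 p * x1 q + x3 p * x0 q).
  by rewrite E !valE mul_mx2 !mxE; apply: complexP => /=; ring.
by split; rewrite ?[LHS]/x0 ?[LHS]/x1 ?[LHS]/x2 ?[LHS]/x3 ?E0 ?E1.
Qed.

Lemma SU2mulA (p q r : G) : p ** (q ** r) = p ** q ** r.
Proof. by apply/val_inj; rewrite /= mulmxA. Qed.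

Lemma SU2inv_subproof (p : G) :
  x0 p ^+ 2 + (- x1 p) ^+ 2 + (- x2 p) ^+ 2 + (- x3 p) ^+ 2 = 1.
Proof. by rewrite !sqrrN sumsq1. Qed.

Definition SU2inv (p : G) : G := mkSU2 (SU2inv_subproof p).

Lemma SU2inv_xE (p : G) :
  [/\ x0 (SU2inv p) = x0 p, x1 (SU2inv p) = - x1 p, x2 (SU2inv p) = - x2 p &
      x3 (SU2inv p) = - x3 p].
Proof. exact: mkSU2E. Qed.

Definition SU2one : G := MkSU2 (is_SU2_1 R).

Lemma SU2one_xE : [/\ x0 SU2one = 1, x1 SU2one = 0, x2 SU2one = 0 & x3 SU2one = 0].
Proof. by rewrite /x0 /x1 /x2 /x3 /= !mxE. Qed.

Lemma SU2mul1 p : p ** SU2one = p.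
Proof. by apply/val_inj; rewrite /= mulmx1. Qed.

Lemma SU2mulVp p : SU2inv p ** p = SU2one.
Proof.
have [e0 e1 e2 e3] := mulE (SU2inv p) p.
have [i0 i1 i2 i3] := SU2inv_xE p; have [u0 u1 u2 u3] := SU2one_xE.
have s := sumsq1 p.
by apply: SU2P; rewrite ?u0 ?u1 ?u2 ?u3 ?e0 ?e1 ?e2 ?e3 ?i0 ?i1 ?i2 ?i3; lra.
Qed.

Lemma SU2mulpV p : p ** SU2inv p = SU2one.
Proof.
have [e0 e1 e2 e3] := mulE p (SU2inv p).
have [i0 i1 i2 i3] := SU2inv_xE p; have [u0 u1 u2 u3] := SU2one_xE.
have s := sumsq1 p.
by apply: SU2P; rewrite ?u0 ?u1 ?u2 ?u3 ?e0 ?e1 ?e2 ?e3 ?i0 ?i1 ?i2 ?i3; lra.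
Qed.

Lemma SU2mul1p p : SU2one ** p = p.
Proof. by apply/val_inj; rewrite /= mul1mx. Qed.

Lemma SU2invM p q : SU2inv (p ** q) = SU2inv q ** SU2inv p.
Proof.
rewrite -[RHS]SU2mul1p -(SU2mulVp (p ** q)) -!SU2mulA.
by rewrite (SU2mulA q) SU2mulpV SU2mul1p SU2mulpV SU2mul1.
Qed.

Lemma SU2invK p : SU2inv (SU2inv p) = p.
Proof. by rewrite -[LHS]SU2mul1 -(SU2mulVp p) SU2mulA SU2mulVp SU2mul1p. Qed.

Definition dist2 (p q : G) : R :=
  (x0 p - x0 q) ^+ 2 + (x1 p - x1 q) ^+ 2 + (x2 p - x2 q) ^+ 2 + (x3 p - x3 q) ^+ 2.

(** Multiplication by a unit quaternion is an isometry of the four-dimensional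
    Euclidean space. *)
Lemma dist2M p q r : dist2 (r ** p) (r ** q) = dist2 p q.
Proof.
rewrite /dist2; have [-> -> -> ->] := mulE r p; have [-> -> -> ->] := mulE r q.
by rewrite -[RHS]mul1r -(sumsq1 r); ring.
Qed.

Lemma dist2Mr p q r : dist2 (p ** r) (q ** r) = dist2 p q.
Proof.
rewrite /dist2; have [-> -> -> ->] := mulE p r; have [-> -> -> ->] := mulE q r.
by rewrite -[RHS]mul1r -(sumsq1 r); ring.
Qed.

Lemma dist2V p q : dist2 (SU2inv p) (SU2inv q) = dist2 p q.
Proof.
rewrite /dist2; have [-> -> -> ->] := SU2inv_xE p.
by have [-> -> -> ->] := SU2inv_xE q; ring.
Qed.

Lemma dist2D p q r : dist2 p r <= 2 * dist2 p q + 2 * dist2 q r.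
Proof.
have h (a b c : R) : (a - c) ^+ 2 <= 2 * (a - b) ^+ 2 + 2 * (b - c) ^+ 2.
  by rewrite -subr_ge0 (_ : _ - _ = (a - 2 * b + c) ^+ 2) ?sqr_ge0//; ring.
have := h (x0 p) (x0 q) (x0 r); have := h (x1 p) (x1 q) (x1 r).
have := h (x2 p) (x2 q) (x2 r); have := h (x3 p) (x3 q) (x3 r).
rewrite /dist2; lra.
Qed.

Lemma dist2_coord p q (e : R) : 0 < e -> dist2 p q < e ^+ 2 ->
  [/\ `|x0 p - x0 q| < e, `|x1 p - x1 q| < e, `|x2 p - x2 q| < e &
      `|x3 p - x3 q| < e].
Proof.
move=> e0 h; have H (a : R) : a ^+ 2 < e ^+ 2 -> `|a| < e.
  by rewrite -real_normK ?num_real// ltr_pXn2r// ?nnegrE// ltW.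
have := sqr_ge0 (x0 p - x0 q); have := sqr_ge0 (x1 p - x1 q).
have := sqr_ge0 (x2 p - x2 q); have := sqr_ge0 (x3 p - x3 q).
by move: h; rewrite /dist2 => ? ? ? ? ?; split; apply: H; lra.
Qed.

End Quaternions.

(** * The invariant mean *)

Local Notation "p ** q" := (SU2mul p q) (at level 40, left associativity).

Section Mean.
Variable R : realType.
Local Notation G := (SU2 R).
Implicit Types (f g : G -> R) (s t : seq G) (p q x y : G).

(** The group has been given no topology: continuity is expressed with the
    chordal distance. As the group is compact, uniform continuity is the same. *)
Definition ucont f := forall e : R, 0 < e ->
  exists2 d : R, 0 < d & forall p q, dist2 p q < d -> `|f p - f q| < e.

(** Points whose coordinates lie in the same cell of a fine grid are close;
    choosing one point in each cell met by the group gives a finite net. *)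
Lemma finite_net (d : R) : 0 < d ->
  exists s, forall p, exists2 x, x \in s & dist2 x p < d.
Proof.
move=> d0; pose e := Num.min 1 d / 2.
have e0 : 0 < e by rewrite divr_gt0// lt_min ltr01.
have ed : 4 * e ^+ 2 <= d.
  have h1 : Num.min 1 d <= 1 by rewrite ge_min lexx.
  have h2 : Num.min 1 d <= d by rewrite ge_min lexx orbT.
  have h3 : 0 < Num.min 1 d by rewrite lt_min ltr01.
  rewrite /e; nra.
pose N := (Num.truncn (2 / e)).+1.
pose cell (a : R) : 'I_N := inord (Num.truncn ((a + 1) / e)).
have cellP (a b : R) : `|a| <= 1 -> `|b| <= 1 -> cell a = cell b -> `|a - b| < e.
  move=> a1 b1 /(congr1 val) /=.
  have lt1 (c : R) : `|c| <= 1 -> (Num.truncn ((c + 1) / e) < N)%N.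
    move=> c1; rewrite ltnS; apply: le_truncn.
    rewrite ler_pM2r ?invr_gt0//; move: c1; rewrite ler_norml; lra.
  have ge0 (c : R) : `|c| <= 1 -> 0 <= (c + 1) / e.
    move=> c1; rewrite divr_ge0 ?(ltW e0)//; move: c1; rewrite ler_norml; lra.
  rewrite !inordK ?lt1// => h.
  have /andP[] := truncn_itv (ge0 _ a1); have /andP[] := truncn_itv (ge0 _ b1).
  rewrite h; set n := Num.truncn _; rewrite -natr1.
  rewrite !ler_pdivlMr// !ltr_pdivrMr// ltr_norml; nra.
pose idx p := (cell (x0 p), cell (x1 p), cell (x2 p), cell (x3 p)).
have le1 p : [/\ `|x0 p| <= 1, `|x1 p| <= 1, `|x2 p| <= 1 & `|x3 p| <= 1].
  have H (a : R) : a ^+ 2 <= 1 -> `|a| <= 1.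
    by rewrite -real_normK ?num_real// -[X in _ <= X](expr1n _ 2) ler_pXn2r ?nnegrE.
  have := sqr_ge0 (x0 p); have := sqr_ge0 (x1 p); have := sqr_ge0 (x2 p).
  have := sqr_ge0 (x3 p); have := sumsq1 p.
  by move=> *; split; apply: H; lra.
exists [seq xget (SU2one R) [set x | idx x = c] | c : 'I_N * 'I_N * 'I_N * 'I_N].
move=> p; exists (xget (SU2one R) [set x | idx x = idx p]).
  exact: (codom_f (fun c => xget (SU2one R) [set x | idx x = c])).
have := @xgetPex _ (SU2one R) [set x | idx x = idx p] (ex_intro _ p erefl).
set x := xget _ _ => -[h0 h1 h2 h3].
have [a0 a1 a2 a3] := le1 x; have [b0 b1 b2 b3] := le1 p.
move: (cellP _ _ a0 b0 h0) (cellP _ _ a1 b1 h1) (cellP _ _ a2 b2 h2) (cellP _ _ a3 b3 h3).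
have H (a : R) : `|a| < e -> a ^+ 2 < e ^+ 2.
  by move=> h; rewrite -real_normK ?num_real// ltr_pXn2r ?nnegrE// ltW.
by do 4 move=> /H ?; rewrite /dist2; lra.
Qed.

Lemma ucont_bounded f : ucont f -> exists2 B, 0 < B & forall p, `|f p| <= B.
Proof.
move=> /(_ _ ltr01)[d d0 hd]; have [s hs] := finite_net d0.
exists (\sum_(x <- s) `|f x| + 1); first by rewrite ltr_wpDl// sumr_ge0.
move=> p; have [x xs xp] := hs p.
rewrite -[f p](subKr (f x)) (le_trans (ler_normB _ _))// lerD//.
  by rewrite (big_rem x xs) /= lerDl sumr_ge0.
by rewrite ltW// hd.
Qed.

Definition avg s f p : R := (\sum_(x <- s) f (x ** p)) / (size s)%:R.
Definition ravg t f p : R := (\sum_(y <- t) f (p ** y)) / (size t)%:R.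

Definition lmean f (c : R) := forall e, 0 < e ->
  exists2 s, s != [::] & forall p, `|avg s f p - c| <= e.
Definition rmean f (c : R) := forall e, 0 < e ->
  exists2 t, t != [::] & forall p, `|ravg t f p - c| <= e.

Lemma size_gt0 s : s != [::] -> 0 < (size s)%:R :> R.
Proof. by case: s => // x s _; rewrite ltr0n. Qed.

Lemma sum_cst s (c : R) : \sum_(x <- s) c = c * (size s)%:R.
Proof. by rewrite big_const_seq count_predT iter_addr addr0 mulr_natr. Qed.

Lemma avg_itv f a b s p : s != [::] -> (forall q, a <= f q <= b) ->
  a <= avg s f p <= b.
Proof.
move=> s0 h; rewrite ler_pdivlMr ?size_gt0// ler_pdivrMr ?size_gt0// -!sum_cst.
by apply/andP; split; apply: ler_sum => x _; have /andP[] := h (x ** p).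
Qed.

Lemma ravg_itv f a b t p : t != [::] -> (forall q, a <= f q <= b) ->
  a <= ravg t f p <= b.
Proof.
move=> s0 h; rewrite ler_pdivlMr ?size_gt0// ler_pdivrMr ?size_gt0// -!sum_cst.
by apply/andP; split; apply: ler_sum => x _; have /andP[] := h (p ** x).
Qed.

Lemma avg_near f c e s p : s != [::] -> (forall q, `|f q - c| <= e) ->
  `|avg s f p - c| <= e.
Proof.
move=> s0 h; rewrite ler_distl; apply: avg_itv => // q.
by rewrite -ler_distl.
Qed.

Lemma ravg_near f c e s p : s != [::] -> (forall q, `|f q - c| <= e) ->
  `|ravg s f p - c| <= e.
Proof.
move=> s0 h; rewrite ler_distl; apply: ravg_itv => // q.
by rewrite -ler_distl.
Qed.

Lemma avg_avg s t f p :
  avg t (avg s f) p = avg [seq x ** y | y <- t, x <- s] f p.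
Proof.
rewrite /avg size_allpairs natrM invfM mulrA big_allpairs_dep -mulr_suml mulrAC.
congr (_ / _ / _); apply: eq_bigr => y _; apply: eq_bigr => x _.
by rewrite SU2mulA.
Qed.

Lemma allpairs_neq0 s t : s != [::] -> t != [::] ->
  [seq x ** y | y <- t, x <- s] != [::].
Proof. by rewrite -!size_eq0 size_allpairs muln_eq0 negb_or => -> ->. Qed.

Lemma avg_ravg s t f p : avg s (ravg t f) p = ravg t (avg s f) p.
Proof.
rewrite /avg /ravg -!mulr_suml exchange_big /= mulrAC; congr (_ / _ / _).
by apply: eq_bigr => y _; apply: eq_bigr => x _; rewrite SU2mulA.
Qed.

(** Left translations are isometries, so all the averages of [f] share its
    modulus of continuity. *)
Lemma ucont_avg_mod s f d e : s != [::] ->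
  (forall p q, dist2 p q < d -> `|f p - f q| < e) ->
  forall p q, dist2 p q < d -> `|avg s f p - avg s f q| <= e.
Proof.
move=> s0 hd p q pq; rewrite /avg -mulrBl -sumrB normrM normfV.
rewrite ler_pdivrMr; last by rewrite normr_gt0 gt_eqF// size_gt0.
rewrite [X in _ * X]ger0_norm ?ler0n// -sum_cst.
apply: le_trans (ler_norm_sum _ _ _) _; apply: ler_sum => x _.
by rewrite ltW// hd// dist2M.
Qed.

Lemma ucont_avg s f : s != [::] -> ucont f -> ucont (avg s f).
Proof.
move=> s0 hf e e0; have [|d d0 hd] := hf (e / 2); first by rewrite divr_gt0.
exists d => // p q pq; apply: le_lt_trans (ucont_avg_mod s0 hd pq) _; lra.
Qed.

(** Von Neumann's argument: push the maximum of the averages of [f] as low as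
    possible. If such an average were still small somewhere, it would be small
    on a ball whose size depends on [f] only, and averaging once more over a
    net would lower the maximum below its infimum. *)
Lemma lmean_ex f : ucont f -> exists c, lmean f c.
Proof.
move=> hf; have [B B0 hB] := ucont_bounded hf.
pose S := [set c : R | exists2 s, s != [::] & forall p, avg s f p <= c].
have avgB s p : s != [::] -> - B <= avg s f p <= B.
  by move=> s0; apply: avg_itv => // q; rewrite -ler_norml.
have hS : has_inf S.
  split; first by exists B, [:: SU2one R] => // p; have /andP[] := avgB _ p (isT : [:: SU2one R] != [::]).
  exists (- B) => c [s s0 hs]; apply: le_trans (hs (SU2one R)).
  by have /andP[] := avgB s (SU2one R) s0.
exists (inf S) => e e0; set m := inf S.
have [|d d0 hd] := hf (e / 2); first by rewrite divr_gt0.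
(* [d], hence the size of the net [t], depends on [f] and [e] only. *)
have [t ht] := finite_net d0.
have t0 : t != [::].
  by have [x] := ht (SU2one R); case: (t).
have N0 : 0 < (size t)%:R :> R := size_gt0 t0.
pose h := Num.min e (e / (4 * (size t)%:R)).
have h0 : 0 < h by rewrite lt_min e0 divr_gt0// mulr_gt0.
have he : h <= e by rewrite ge_min lexx.
have hN : h * (4 * (size t)%:R) <= e.
  by rewrite -ler_pdivlMr ?mulr_gt0// ge_min lexx orbT.
have [c [s s0 hs] hc] := inf_adherent h0 hS.
have top p : avg s f p <= m + h by apply: le_trans (hs p) (ltW hc).
exists s => // p0; rewrite ler_distl; apply/andP; split; last by rewrite (le_trans (top p0))// lerD2l.
rewrite leNgt; apply/negP => low.
suff : m <= m + h - e / 2 / (size t)%:R.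
  have : h < e / 2 / (size t)%:R by rewrite ltr_pdivlMr//; lra.
  lra.
apply: ge_inf; first by case: hS.
exists [seq x ** y | y <- t, x <- s]; first exact: allpairs_neq0.
move=> p; rewrite -avg_avg {1}/avg ler_pdivrMr// mulrBl divfK ?gt_eqF// -sum_cst.
(* One of the translates of [p] by the net falls next to the low point [p0]. *)
have [y yt hy] := ht (p0 ** SU2inv p).
rewrite (big_rem y yt) /= [X in _ <= X - _](big_rem y yt) /=.
have hsum : \sum_(x <- rem y t) avg s f (x ** p) <= \sum_(x <- rem y t) (m + h).
  by apply: ler_sum => x _; exact: top.
have : dist2 (y ** p) p0 < d.
  by rewrite -(dist2Mr _ _ (SU2inv p)) -SU2mulA SU2mulpV SU2mul1.
move=> /(ucont_avg_mod s0 hd); rewrite ler_distl => /andP[_]; move: low hsum; lra.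
Qed.

Definition precomp_inv f p := f (SU2inv p).

Lemma ucont_precomp_inv f : ucont f -> ucont (precomp_inv f).
Proof.
move=> hf e /hf[d d0 hd]; exists d => // p q pq; apply: hd.
by rewrite dist2V.
Qed.

Lemma rmean_ex f : ucont f -> exists c, rmean f c.
Proof.
move=> /ucont_precomp_inv/lmean_ex[c hc]; exists c => e /hc[s s0 hs].
exists [seq SU2inv x | x <- s]; first by case: (s) s0.
move=> p; rewrite /ravg size_map big_map (eq_bigr (fun x => precomp_inv f (x ** SU2inv p))).
  exact: hs.
by move=> x _; rewrite /precomp_inv SU2invM SU2invK.
Qed.

(** Left and right averages commute, so a constant that left averages approach
    agrees with one that right averages approach; hence both are unique. *)
Lemma lmean_rmean f c d : lmean f c -> rmean f d -> c = d.
Proof.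
move=> hc hd; apply/eqP; rewrite -subr_eq0 -normr_le0; apply/ler_addgt0Pr => e e0.
have e2 : 0 < e / 2 by rewrite divr_gt0.
have [s s0 hs] := hc _ e2; have [t t0 ht] := hd _ e2.
have h1 := ravg_near (SU2one R) t0 hs; have h2 := avg_near (SU2one R) s0 ht.
rewrite avg_ravg in h2; rewrite add0r (le_trans (ler_distD (ravg t (avg s f) (SU2one R)) _ _))//.
by rewrite [e]splitr lerD// distrC.
Qed.

Lemma rmean_avg s f d : s != [::] -> rmean f d -> rmean (avg s f) d.
Proof.
move=> s0 hd e /hd[t t0 ht]; exists t => // p.
by rewrite -avg_ravg; apply: avg_near.
Qed.

Definition haar f : R := xget 0 (lmean f).

Lemma lmean_haar f : ucont f -> lmean f (haar f).
Proof. by move=> /lmean_ex[c hc]; apply: (xgetI 0 hc). Qed.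

Lemma haar_uniq f c : ucont f -> lmean f c -> haar f = c.
Proof.
move=> hf hc; have [d hd] := rmean_ex hf.
by rewrite (lmean_rmean hc hd); apply: lmean_rmean hd; apply: lmean_haar.
Qed.

Lemma ucontD f g : ucont f -> ucont g -> ucont (fun p => f p + g p).
Proof.
move=> hf hg e e0; have e2 : 0 < e / 2 by rewrite divr_gt0.
have [d d0 hd] := hf _ e2; have [d' d0' hd'] := hg _ e2.
exists (Num.min d d') => [|p q]; first by rewrite lt_min d0.
rewrite lt_min => /andP[/hd h1 /hd' h2]; rewrite opprD addrACA.
by rewrite (le_lt_trans (ler_normD _ _))// [e]splitr ltrD.
Qed.

Lemma ucont_cst (c : R) : ucont (fun=> c).
Proof. by move=> e e0; exists 1 => // p q _; rewrite subrr normr0. Qed.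

Lemma ucontM f g : ucont f -> ucont g -> ucont (fun p => f p * g p).
Proof.
move=> hf hg e e0.
have [A A0 hA] := ucont_bounded hf; have [B B0 hB] := ucont_bounded hg.
have [|d d0 hd] := hf (e / 2 / B); first by rewrite !divr_gt0.
have [|d' d0' hd'] := hg (e / 2 / A); first by rewrite !divr_gt0.
exists (Num.min d d') => [|p q]; first by rewrite lt_min d0.
rewrite lt_min => /andP[/hd h1 /hd' h2].
have -> : f p * g p - f q * g q = f p * (g p - g q) + (f p - f q) * g q by ring.
rewrite (le_lt_trans (ler_normD _ _))// [e]splitr !normrM; apply: ltrD.
  by apply: le_lt_trans (ler_wpM2r _ (hA p)) _; rewrite // mulrC -ltr_pdivlMr.
by apply: le_lt_trans (ler_wpM2l _ (hB q)) _; rewrite // -ltr_pdivlMr.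
Qed.

End Mean.

Section MeanTheory.
Variable R : realType.
Local Notation G := (SU2 R).
Implicit Types (f g : G -> R) (p q h : G).

Lemma ucont_ext f g : f =1 g -> ucont f -> ucont g.
Proof. by move=> /funext ->. Qed.

Lemma ucontZ (c : R) f : ucont f -> ucont (fun p => c * f p).
Proof. by move=> hf; apply: ucontM => //; exact: ucont_cst. Qed.

Lemma ucontB f g : ucont f -> ucont g -> ucont (fun p => f p - g p).
Proof.
move=> hf hg; apply: (ucont_ext (f := fun p => f p + -1 * g p)).
  by move=> p; rewrite mulN1r.
by apply: ucontD => //; exact: ucontZ.
Qed.

Lemma ucontX f n : ucont f -> ucont (fun p => f p ^+ n).
Proof.
move=> hf; elim: n => [|n IH]; first exact: ucont_cst.
by apply: (ucont_ext (f := fun p => f p * f p ^+ n)) => [p|]; [rewrite exprS|exact: ucontM].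
Qed.

Lemma ucont_sum (I : Type) (r : seq I) (F : I -> G -> R) :
  (forall i, ucont (F i)) -> ucont (fun p => \sum_(i <- r) F i p).
Proof.
move=> hF; elim: r => [|i r IH].
  by apply: ucont_ext (ucont_cst 0) => p; rewrite big_nil.
by apply: ucont_ext (ucontD (hF i) IH) => p; rewrite big_cons.
Qed.

Lemma ucont_mulr f h : ucont f -> ucont (fun p => f (p ** h)).
Proof.
by move=> hf e /hf[d d0 hd]; exists d => // p q pq; apply: hd; rewrite dist2Mr.
Qed.

Lemma ucont_coord : [/\ ucont (@x0 R), ucont (@x1 R), ucont (@x2 R) & ucont (@x3 R)].
Proof.
by split=> e e0; exists (e ^+ 2); rewrite ?exprn_gt0// => p q /(dist2_coord e0)[].
Qed.

Lemma avgD f g s p : avg s (fun p => f p + g p) p = avg s f p + avg s g p.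
Proof. by rewrite /avg big_split mulrDl. Qed.

Lemma avgZ (c : R) f s p : avg s (fun p => c * f p) p = c * avg s f p.
Proof. by rewrite /avg -mulr_sumr mulrA. Qed.

(** Left averages of [g] do not change its mean, so one can first average [f]
    to a constant and then [g], without spoiling the former. *)
Lemma haarD f g : ucont f -> ucont g -> haar (fun p => f p + g p) = haar f + haar g.
Proof.
move=> hf hg; apply: haar_uniq; first exact: ucontD.
move=> e e0; have e2 : 0 < e / 2 by rewrite divr_gt0.
have [s s0 hs] := lmean_haar hf e2.
have [d hd] := rmean_ex hg; have := rmean_avg s0 hd.
rewrite -(lmean_rmean (lmean_haar hg) hd) => /(lmean_rmean _) hd'.
have hg' : haar (avg s g) = haar g.
  by rewrite (hd' (haar (avg s g)))//; apply: lmean_haar; apply: ucont_avg.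
have [t t0 ht] := lmean_haar (ucont_avg s0 hg) e2.
exists [seq x ** y | y <- t, x <- s] => [|p]; first exact: allpairs_neq0.
rewrite avgD -!avg_avg opprD addrACA -hg' (le_trans (ler_normD _ _))//.
by rewrite [e]splitr lerD//; apply: avg_near.
Qed.

Lemma haarZ (c : R) f : ucont f -> haar (fun p => c * f p) = c * haar f.
Proof.
move=> hf; apply: haar_uniq; first exact: ucontZ.
have c0 : 0 < `|c| + 1 by rewrite ltr_wpDl.
move=> e e0; have [|s s0 hs] := lmean_haar hf (e := e / (`|c| + 1)); first by rewrite divr_gt0.
exists s => // p; rewrite avgZ -mulrBr normrM.
have := hs p; rewrite ler_pdivlMr// => /(le_trans _); apply.
by rewrite mulrC ler_wpM2l// lerDl.
Qed.

Lemma haar_cst (c : R) : haar (fun=> c) = c.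
Proof.
apply: haar_uniq; first exact: ucont_cst.
move=> e e0; exists [:: SU2one R] => // p.
by rewrite /avg big_seq1 divr1 subrr normr0 ltW.
Qed.

Lemma haarB f g : ucont f -> ucont g -> haar (fun p => f p - g p) = haar f - haar g.
Proof.
move=> hf hg; rewrite -[- haar g]mulN1r -(haarZ _ hg) -haarD//; last exact: ucontZ.
by congr haar; apply/funext => p; rewrite mulN1r.
Qed.

Lemma haar_sum (I : Type) (r : seq I) (F : I -> G -> R) :
  (forall i, ucont (F i)) -> haar (fun p => \sum_(i <- r) F i p) = \sum_(i <- r) haar (F i).
Proof.
move=> hF; elim: r => [|i r IH].
  by rewrite big_nil -[RHS](haar_cst 0); congr haar; apply/funext => p; rewrite big_nil.
rewrite big_cons -IH -haarD//; last exact: ucont_sum.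
by congr haar; apply/funext => p; rewrite big_cons.
Qed.

Lemma haar_ge0 f : ucont f -> (forall p, 0 <= f p) -> 0 <= haar f.
Proof.
move=> hf f0; apply/ler_addgt0Pr => e e0; have [s s0 hs] := lmean_haar hf e0.
have := hs (SU2one R); rewrite ler_distl => /andP[_]; apply: le_trans.
by rewrite divr_ge0// sumr_ge0.
Qed.

Lemma haar_le f g : ucont f -> ucont g -> (forall p, f p <= g p) -> haar f <= haar g.
Proof.
move=> hf hg fg; rewrite -subr_ge0 -haarB//; apply: haar_ge0; first exact: ucontB.
by move=> p; rewrite subr_ge0.
Qed.

Lemma haar_norm_le f (e : R) : ucont f -> (forall p, `|f p| <= e) -> `|haar f| <= e.
Proof.
move=> hf fe; rewrite ler_norml -{1}[- e]haar_cst -[X in _ && (_ <= X)]haar_cst.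
by apply/andP; split; apply: haar_le => //; try exact: ucont_cst;
  move=> p; have := fe p; rewrite ler_norml => /andP[].
Qed.

(** Left averages commute with right translations. *)
Lemma haar_mulr f h : ucont f -> haar (fun p => f (p ** h)) = haar f.
Proof.
move=> hf; apply: haar_uniq; first exact: ucont_mulr.
move=> e /(lmean_haar hf)[s s0 hs]; exists s => // p.
by have := hs (p ** h); rewrite /avg; under eq_bigr do rewrite SU2mulA.
Qed.

End MeanTheory.

(** * Left-invariant derivatives *)

Section Derivatives.
Variable R : realType.
Local Notation G := (SU2 R).
Implicit Types (f g : G -> R) (p q h : G) (j : 'I_3).

Lemma ord3P (P : 'I_3 -> Prop) : P 0 -> P 1 -> P 2%:R -> forall j, P j.
Proof.
move=> P0 P1 P2 -[[|[|[|//]]] Hj].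
- by rewrite (_ : Ordinal Hj = 0)//; apply/val_inj.
- by rewrite (_ : Ordinal Hj = 1)//; apply/val_inj.
- by rewrite (_ : Ordinal Hj = 2%:R)//; apply/val_inj.
Qed.

Lemma flow_subproof j (t : R) : cos t ^+ 2 + (sin t * (j == 0)%:R) ^+ 2 +
  (sin t * (j == 1)%:R) ^+ 2 + (sin t * (j == 2%:R)%:R) ^+ 2 = 1.
Proof.
by rewrite -[RHS](cos2Dsin2 t); move: j; apply: ord3P => /=; ring.
Qed.

Definition flow j (t : R) : G := mkSU2 (flow_subproof j t).

Lemma flow_xE j t : [/\ x0 (flow j t) = cos t, x1 (flow j t) = sin t * (j == 0)%:R,
  x2 (flow j t) = sin t * (j == 1)%:R & x3 (flow j t) = sin t * (j == 2%:R)%:R].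
Proof. exact: mkSU2E. Qed.

Lemma flow0 j : flow j 0 = SU2one R.
Proof.
have [a0 a1 a2 a3] := flow_xE j 0; have [b0 b1 b2 b3] := SU2one_xE R.
by apply: SU2P; rewrite ?a0 ?a1 ?a2 ?a3 ?b0 ?b1 ?b2 ?b3 ?cos0 ?sin0 ?mul0r.
Qed.

Lemma flowD j s t : flow j (s + t) = flow j s ** flow j t.
Proof.
have [a0 a1 a2 a3] := flow_xE j (s + t); have [b0 b1 b2 b3] := flow_xE j s.
have [c0 c1 c2 c3] := flow_xE j t; have [d0 d1 d2 d3] := mulE (flow j s) (flow j t).
apply: SU2P; rewrite ?a0 ?a1 ?a2 ?a3 ?d0 ?d1 ?d2 ?d3 ?b0 ?b1 ?b2 ?b3 ?c0 ?c1 ?c2 ?c3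
  ?cosD ?sinD; move: j {a0 a1 a2 a3 b0 b1 b2 b3 c0 c1 c2 c3 d0 d1 d2 d3};
  by apply: ord3P => /=; ring.
Qed.

(** [f'] is the derivative of [f] along the left-invariant field generated by
    the [j]-th basis vector of the Lie algebra. *)
Definition isder j f f' := forall p,
  is_derive (0 : R) 1 (fun t : R => f (p ** flow j t)) (f' p).

Lemma isder_at j f f' p (t : R) : isder j f f' ->
  is_derive t 1 (fun s : R => f (p ** flow j s)) (f' (p ** flow j t)).
Proof.
move=> h; have := h (p ** flow j t).
rewrite -{1}(subrr t) => h1.
have := @is_derive1_comp R _ (shift (- t)) t _ _ h1 (is_derive_shift t 1 (- t)).
rewrite mulr1 [X in is_derive _ _ X _](_ : _ = fun s => f (p ** flow j s))//.
by apply/funext => s /=; rewrite -SU2mulA -flowD addrC subrK.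
Qed.

Lemma dist2_flow p j t : dist2 p (p ** flow j t) = 2 - 2 * cos t.
Proof.
rewrite -{1}(SU2mul1 p) dist2M /dist2; have [-> -> -> ->] := SU2one_xE R.
have [-> -> -> ->] := flow_xE j t; have := cos2Dsin2 t.
by move: j; apply: ord3P => /= h; lra.
Qed.

(** Invariance of the mean, differentiated: difference quotients of [f] have
    mean zero and converge uniformly to [f']. *)
Lemma haar_isder j f f' : ucont f -> ucont f' -> isder j f f' -> haar f' = 0.
Proof.
move=> hf hf' df; apply/eqP; rewrite -normr_le0; apply/ler_addgt0Pr => e e0.
rewrite add0r; have [d d0 hd] := hf' e e0.
have [t t0 ht] : exists2 t : R, 0 < t & forall s, 0 <= s <= t -> 2 - 2 * cos s < d.
  have /cvgrPdist_lt/(_ (d / 2)) := @continuous_cos R 0; rewrite cos0.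
  rewrite divr_gt0// => /(_ isT)[r /= r0 hr]; exists (r / 2); first by rewrite divr_gt0.
  move=> s /andP[s0 s1]; have := hr s; rewrite /= sub0r normrN ger0_norm//.
  have -> : s < r by lra.
  by move=> /(_ isT); rewrite ltr_distl; lra.
have q0 : haar (fun p => (f (p ** flow j t) - f p) / t) = 0.
  transitivity (haar (fun p => t^-1 * (f (p ** flow j t) - f p))).
    by congr haar; apply/funext => p; rewrite mulrC.
  have h1 : ucont (fun p => f (p ** flow j t)) by exact: ucont_mulr.
  by rewrite haarZ ?haarB ?haar_mulr ?subrr ?mulr0//; exact: ucontB.
have hq : ucont (fun p => (f (p ** flow j t) - f p) / t).
  apply: ucontM; last exact: ucont_cst.
  by apply: ucontB => //; exact: ucont_mulr.
rewrite -[haar f']subr0 -q0 -haarB//; apply: haar_norm_le; first exact: ucontB.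
move=> p; have [] := @MVT R (fun s => f (p ** flow j s)) (fun s => f' (p ** flow j s)) 0 t t0.
- by move=> s _; exact: isder_at.
- apply: derivable_within_continuous => s _.
  exact: (@ex_derive _ _ _ _ _ _ _ (isder_at p s df)).
move=> s; rewrite in_itv /= => /andP[s0 s1].
rewrite flow0 SU2mul1 subr0 => ->; rewrite mulfK ?gt_eqF//.
by rewrite ltW// hd// dist2_flow ht// !ltW.
Qed.

Lemma isderD j f f' g g' : isder j f f' -> isder j g g' ->
  isder j (fun p => f p + g p) (fun p => f' p + g' p).
Proof. by move=> hf hg p; apply: is_deriveD. Qed.

Lemma isder_cst j (c : R) : isder j (fun=> c) (fun=> 0).
Proof. by move=> p; apply: is_derive_cst. Qed.

Lemma isderM j f f' g g' : isder j f f' -> isder j g g' ->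
  isder j (fun p => f p * g p) (fun p => f p * g' p + f' p * g p).
Proof.
move=> hf hg p; have := is_deriveM (hf p) (hg p).
by rewrite !flow0 !SU2mul1 /GRing.scale /= [g p * _]mulrC.
Qed.

Lemma isder_eq j f f' g' : isder j f f' -> f' =1 g' -> isder j f g'.
Proof. by move=> h /funext <-. Qed.

Lemma isder_uniq j f f' g' : isder j f f' -> isder j f g' -> f' =1 g'.
Proof.
move=> h1 h2 p; rewrite -(@derive_val _ _ _ _ _ _ _ (h1 p)).
exact: (@derive_val _ _ _ _ _ _ _ (h2 p)).
Qed.

(** The quaternion coordinates are differentiated by right multiplication by
    the imaginary units. *)
Lemma isder_coord :
  [/\ isder 0 (@x0 R) (fun p => - x1 p), isder 0 (@x1 R) (@x0 R),
      isder 0 (@x2 R) (@x3 R) & isder 0 (@x3 R) (fun p => - x2 p)] /\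
  [/\ isder 1 (@x0 R) (fun p => - x2 p), isder 1 (@x1 R) (fun p => - x3 p),
      isder 1 (@x2 R) (@x0 R) & isder 1 (@x3 R) (@x1 R)] /\
  [/\ isder 2%:R (@x0 R) (fun p => - x3 p), isder 2%:R (@x1 R) (@x2 R),
      isder 2%:R (@x2 R) (fun p => - x1 p) & isder 2%:R (@x3 R) (@x0 R)].
Proof.
have key (a b : R) : is_derive (0 : R) 1 (fun t => a * cos t + b * sin t) b.
  have -> : (fun t => a * cos t + b * sin t) = a \*: cos \+ b \*: (sin : R -> R) by [].
  apply: is_derive_eq; rewrite sin0 cos0 oppr0 scaler0 add0r /GRing.scale /=.
  by rewrite mulr1.
have E j p : [/\ forall t, x0 (p ** flow j t) = x0 p * cos t +
    (- x1 p * (j == 0)%:R - x2 p * (j == 1)%:R - x3 p * (j == 2%:R)%:R) * sin t,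
    forall t, x1 (p ** flow j t) = x1 p * cos t +
    (x0 p * (j == 0)%:R - x3 p * (j == 1)%:R + x2 p * (j == 2%:R)%:R) * sin t,
    forall t, x2 (p ** flow j t) = x2 p * cos t +
    (x3 p * (j == 0)%:R + x0 p * (j == 1)%:R - x1 p * (j == 2%:R)%:R) * sin t &
    forall t, x3 (p ** flow j t) = x3 p * cos t +
    (- x2 p * (j == 0)%:R + x1 p * (j == 1)%:R + x0 p * (j == 2%:R)%:R) * sin t].
  split=> t; have [e0 e1 e2 e3] := mulE p (flow j t); rewrite ?e0 ?e1 ?e2 ?e3;
    by have [-> -> -> ->] := flow_xE j t; ring.
split; [|split]; split=> p.
all: match goal with |- is_derive _ _ (fun t => _ (?p ** flow ?j t)) _ =>
  have [/funext e0 /funext e1 /funext e2 /funext e3] := E j p end.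
all: rewrite ?e0 ?e1 ?e2 ?e3 /=; apply: is_derive_eq (key _ _) _; ring.
Qed.
End Derivatives.

(** * Complex-valued functions *)

Section ComplexFunctions.
Variable R : realType.
Local Notation G := (SU2 R).
Local Notation C := R[i].
Local Notation Re := complex.Re.
Local Notation Im := complex.Im.
Implicit Types (F H : G -> C) (p q h : G) (j : 'I_3).

Lemma ReD (z w : C) : Re (z + w) = Re z + Re w. Proof. by case: z w => [??] []. Qed.
Lemma ImD (z w : C) : Im (z + w) = Im z + Im w. Proof. by case: z w => [??] []. Qed.
Lemma ReM (z w : C) : Re (z * w) = Re z * Re w - Im z * Im w.
Proof. by case: z w => [??] []. Qed.
Lemma ImM (z w : C) : Im (z * w) = Re z * Im w + Im z * Re w.
Proof. by case: z w => [??] []. Qed.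

Definition ucontC F := ucont (fun p => Re (F p)) /\ ucont (fun p => Im (F p)).
Definition haarC F : C := haar (fun p => Re (F p)) +i* haar (fun p => Im (F p)).
Definition isderc j F F' := isder j (fun p => Re (F p)) (fun p => Re (F' p)) /\
  isder j (fun p => Im (F p)) (fun p => Im (F' p)).

Lemma ucontC_cst (c : C) : ucontC (fun=> c).
Proof. by split; apply: ucont_cst. Qed.

Lemma ucontC_ext F H : F =1 H -> ucontC F -> ucontC H.
Proof. by move=> /funext ->. Qed.

Lemma ucontCD F H : ucontC F -> ucontC H -> ucontC (fun p => F p + H p).
Proof.
move=> [f1 f2] [h1 h2]; split.
  by apply: ucont_ext (ucontD f1 h1) => p; rewrite ReD.
by apply: ucont_ext (ucontD f2 h2) => p; rewrite ImD.
Qed.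

Lemma ucontCM F H : ucontC F -> ucontC H -> ucontC (fun p => F p * H p).
Proof.
move=> [f1 f2] [h1 h2]; split.
  by apply: ucont_ext (ucontB (ucontM f1 h1) (ucontM f2 h2)) => p; rewrite ReM.
by apply: ucont_ext (ucontD (ucontM f1 h2) (ucontM f2 h1)) => p; rewrite ImM.
Qed.

Lemma ucontCZ (c : C) F : ucontC F -> ucontC (fun p => c * F p).
Proof. by apply: ucontCM; apply: ucontC_cst. Qed.

Lemma ucontCX F n : ucontC F -> ucontC (fun p => F p ^+ n).
Proof.
move=> hF; elim: n => [|n IH]; first exact: ucontC_cst.
by apply: ucontC_ext (ucontCM hF IH) => p; rewrite exprS.
Qed.

Lemma ucontC_real (f : G -> R) : ucont f -> ucontC (fun p => (f p)%:C).
Proof. by move=> hf; split => //; exact: ucont_cst. Qed.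

Lemma ucontC_sum (I : Type) (r : seq I) (F : I -> G -> C) :
  (forall i, ucontC (F i)) -> ucontC (fun p => \sum_(i <- r) F i p).
Proof.
move=> hF; elim: r => [|i r IH].
  by apply: ucontC_ext (ucontC_cst 0) => p; rewrite big_nil.
by apply: ucontC_ext (ucontCD (hF i) IH) => p; rewrite big_cons.
Qed.

Lemma haarC_D F H : ucontC F -> ucontC H -> haarC (fun p => F p + H p) = haarC F + haarC H.
Proof.
move=> [f1 f2] [h1 h2]; rewrite /haarC; apply: complexP; rewrite ?ReD ?ImD /= -haarD//;
  by congr haar; apply/funext => p; rewrite ?ReD ?ImD.
Qed.

Lemma haarC_Z (c : C) F : ucontC F -> haarC (fun p => c * F p) = c * haarC F.
Proof.
move=> [f1 f2]; rewrite /haarC; apply: complexP; rewrite ?ReM ?ImM /= -!haarZ//.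
  rewrite -haarB; try exact: ucontZ.
  by congr haar; apply/funext => p; rewrite ReM.
rewrite -haarD; try exact: ucontZ.
by congr haar; apply/funext => p; rewrite ImM.
Qed.

Lemma eq_haarC F H : F =1 H -> haarC F = haarC H.
Proof. by move=> /funext ->. Qed.

Lemma haarC_cst (c : C) : haarC (fun=> c) = c.
Proof. by rewrite /haarC !haar_cst; case: c. Qed.

Lemma haarC_sum (I : Type) (r : seq I) (F : I -> G -> C) :
  (forall i, ucontC (F i)) -> haarC (fun p => \sum_(i <- r) F i p) = \sum_(i <- r) haarC (F i).
Proof.
move=> hF; elim: r => [|i r IH].
  rewrite big_nil -[RHS](haarC_cst 0).
  by apply: eq_haarC => p; rewrite big_nil.
rewrite big_cons -IH -haarC_D//; last exact: ucontC_sum.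
by apply: eq_haarC => p; rewrite big_cons.
Qed.

Lemma haarC_real (f : G -> R) : haarC (fun p => (f p)%:C) = (haar f)%:C.
Proof. by rewrite /haarC /= haar_cst. Qed.

Lemma isderc_eq j F F' H : isderc j F F' -> F' =1 H -> isderc j F H.
Proof. by move=> h /funext <-. Qed.

Lemma isderc_cst j (c : C) : isderc j (fun=> c) (fun=> 0).
Proof. by split; apply: isder_cst. Qed.

Lemma isdercD j F F' H H' : isderc j F F' -> isderc j H H' ->
  isderc j (fun p => F p + H p) (fun p => F' p + H' p).
Proof.
move=> [f1 f2] [h1 h2]; split.
  have E : (fun p => Re (F p + H p)) = fun p => Re (F p) + Re (H p).
    by apply/funext => p; rewrite ReD.
  by rewrite E; apply: isder_eq (isderD f1 h1) _ => p; rewrite ReD.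
have E : (fun p => Im (F p + H p)) = fun p => Im (F p) + Im (H p).
  by apply/funext => p; rewrite ImD.
by rewrite E; apply: isder_eq (isderD f2 h2) _ => p; rewrite ImD.
Qed.

Lemma isdercM j F F' H H' : isderc j F F' -> isderc j H H' ->
  isderc j (fun p => F p * H p) (fun p => F p * H' p + F' p * H p).
Proof.
move=> [f1 f2] [h1 h2]; split.
  have k := isderD (isderM f1 h1) (isderM (isderM (isder_cst j (-1)) f2) h2).
  have E : (fun p => Re (F p * H p)) =
      fun p => Re (F p) * Re (H p) + -1 * Im (F p) * Im (H p).
    by apply/funext => p; rewrite ReM; ring.
  by rewrite E; apply: isder_eq k _ => p; rewrite ReD !ReM; ring.
have k := isderD (isderM f1 h2) (isderM f2 h1).
have E : (fun p => Im (F p * H p)) =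
    fun p => Re (F p) * Im (H p) + Im (F p) * Re (H p).
  by apply/funext => p; rewrite ImM.
by rewrite E; apply: isder_eq k _ => p; rewrite ImD !ImM; ring.
Qed.

Lemma isdercZ j (c : C) F F' : isderc j F F' ->
  isderc j (fun p => c * F p) (fun p => c * F' p).
Proof.
move=> /(isdercM (isderc_cst j c)) h; apply: isderc_eq h _ => p.
by rewrite mul0r addr0.
Qed.

Lemma isdercX j F F' n : isderc j F F' ->
  isderc j (fun p => F p ^+ n) (fun p => n%:R * F p ^+ n.-1 * F' p).
Proof.
move=> h; elim: n => [|n IH].
  by apply: isderc_eq (isderc_cst j 1) _ => p; rewrite !mul0r.
have E : (fun p => F p ^+ n.+1) = fun p => F p * F p ^+ n.
  by apply/funext => p; rewrite exprS.
rewrite E; apply: isderc_eq (isdercM h IH) _ => p /=.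
case: n {IH E} => [|n]; first by rewrite !expr0; ring.
by rewrite /= exprS [in RHS]mulrSr; ring.
Qed.

Lemma isderc_real j (f f' : G -> R) : isder j f f' ->
  isderc j (fun p => (f p)%:C) (fun p => (f' p)%:C).
Proof. by move=> h; split => //=; exact: isder_cst. Qed.

Lemma haarC_isder j F F' : ucontC F -> ucontC F' -> isderc j F F' -> haarC F' = 0.
Proof.
move=> [f1 f2] [g1 g2] [d1 d2]; rewrite /haarC.
by rewrite (haar_isder f1 g1 d1) (haar_isder f2 g2 d2).
Qed.

Lemma haarC_by_parts j F F' H H' : ucontC F -> ucontC F' -> ucontC H -> ucontC H' ->
  isderc j F F' -> isderc j H H' ->
  haarC (fun p => F p * H' p) = - haarC (fun p => F' p * H p).
Proof.
move=> uF uF' uH uH' dF dH; apply/eqP; rewrite -addr_eq0 -haarC_D; try exact: ucontCM.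
rewrite (haarC_isder (ucontCM uF uH) _ (isdercM dF dH))//.
by apply: ucontCD; apply: ucontCM.
Qed.

(** ** Eigenfunctions on the group *)

(** The operator is minus the sum of the squares of the basis fields scaled by
    [w]. Carrying the derivatives as data treats smooth functions and polynomials
    in the coordinates alike. *)
Definition eigfun (w : 'I_3 -> R) (mu : R) (f : G -> R) := ucont f /\
  exists f1 f2 : 'I_3 -> G -> R,
    (forall j, [/\ ucont (f1 j), ucont (f2 j), isder j f (f1 j) & isder j (f1 j) (f2 j)]) /\
    forall p, \sum_j w j ^+ 2 * f2 j p = - mu * f p.

(** Two integrations by parts move the operator from the eigenfunction to the
    test function. *)
Lemma eigfun_green w mu f (H : G -> C) (H1 H2 : 'I_3 -> G -> C) :
  eigfun w mu f -> ucontC H ->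
  (forall j, [/\ ucontC (H1 j), ucontC (H2 j), isderc j H (H1 j) & isderc j (H1 j) (H2 j)]) ->
  \sum_j (w j ^+ 2)%:C * haarC (fun p => (f p)%:C * H2 j p) =
  - mu%:C * haarC (fun p => (f p)%:C * H p).
Proof.
move=> [uf [f1 [f2 [hf ef]]]] uH hH.
have E j : haarC (fun p => (f p)%:C * H2 j p) = haarC (fun p => (f2 j p)%:C * H p).
  have [u1 u2 d1 d2] := hf j; have [v1 v2 e1 e2] := hH j.
  rewrite (@haarC_by_parts j _ (fun p => (f1 j p)%:C) (H1 j));
    try (by [|apply: ucontC_real|apply: isderc_real]).
  rewrite (@haarC_by_parts j _ (fun p => (f2 j p)%:C) H) ?opprK//;
    by [apply: ucontC_real|apply: isderc_real].
have u j : ucontC (fun p => (f2 j p)%:C * H p).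
  by apply: ucontCM => //; apply: ucontC_real; case: (hf j).
under eq_bigr do rewrite E -haarC_Z//.
rewrite -haarC_sum; last by move=> j; exact: ucontCZ.
rewrite -haarC_Z; last by apply: ucontCM => //; exact: ucontC_real.
apply: eq_haarC => p; rewrite mulrA -[- mu%:C]rmorphN -rmorphM -ef rmorph_sum mulr_suml.
by apply: eq_bigr => j _; rewrite [in LHS]mulrA -[in LHS]rmorphM.
Qed.

(** ** Matrix coefficients *)

(** The rows of the matrix [p] are (ma, mb) and (- mb', ma'), the primes standing
    for complex conjugation. *)
Definition ma p : C := x0 p +i* x1 p.
Definition mb p : C := x2 p +i* x3 p.
Definition ma' p : C := x0 p -i* x1 p.
Definition mb' p : C := x2 p -i* x3 p.

(** [xi u v] and [eta u v] are the coordinates of the row vector [(u, v) p] in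
    the eigenbasis of the right multiplication by the third basis vector. *)
Definition xi (u v : C) p : C := u * (ma p + mb p) + v * (ma' p + - 1 * mb' p).
Definition eta (u v : C) p : C := u * (ma p + - 1 * mb p) + v * (-1 * ma' p + -1 * mb' p).

Local Notation Ci := ('i : C).

Lemma ucontC_ab : [/\ ucontC ma, ucontC mb, ucontC ma' & ucontC mb'].
Proof.
have [h0 h1 h2 h3] := ucont_coord R.
have n (f : G -> R) : ucont f -> ucont (fun p => - f p).
  by move=> hf; apply: ucont_ext (ucontZ (-1) hf) => p; rewrite mulN1r.
by split; split => //=; exact: n.
Qed.

Lemma ucontC_xi u v : ucontC (xi u v).
Proof.
have [h0 h1 h2 h3] := ucontC_ab.
by apply: ucontCD; apply: ucontCZ; apply: ucontCD => //; apply: ucontCZ.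
Qed.

Lemma ucontC_eta u v : ucontC (eta u v).
Proof.
have [h0 h1 h2 h3] := ucontC_ab.
by apply: ucontCD; apply: ucontCZ; apply: ucontCD => //; apply: ucontCZ.
Qed.

Lemma isderc_ab :
  [/\ isderc 0 ma (fun p => Ci * ma p), isderc 0 mb (fun p => - Ci * mb p),
      isderc 0 ma' (fun p => - Ci * ma' p) & isderc 0 mb' (fun p => Ci * mb' p)] /\
  [/\ isderc 1 ma (fun p => - mb p), isderc 1 mb ma,
      isderc 1 ma' (fun p => - mb' p) & isderc 1 mb' ma'] /\
  [/\ isderc 2%:R ma (fun p => Ci * mb p), isderc 2%:R mb (fun p => Ci * ma p),
      isderc 2%:R ma' (fun p => - Ci * mb' p) & isderc 2%:R mb' (fun p => - Ci * ma' p)].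
Proof.
have [[a0 a1 a2 a3] [[b0 b1 b2 b3] [c0 c1 c2 c3]]] := isder_coord R.
have neg j (f f' : G -> R) : isder j f f' -> isder j (fun p => - f p) (fun p => - f' p).
  move=> h p; exact: is_deriveN (h p).
split; [|split]; split; split.
all: [> apply: isder_eq a0 _|apply: isder_eq a1 _|apply: isder_eq a2 _
  |apply: isder_eq a3 _|apply: isder_eq a0 _|apply: isder_eq (neg _ _ _ a1) _
  |apply: isder_eq a2 _|apply: isder_eq (neg _ _ _ a3) _
  |apply: isder_eq b0 _|apply: isder_eq b1 _|apply: isder_eq b2 _
  |apply: isder_eq b3 _|apply: isder_eq b0 _|apply: isder_eq (neg _ _ _ b1) _
  |apply: isder_eq b2 _|apply: isder_eq (neg _ _ _ b3) _
  |apply: isder_eq c0 _|apply: isder_eq c1 _|apply: isder_eq c2 _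
  |apply: isder_eq c3 _|apply: isder_eq c0 _|apply: isder_eq (neg _ _ _ c1) _
  |apply: isder_eq c2 _|apply: isder_eq (neg _ _ _ c3) _].
all: move=> p; rewrite /ma /mb /ma' /mb' ?mulrN ?mulNr /= ?ReM ?ImM /=; ring.
Qed.

Lemma isderc_xi u v :
  [/\ isderc 0 (xi u v) (fun p => Ci * eta u v p),
      isderc 1 (xi u v) (eta u v) &
      isderc 2%:R (xi u v) (fun p => Ci * xi u v p)] /\
  [/\ isderc 0 (eta u v) (fun p => Ci * xi u v p),
      isderc 1 (eta u v) (fun p => - xi u v p) &
      isderc 2%:R (eta u v) (fun p => - Ci * eta u v p)].
Proof.
have [[a0 a1 a2 a3] [[b0 b1 b2 b3] [c0 c1 c2 c3]]] := isderc_ab.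
have comb j (s t : C) F F' H H' K K' L L' : isderc j F F' -> isderc j H H' ->
    isderc j K K' -> isderc j L L' ->
    isderc j (fun p => u * (F p + s * H p) + v * (t * K p + -1 * L p))
      (fun p => u * (F' p + s * H' p) + v * (t * K' p + -1 * L' p)).
  move=> hF hH hK hL; apply: isdercD; apply: isdercZ; apply: isdercD => //;
    exact: isdercZ.
have Ex : xi u v = fun p => u * (ma p + 1 * mb p) + v * (1 * ma' p + -1 * mb' p).
  by apply/funext => p; rewrite !mul1r.
have Ee : eta u v = fun p => u * (ma p + - 1 * mb p) + v * (-1 * ma' p + -1 * mb' p) by [].
split; split; rewrite ?[X in isderc _ X _]Ex ?[X in isderc _ X _]Ee.
all: [> apply: isderc_eq (comb _ _ _ _ _ _ _ _ _ _ _ a0 a1 a2 a3) _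
  |apply: isderc_eq (comb _ _ _ _ _ _ _ _ _ _ _ b0 b1 b2 b3) _
  |apply: isderc_eq (comb _ _ _ _ _ _ _ _ _ _ _ c0 c1 c2 c3) _
  |apply: isderc_eq (comb _ _ _ _ _ _ _ _ _ _ _ a0 a1 a2 a3) _
  |apply: isderc_eq (comb _ _ _ _ _ _ _ _ _ _ _ b0 b1 b2 b3) _
  |apply: isderc_eq (comb _ _ _ _ _ _ _ _ _ _ _ c0 c1 c2 c3) _].
all: by move=> p; rewrite /xi /eta; ring.
Qed.

End ComplexFunctions.

(** * Orthogonality to the higher representations *)

Section Ladder.

(** On the monomials of degree [k] in [xi] and [eta], the first two basis
    vectors act through this operator, up to scalars, with [s] equal to [1] and
    to [-1]. *)
Definition ladder (A : comNzRingType) (s : A) (k : nat) (x : nat -> A) (i : nat) : A :=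
  i%:R * x i.-1 + s * (k - i)%:R * x i.+1.

(** The commutator relation in disguise: the third basis vector acts on the
    [i]-th monomial by the weight [2 i - k], and the Casimir operator by
    [k (k + 2)], which leaves this diagonal operator for the first two. *)
Lemma ladder2_sub (A : comNzRingType) k (x : nat -> A) i : (i <= k)%N ->
  ladder 1 k (ladder 1 k x) i - ladder (-1) k (ladder (-1) k x) i =
  (k%:R * (k%:R + 2) - (2 * i%:R - k%:R) ^+ 2) * x i.
Proof.
move=> ik; rewrite /ladder; case: i ik => [|i] ik.
  rewrite !mul0r subn0 /=; case: k ik => [|k] _; first by rewrite !mul0r; ring.
  by rewrite subn1 /= -[k.+1%:R]natr1; ring.
rewrite /= (natrB _ ik) (natrB _ (ltnW ik)).
have [ik2|] := ltnP i.+1 k; last first.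
  move=> ki; have -> : k = i.+1 by apply/eqP; rewrite eqn_leq ik ki.
  by rewrite -[i.+1%:R]natr1; case: i {ik ki} => [|i]; ring.
by rewrite (natrB _ ik2) -[i.+2%:R]natr1 -[i.+1%:R]natr1; ring.
Qed.

(** The ladder operator is symmetric for the binomial weights: this is the
    invariant inner product on binary forms of degree [k]. *)
Lemma ladder_sym (F : realFieldType) k (x y : nat -> F) :
  \sum_(i < k.+1) 'C(k, i)%:R * (x i * ladder 1 k y i) =
  \sum_(i < k.+1) 'C(k, i)%:R * (ladder 1 k x i * y i).
Proof.
have up (u v : nat -> F) : \sum_(i < k.+1) 'C(k, i)%:R * (u i * (i%:R * v i.-1)) =
    \sum_(i < k) ('C(k, i.+1) * i.+1)%:R * (u i.+1 * v i).
  rewrite big_ord_recl mul0r !mulr0 add0r; apply: eq_bigr => i _.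
  by rewrite !lift0 natrM /=; ring.
have down (u v : nat -> F) : \sum_(i < k.+1) 'C(k, i)%:R * (u i * ((k - i)%:R * v i.+1)) =
    \sum_(i < k) ('C(k, i.+1) * i.+1)%:R * (u i * v i.+1).
  rewrite big_ord_recr /= subnn mul0r !mulr0 addr0; apply: eq_bigr => i _.
  by rewrite [in RHS]mulnC mul_bin_left natrM; ring.
have split2 (u v : nat -> F) : \sum_(i < k.+1) 'C(k, i)%:R * (u i * ladder 1 k v i) =
    \sum_(i < k) ('C(k, i.+1) * i.+1)%:R * (u i.+1 * v i) +
    \sum_(i < k) ('C(k, i.+1) * i.+1)%:R * (u i * v i.+1).
  rewrite -up -down -big_split; apply: eq_bigr => i _ /=.
  by rewrite /ladder; ring.
rewrite split2; under [RHS]eq_bigr do rewrite [ladder _ _ _ _ * _]mulrC.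
rewrite split2 addrC; congr (_ + _); apply: eq_bigr => i _; ring.
Qed.

(** The square of the ladder operator is positive, and the remaining diagonal
    part is at least [2 k b2 + k ^ 2 c2], so an eigenvalue below this bound
    forces the eigenvector to vanish. *)
Lemma ladder_eigen0 (F : realFieldType) k (x : nat -> F) (A b2 c2 mu : F) :
  0 <= A -> 0 <= c2 <= b2 -> mu < 2 * k%:R * b2 + k%:R ^+ 2 * c2 ->
  (forall i, (i <= k)%N -> mu * x i = A * ladder 1 k (ladder 1 k x) i +
    (b2 * (k%:R * (k%:R + 2) - (2 * i%:R - k%:R) ^+ 2) +
     c2 * (2 * i%:R - k%:R) ^+ 2) * x i) ->
  forall i, (i <= k)%N -> x i = 0.
Proof.
move=> A0 /andP[c0 cb] hmu hx.
pose d (i : nat) : F := b2 * (k%:R * (k%:R + 2) - (2 * i%:R - k%:R) ^+ 2) +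
     c2 * (2 * i%:R - k%:R) ^+ 2 - mu.
have d0 i : (i <= k)%N -> 0 < d i.
  move=> ik; have ik' : (i%:R : F) <= k%:R by rewrite ler_nat.
  have i0 : 0 <= (i%:R : F) by rewrite ler0n.
  have : 0 <= (b2 - c2) * (i%:R * (k%:R - i%:R)).
    by rewrite !mulr_ge0// ?subr_ge0.
  rewrite /d; move: hmu; set K := k%:R; set I := i%:R; nra.
have pos : 0 <= \sum_(i < k.+1) 'C(k, i)%:R * (ladder 1 k x i * ladder 1 k x i).
  by apply: sumr_ge0 => i _; rewrite mulr_ge0// -expr2 sqr_ge0.
have E : A * (\sum_(i < k.+1) 'C(k, i)%:R * (ladder 1 k x i * ladder 1 k x i)) +
    \sum_(i < k.+1) 'C(k, i)%:R * (d i * x i ^+ 2) = 0.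
  rewrite -ladder_sym mulr_sumr -big_split /=; apply: big1 => i _.
  rewrite (_ : _ + _ = 'C(k, i)%:R * x i * (A * ladder 1 k (ladder 1 k x) i +
    (b2 * (k%:R * (k%:R + 2) - (2 * i%:R - k%:R) ^+ 2) +
     c2 * (2 * i%:R - k%:R) ^+ 2) * x i - mu * x i)); last by rewrite /d; ring.
  by rewrite -hx ?subrr ?mulr0// -ltnS.
have dpos (i : 'I_k.+1) : true -> 0 <= 'C(k, i)%:R * (d i * x i ^+ 2).
  by move=> _; rewrite mulr_ge0// mulr_ge0 ?sqr_ge0// ltW// d0// -ltnS.
have S0 : \sum_(i < k.+1) 'C(k, i)%:R * (d i * x i ^+ 2) = 0.
  by apply/eqP; rewrite eq_le sumr_ge0 ?andbT//; have := mulr_ge0 A0 pos; lra.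
move=> i ik; have iK : (i < k.+1)%N by rewrite ltnS.
have /eqP := psumr_eq0P dpos S0 (i := Ordinal iK) isT.
rewrite /= mulf_eq0 pnatr_eq0 eqn0Ngt bin_gt0 ik /=.
by rewrite mulf_eq0 (gt_eqF (d0 _ ik)) sqrf_eq0 => /eqP.
Qed.

End Ladder.

Lemma sum3 (V : nmodType) (F : 'I_3 -> V) : \sum_j F j = F 0 + F 1 + F 2%:R.
Proof.
rewrite !big_ord_recl big_ord0 addr0 addrA.
by congr (_ + F _ + F _); exact/val_inj.
Qed.

Section Orthogonality.
Variable R : realType.
Local Notation G := (SU2 R).
Local Notation C := R[i].
Local Notation Ci := ('i : C).

(** For fixed [u] and [v], not both zero, these monomials span a copy of the irreducible
    representation of dimension [k + 1], acted upon by right translations. *)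
Definition form (u v : C) (k i : nat) (p : G) : C := xi u v p ^+ i * eta u v p ^+ (k - i).

Lemma ucontC_form u v k i : ucontC (form u v k i).
Proof. by apply: ucontCM; apply: ucontCX; [exact: ucontC_xi|exact: ucontC_eta]. Qed.

Lemma isderc_form u v k i j (z s : C) : (i <= k)%N ->
  isderc j (xi u v) (fun p => z * eta u v p) ->
  isderc j (eta u v) (fun p => z * s * xi u v p) ->
  isderc j (form u v k i) (fun p => z * ladder s k (fun n => form u v k n p) i).
Proof.
move=> ik hx he; apply: isderc_eq (isdercM (isdercX i hx) (isdercX (k - i) he)) _ => p.
rewrite /ladder /form subnS exprS.
case: i ik => [|i] ik; first by rewrite !mul0r; ring.
by rewrite -[(k - i.+1.-1)%N](subnSK ik) !exprS /=; ring.
Qed.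

Lemma isderc_ladder u v k i j (z s : C) : (i <= k)%N ->
  isderc j (xi u v) (fun p => z * eta u v p) ->
  isderc j (eta u v) (fun p => z * s * xi u v p) ->
  isderc j (fun p => z * ladder s k (fun n => form u v k n p) i)
    (fun p => z ^+ 2 * ladder s k (ladder s k (fun n => form u v k n p)) i).
Proof.
move=> ik hx he.
have h1 := isderc_form (leq_trans (leq_pred i) ik) hx he.
have h2 : isderc j (fun p => (s * (k - i)%:R) * form u v k i.+1 p)
    (fun p => (s * (k - i)%:R) * (z * ladder s k (fun n => form u v k n p) i.+1)).
  have [ki|ki] := ltnP i k; first exact: isdercZ (isderc_form ki hx he).
  have -> : (k - i)%N = 0%N by apply/eqP.
  rewrite !mulr0; apply: isderc_eq; last by move=> p; rewrite mul0r.
  rewrite (_ : (fun p => _) = fun=> 0); first exact: isderc_cst.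
  by apply/funext => p; rewrite mul0r.
apply: isderc_eq (isdercZ z (isdercD (isdercZ i%:R h1) h2)) _ => p.
by rewrite {3}/ladder; ring.
Qed.

Lemma ucontC_ladder u v k i (s : C) : ucontC (fun p => ladder s k (fun n => form u v k n p) i).
Proof. by apply: ucontCD; apply: ucontCZ; exact: ucontC_form. Qed.

Lemma ucontC_ladder2 u v k i (s : C) :
  ucontC (fun p => ladder s k (ladder s k (fun n => form u v k n p)) i).
Proof. by apply: ucontCD; apply: ucontCZ; exact: ucontC_ladder. Qed.

Lemma haarC_ladder (F : G -> C) (H : nat -> G -> C) (s : C) k i : ucontC F ->
  (forall n, ucontC (H n)) ->
  haarC (fun p => F p * ladder s k (fun n => H n p) i) =
  ladder s k (fun n => haarC (fun p => F p * H n p)) i.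
Proof.
move=> uF uH; rewrite /ladder.
have u n : ucontC (fun p => F p * H n p) by exact: ucontCM.
rewrite -!haarC_Z// -haarC_D; try exact: ucontCZ.
by apply: eq_haarC => p; ring.
Qed.

Lemma haarC_ladder2 (F : G -> C) (H : nat -> G -> C) (s : C) k i : ucontC F ->
  (forall n, ucontC (H n)) ->
  haarC (fun p => F p * ladder s k (ladder s k (fun n => H n p)) i) =
  ladder s k (ladder s k (fun n => haarC (fun p => F p * H n p))) i.
Proof.
move=> uF uH; rewrite (@haarC_ladder _ (fun m p => ladder s k (fun n => H n p) m))//.
  by rewrite {1 3}/ladder !haarC_ladder.
by move=> n; apply: ucontCD; apply: ucontCZ.
Qed.

Lemma Re_ladder k (x : nat -> C) i :
  complex.Re (ladder 1 k x i) = ladder 1 k (fun n => complex.Re (x n)) i.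
Proof.
by rewrite /ladder -!(rmorph_nat (real_complex R)) ReD !ReM /=; ring.
Qed.

Lemma Im_ladder k (x : nat -> C) i :
  complex.Im (ladder 1 k x i) = ladder 1 k (fun n => complex.Im (x n)) i.
Proof.
by rewrite /ladder -!(rmorph_nat (real_complex R)) ImD !ImM /=; ring.
Qed.

(** The means of [f] against the forms of degree [k] are an eigenvector of the
    transposed operator. Writing [a^2 X1^2 + b^2 X2^2] as
    [(a^2 - b^2) X1^2 + b^2 (X1^2 + X2^2)] puts the recurrence in the shape
    for which small eigenvalues are excluded. *)
Lemma eigfun_ortho (a b c mu : R) f u v k i :
  0 < c -> c <= b -> b <= a -> eigfun (weight a b c) mu f ->
  mu < 2 * k%:R * b ^+ 2 + k%:R ^+ 2 * c ^+ 2 -> (i <= k)%N ->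
  haarC (fun p => (f p)%:C * form u v k i p) = 0.
Proof.
move=> c0 cb ba ef hmu; move: i.
pose x n := haarC (fun p => (f p)%:C * form u v k n p).
have uf : ucontC (fun p => (f p)%:C) by apply: ucontC_real; case: ef.
have rec i : (i <= k)%N -> mu%:C * x i =
   (a ^+ 2 - b ^+ 2)%:C * ladder 1 k (ladder 1 k x) i +
   (b ^+ 2 * (k%:R * (k%:R + 2) - (2 * i%:R - k%:R) ^+ 2) +
    c ^+ 2 * (2 * i%:R - k%:R) ^+ 2)%:C * x i.
  move=> ik.
  have [[d0 d1 d2] [e0 e1 e2]] := isderc_xi u v.
  have d1' : isderc 1 (xi u v) (fun p => 1 * eta u v p).
    by apply: isderc_eq d1 _ => p; rewrite mul1r.
  have e0' : isderc 0 (eta u v) (fun p => Ci * 1 * xi u v p).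
    by apply: isderc_eq e0 _ => p; rewrite mulr1.
  have e1' : isderc 1 (eta u v) (fun p => 1 * -1 * xi u v p).
    by apply: isderc_eq e1 _ => p; ring.
  pose r : C := Ci * (2 * i%:R - k%:R).
  have d2' : isderc 2%:R (form u v k i) (fun p => r * form u v k i p).
    apply: isderc_eq (isdercM (isdercX i d2) (isdercX (k - i) e2)) _ => p.
    have X (n : nat) (z : C) : n%:R * z ^+ n.-1 * z = n%:R * z ^+ n.
      by case: n => [|n]; rewrite ?mul0r// exprSr mulrA.
    transitivity (- Ci * xi u v p ^+ i * ((k - i)%:R * eta u v p ^+ (k - i).-1 * eta u v p)
      + Ci * (i%:R * xi u v p ^+ i.-1 * xi u v p) * eta u v p ^+ (k - i)); first by ring.
    by rewrite !X /form /r natrB//; ring.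
  pose H1 (j : 'I_3) p := if j == 0 then Ci * ladder 1 k (fun n => form u v k n p) i
    else if j == 1 then 1 * ladder (-1) k (fun n => form u v k n p) i
    else r * form u v k i p.
  pose H2 (j : 'I_3) p :=
    if j == 0 then Ci ^+ 2 * ladder 1 k (ladder 1 k (fun n => form u v k n p)) i
    else if j == 1 then 1 ^+ 2 * ladder (-1) k (ladder (-1) k (fun n => form u v k n p)) i
    else r * (r * form u v k i p).
  have hH j : [/\ ucontC (H1 j), ucontC (H2 j), isderc j (form u v k i) (H1 j) &
      isderc j (H1 j) (H2 j)].
    rewrite /H1 /H2; move: j; apply: ord3P => /=; split.
    - exact/ucontCZ/ucontC_ladder.
    - exact/ucontCZ/ucontC_ladder2.
    - exact: isderc_form d0 e0'.
    - exact: isderc_ladder d0 e0'.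
    - exact/ucontCZ/ucontC_ladder.
    - exact/ucontCZ/ucontC_ladder2.
    - exact: isderc_form d1' e1'.
    - exact: isderc_ladder d1' e1'.
    - exact/ucontCZ/ucontC_form.
    - exact/ucontCZ/ucontCZ/ucontC_form.
    - exact: d2'.
    - exact: isdercZ.
  have Z (z : C) (H : G -> C) : ucontC H ->
      haarC (fun p => (f p)%:C * (z * H p)) = z * haarC (fun p => (f p)%:C * H p).
    by move=> uH; rewrite -haarC_Z; [apply: eq_haarC => p; ring|exact: ucontCM].
  have E0 : haarC (fun p => (f p)%:C * H2 0 p) = - ladder 1 k (ladder 1 k x) i.
    by rewrite [LHS]Z ?haarC_ladder2 ?sqr_i ?mulN1r//; [exact: ucontC_form|exact: ucontC_ladder2].
  have E1 : haarC (fun p => (f p)%:C * H2 1 p) = ladder (-1) k (ladder (-1) k x) i.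
    rewrite [LHS]Z ?haarC_ladder2 ?expr1n ?mul1r//; [exact: ucontC_form|exact: ucontC_ladder2].
  have E2 : haarC (fun p => (f p)%:C * H2 2%:R p) = - (2 * i%:R - k%:R) ^+ 2 * x i.
    rewrite [LHS]Z ?Z//; [|exact: ucontC_form|exact/ucontCZ/ucontC_form].
    by rewrite /r mulrA -expr2 exprMn sqr_i mulN1r.
  have := eigfun_green ef (ucontC_form u v k i) hH.
  rewrite sum3 E0 E1 E2 => h.
  have sub := ladder2_sub x ik.
  apply: oppr_inj; rewrite -mulNr -h -(subrK (ladder (-1) k (ladder (-1) k x) i)
    (ladder 1 k (ladder 1 k x) i)) sub.
  rewrite !(rmorphD, rmorphM, rmorphB, rmorphXn, rmorph_nat) /=; ring.
have cond : 0 <= a ^+ 2 - b ^+ 2 /\ 0 <= c ^+ 2 <= b ^+ 2.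
  by split; [nra|apply/andP; split; nra].
have [cond1 cond2] := cond.
move=> i ik; apply: complexP.
  apply: (@ladder_eigen0 R k (fun n => complex.Re (x n)) (a ^+ 2 - b ^+ 2) (b ^+ 2) (c ^+ 2) mu) => //.
  move=> n nk; have := congr1 (@complex.Re R) (rec n nk).
  rewrite ReD !ReM /= !mul0r !subr0 Re_ladder => ->; congr (_ * _ + _).
  by congr ladder; apply/funext => m; rewrite Re_ladder.
apply: (@ladder_eigen0 R k (fun n => complex.Im (x n)) (a ^+ 2 - b ^+ 2) (b ^+ 2) (c ^+ 2) mu) => //.
move=> n nk; have := congr1 (@complex.Im R) (rec n nk).
rewrite ImD !ImM /= !mul0r !addr0 Im_ladder => ->; congr (_ * _ + _).
by congr ladder; apply/funext => m; rewrite Im_ladder.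
Qed.
End Orthogonality.

(** * The adjoint representation *)

Section Adjoint.
Variable R : realType.
Local Notation G := (SU2 R).
Local Notation C := R[i].
Implicit Types (p : G) (j k l m : 'I_3).

Definition rotq j k (a b c d : R) : R := nth 0 (nth [::]
  [:: [:: a * a + b * b - c * c - d * d; 2 * (b * c - a * d); 2 * (b * d + a * c)];
      [:: 2 * (b * c + a * d); a * a - b * b + c * c - d * d; 2 * (c * d - a * b)];
      [:: 2 * (b * d - a * c); 2 * (c * d + a * b); a * a - b * b - c * c + d * d]] j) k.

(** The entries of the matrix of the adjoint representation. *)
Definition rot j k p : R := rotq j k (x0 p) (x1 p) (x2 p) (x3 p).

Lemma ucont_rot j k : ucont (rot j k).
Proof.
have [h0 h1 h2 h3] := ucont_coord R.
have q00 := ucontM h0 h0; have q11 := ucontM h1 h1; have q22 := ucontM h2 h2.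
have q33 := ucontM h3 h3; have q01 := ucontM h0 h1; have q02 := ucontM h0 h2.
have q03 := ucontM h0 h3; have q12 := ucontM h1 h2; have q13 := ucontM h1 h3.
have q23 := ucontM h2 h3.
move: j k; apply: ord3P; apply: ord3P;
  [exact: ucontB (ucontB (ucontD q00 q11) q22) q33|exact: ucontZ (ucontB q12 q03)
  |exact: ucontZ (ucontD q13 q02)|exact: ucontZ (ucontD q12 q03)
  |exact: ucontB (ucontD (ucontB q00 q11) q22) q33|exact: ucontZ (ucontB q23 q01)
  |exact: ucontZ (ucontB q13 q02)|exact: ucontZ (ucontD q23 q01)
  |exact: ucontD (ucontB (ucontB q00 q11) q22) q33].
Qed.

Lemma isderB l (f f' g g' : G -> R) : isder l f f' -> isder l g g' ->
  isder l (fun p => f p - g p) (fun p => f' p - g' p).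
Proof. by move=> hf hg p; apply: is_deriveB. Qed.

Lemma isderZ l (c : R) (f f' : G -> R) :
  isder l f f' -> isder l (fun p => c * f p) (fun p => c * f' p).
Proof.
move=> h; apply: isder_eq (isderM (isder_cst l c) h) _ => p.
by rewrite mul0r addr0.
Qed.

(** A quadratic form is differentiated by polarisation. *)
Lemma isder_rotq l j k (d0 d1 d2 d3 : G -> R) :
  isder l (@x0 R) d0 -> isder l (@x1 R) d1 -> isder l (@x2 R) d2 -> isder l (@x3 R) d3 ->
  isder l (rot j k) (fun p =>
    rotq j k (x0 p + d0 p) (x1 p + d1 p) (x2 p + d2 p) (x3 p + d3 p) -
    rot j k p - rotq j k (d0 p) (d1 p) (d2 p) (d3 p)).
Proof.
move=> h0 h1 h2 h3; have z := isder_cst l (2 : R).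
move: j k; apply: ord3P; apply: ord3P; rewrite /rot /rotq /=.
all: apply: isder_eq;
  [repeat first [apply: isderB|apply: isderD|apply: isderM; [exact: z|]|apply: isderM]; eassumption
  |by move=> p /=; ring].
Qed.

(** The structure constants of the basis [X1, X2, X3], up to a factor two. *)
Definition struct_cst l k m : R := nth 0 (nth [::] (nth [::]
  [:: [:: [:: 0; 0; 0]; [:: 0; 0; 1]; [:: 0; -1; 0]];
      [:: [:: 0; 0; -1]; [:: 0; 0; 0]; [:: 1; 0; 0]];
      [:: [:: 0; 1; 0]; [:: -1; 0; 0]; [:: 0; 0; 0]]] l) k) m.

Definition rot1 l j k p : R := 2 * \sum_m struct_cst l k m * rot j m p.

Lemma ucont_rot1 l j k : ucont (rot1 l j k).
Proof. by apply: ucontZ; apply: ucont_sum => m; apply: ucontZ; exact: ucont_rot. Qed.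

Lemma isder_rot l j k : isder l (rot j k) (rot1 l j k).
Proof.
have [[a0 a1 a2 a3] [[b0 b1 b2 b3] [c0 c1 c2 c3]]] := isder_coord R.
move: l; apply: ord3P.
- apply: isder_eq (isder_rotq j k a0 a1 a2 a3) _ => p.
  by rewrite /rot1 sum3; move: j k; apply: ord3P; apply: ord3P;
    rewrite /struct_cst /rot /rotq /=; ring.
- apply: isder_eq (isder_rotq j k b0 b1 b2 b3) _ => p.
  by rewrite /rot1 sum3; move: j k; apply: ord3P; apply: ord3P;
    rewrite /struct_cst /rot /rotq /=; ring.
- apply: isder_eq (isder_rotq j k c0 c1 c2 c3) _ => p.
  by rewrite /rot1 sum3; move: j k; apply: ord3P; apply: ord3P;
    rewrite /struct_cst /rot /rotq /=; ring.
Qed.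

Definition rot2 l j k p : R := if l == k then 0 else - 4 * rot j k p.

Lemma isder_rot1 l j k : isder l (rot1 l j k) (rot2 l j k).
Proof.
have h : isder l (rot1 l j k) (fun p => 2 * \sum_m struct_cst l k m * rot1 l j m p).
  have E (F : 'I_3 -> G -> R) :
      (fun p => \sum_m F m p) = fun p => F 0 p + F 1 p + F 2%:R p.
    by apply/funext => p; exact: sum3.
  apply: isderZ; rewrite (E (fun m p => struct_cst l k m * rot j m p)).
  rewrite (E (fun m p => struct_cst l k m * rot1 l j m p)).
  by apply: isderD; [apply: isderD|]; apply: isderZ; exact: isder_rot.
apply: isder_eq h _ => p; rewrite sum3 /rot1 /rot2 !sum3.
by move: l k; apply: ord3P; apply: ord3P; rewrite /struct_cst /=; ring.
Qed.

(** The eigenvalue on the [k]-th column of the adjoint matrix: the [k]-th basis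
    field annihilates it, the square of each of the others acts by [- 4]. *)
Definition lam (w : 'I_3 -> R) k : R := 4 * \sum_(l | l != k) w l ^+ 2.

Lemma eigfun_rot w j k : eigfun w (lam w k) (rot j k).
Proof.
split; first exact: ucont_rot.
exists (fun l => rot1 l j k), (fun l => rot2 l j k); split=> [l|p].
  split; [exact: ucont_rot1| |exact: isder_rot|exact: isder_rot1].
  by rewrite /rot2; case: (l == k); [exact: ucont_cst|apply: ucontZ; exact: ucont_rot].
rewrite /rot2 (bigD1 k)//= eqxx mulr0 add0r.
rewrite /lam -mulNr mulr_sumr mulr_suml; apply: eq_bigr => l lk.
by rewrite (negbTE lk); ring.
Qed.

Lemma eigfun_cst w (c : R) : eigfun w 0 (fun=> c).
Proof.
split; first exact: ucont_cst.
exists (fun _ _ => 0), (fun _ _ => 0); split=> [l|p].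
  by split; [exact: ucont_cst..|exact: isder_cst|exact: isder_cst].
by rewrite oppr0 mul0r big1// => l _; rewrite mulr0.
Qed.

Lemma haar_rot j k : haar (rot j k) = 0.
Proof.
have h l m : haar (rot1 l j m) = 0.
  exact: haar_isder (ucont_rot j m) (ucont_rot1 l j m) (isder_rot l j m).
have E l m : haar (rot1 l j m) = 2 * \sum_n struct_cst l m n * haar (rot j n).
  rewrite haarZ; last by apply: ucont_sum => n; apply: ucontZ; exact: ucont_rot.
  rewrite haar_sum; last by move=> n; apply: ucontZ; exact: ucont_rot.
  by congr (2 * _); apply: eq_bigr => n _; rewrite haarZ//; exact: ucont_rot.
have h01 := h 0 1; have h02 := h 0 2%:R; have h12 := h 1 2%:R.
move: h01 h02 h12; rewrite !E !sum3 /struct_cst /= => h01 h02 h12.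
by move: k; apply: ord3P; lra.
Qed.

Lemma rot_orthogonal j l p : \sum_k rot j k p * rot l k p = (j == l)%:R.
Proof.
rewrite sum3; transitivity ((j == l)%:R *
    (x0 p ^+ 2 + x1 p ^+ 2 + x2 p ^+ 2 + x3 p ^+ 2) ^+ 2); last first.
  by rewrite sumsq1 expr1n mulr1.
by move: j l; apply: ord3P; apply: ord3P; rewrite /rot /rotq /=; ring.
Qed.

(** Schur orthogonality for the adjoint representation, in infinitesimal form:
    the mean of a derivative of [rot j k * rot l m] is zero. *)
Lemma haar_rot_rot j k l m :
  haar (fun p => rot j k p * rot l m p) = (j == l)%:R * (k == m)%:R / 3.
Proof.
pose K k m := haar (fun p => rot j k p * rot l m p).
have u k' m' : ucont (fun p => rot j k' p * rot l m' p).
  by apply: ucontM; exact: ucont_rot.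
have rel i k' m' : \sum_n struct_cst i m' n * K k' n + \sum_n struct_cst i k' n * K n m' = 0.
  have h := isderM (isder_rot i j k') (isder_rot i l m').
  have uh : ucont (fun p => rot j k' p * rot1 i l m' p + rot1 i j k' p * rot l m' p).
    by apply: ucontD; apply: ucontM; first [exact: ucont_rot|exact: ucont_rot1].
  have := haar_isder (u k' m') uh h.
  rewrite (_ : (fun p => _) = fun p => 2 * (
    \sum_n struct_cst i m' n * (rot j k' p * rot l n p) +
    \sum_n struct_cst i k' n * (rot j n p * rot l m' p))); last first.
    by apply/funext => p; rewrite /rot1 !sum3; ring.
  have U (e : 'I_3 -> R) (f : 'I_3 -> G -> R) :
     (forall n, ucont (f n)) -> ucont (fun p => \sum_n e n * f n p).
    by move=> hf; apply: ucont_sum => n; exact: ucontZ.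
  have E (e : 'I_3 -> R) (f : 'I_3 -> G -> R) :
     (forall n, ucont (f n)) -> haar (fun p => \sum_n e n * f n p) = \sum_n e n * haar (f n).
    move=> hf; rewrite haar_sum; last by move=> n; exact: ucontZ.
    by apply: eq_bigr => n _; rewrite haarZ.
  rewrite haarZ; last by apply: ucontD; apply: U.
  by rewrite haarD; [rewrite !E//; move/eqP; rewrite mulf_eq0 pnatr_eq0 => /eqP|exact: U..].
have tr : K 0 0 + K 1 1 + K 2%:R 2%:R = (j == l)%:R.
  rewrite -(haar_cst (j == l)%:R) -/(K _ _) /K -!haarD//; last exact: ucontD.
  by congr haar; apply/funext => p; rewrite -(rot_orthogonal j l p) sum3.
have := rel 0 0 1; have := rel 0 0 2%:R; have := rel 0 1 0; have := rel 0 2%:R 0.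
have := rel 1 1 0; have := rel 1 0 1; have := rel 0 1 2%:R; have := rel 1 0 2%:R.
rewrite !sum3 /struct_cst /= -/(K k m) => e1 e2 e3 e4 e5 e6 e7 e8.
by move: k m; apply: ord3P; apply: ord3P => /=; move: tr e1 e2 e3 e4 e5 e6 e7 e8; lra.
Qed.

(** ** The component orthogonal to the constants and to the adjoint entries *)

(** By Schur orthogonality the adjoint entries have squared norm 1/3, hence the
    factor three; [low f] is the orthogonal projection of [f]. *)
Definition coef (f : G -> R) j k : R := 3 * haar (fun p => f p * rot j k p).
Definition low (f : G -> R) p : R := haar f + \sum_j \sum_k coef f j k * rot j k p.
Definition high (f : G -> R) p : R := f p - low f p.

Lemma ucont_low f : ucont (low f).
Proof.
apply: ucontD; first exact: ucont_cst.
by do 2 (apply: ucont_sum => ?); apply: ucontZ; exact: ucont_rot.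
Qed.

Lemma ucont_high f : ucont f -> ucont (high f).
Proof. by move=> hf; apply: ucontB => //; exact: ucont_low. Qed.

Lemma haarC_low f H : ucontC H -> haarC (fun p => (low f p)%:C * H p) =
  (haar f)%:C * haarC H + \sum_j \sum_k (coef f j k)%:C * haarC (fun p => (rot j k p)%:C * H p).
Proof.
move=> uH.
have ur j k : ucontC (fun p => (rot j k p)%:C * H p).
  by apply: ucontCM => //; apply: ucontC_real; exact: ucont_rot.
rewrite (_ : (fun p => _) = fun p => (haar f)%:C * H p +
   \sum_j \sum_k (coef f j k)%:C * ((rot j k p)%:C * H p)); last first.
  apply/funext => p; rewrite /low rmorphD mulrDl; congr (_ + _).
  rewrite rmorph_sum mulr_suml; apply: eq_bigr => j _.
  rewrite rmorph_sum mulr_suml; apply: eq_bigr => k _.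
  by rewrite rmorphM mulrA.
have u1 j : ucontC (fun p => \sum_k (coef f j k)%:C * ((rot j k p)%:C * H p)).
  by apply: ucontC_sum => k; exact: ucontCZ.
rewrite haarC_D ?haarC_Z//; [|exact: ucontCZ|exact: ucontC_sum].
congr (_ + _); rewrite haarC_sum//; apply: eq_bigr => j _.
rewrite haarC_sum; last by move=> k; exact: ucontCZ.
by apply: eq_bigr => k _; rewrite haarC_Z.
Qed.

Lemma haarC_high f H : ucont f -> ucontC H -> haarC (fun p => (high f p)%:C * H p) =
  haarC (fun p => (f p)%:C * H p) - haarC (fun p => (low f p)%:C * H p).
Proof.
move=> uf uH; rewrite -mulN1r -haarC_Z -?haarC_D.
- by apply: eq_haarC => p; rewrite /high rmorphB; ring.
- by apply: ucontCM => //; exact: ucontC_real.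
- by apply: ucontCZ; apply: ucontCM => //; apply: ucontC_real; exact: ucont_low.
- by apply: ucontCM => //; apply: ucontC_real; exact: ucont_low.
Qed.

Lemma haarC_high_cst f : ucont f -> haarC (fun p => (high f p)%:C) = 0.
Proof.
move=> uf; have E := haarC_high uf (ucontC_cst 1); rewrite (haarC_low _ (ucontC_cst 1)) in E.
rewrite -[RHS](subrr (haar f)%:C) -{1}(haarC_real f).
rewrite (eq_haarC (H := fun p => (high f p)%:C * 1)); last by move=> p; rewrite mulr1.
rewrite E haarC_cst mulr1 (eq_haarC (H := fun p => (f p)%:C)); last by move=> p; rewrite mulr1.
rewrite big1 ?addr0// => j _; rewrite big1// => k _.
rewrite (eq_haarC (H := fun p => (rot j k p)%:C)); last by move=> p; rewrite mulr1.
by rewrite haarC_real haar_rot mulr0.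
Qed.

Lemma haarC_high_rot f j k : ucont f -> haarC (fun p => (high f p)%:C * (rot j k p)%:C) = 0.
Proof.
move=> uf; have u := ucontC_real (ucont_rot j k).
rewrite haarC_high// haarC_low// haarC_real haar_rot mulr0 add0r.
rewrite (bigD1 j)//= (bigD1 k)//= !big1 ?addr0.
- rewrite (eq_haarC (H := fun p => (f p * rot j k p)%:C)); last by move=> p; rewrite rmorphM.
  rewrite (eq_haarC (F := fun p => _ * _) (H := fun p => (rot j k p * rot j k p)%:C)); last first.
    by move=> p; rewrite rmorphM.
  rewrite !haarC_real haar_rot_rot !eqxx /coef -rmorphM -rmorphB.
  have -> : (true%:R : R) = 1 by [].
  by rewrite (_ : _ - _ = 0) ?rmorph0//; field.
- move=> l lj; rewrite big1// => m _.
  rewrite (eq_haarC (H := fun p => (rot l m p * rot j k p)%:C)); last by move=> p; rewrite rmorphM.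
  by rewrite haarC_real haar_rot_rot (negbTE lj) !mul0r mulr0.
- move=> m mk.
  rewrite (eq_haarC (H := fun p => (rot j m p * rot j k p)%:C)); last by move=> p; rewrite rmorphM.
  by rewrite haarC_real haar_rot_rot (negbTE mk) mulr0 mul0r mulr0.
Qed.

End Adjoint.

(** * Completeness *)

Section Interpolation.

(** The derivative at zero of polynomials of bounded degree is a fixed linear
    combination of their values at the first integers. *)
Lemma deriv0_interp (F : numFieldType) n : exists c : 'I_n -> F,
  forall P : {poly F}, (size P <= n)%N -> P^`().[0] = \sum_r c r * P.[r%:R].
Proof.
pose a : 'rV[F]_n := \row_r r%:R.
have V : Vandermonde n a \in unitmx.
  rewrite unitmxE det_Vandermonde unitfE; apply/prodf_neq0 => i _.
  apply/prodf_neq0 => j ij; rewrite !mxE subr_eq0 eqr_nat.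
  by rewrite neq_ltn ij orbT.
pose e : 'cV[F]_n := \col_i (i == 1%N :> nat)%:R.
pose c := invmx (Vandermonde n a) *m e.
have cE (i : 'I_n) : \sum_(r < n) (r%:R : F) ^+ i * c r 0 = (i == 1%N :> nat)%:R :> F.
  have := mulKVmx V e; rewrite -/c => /matrixP/(_ i 0); rewrite !mxE => <-.
  by apply: eq_bigr => r _; rewrite !mxE.
exists (fun r => c r 0) => P sP; rewrite horner_coef0 coef_deriv mulr1n.
have -> : P`_1 = \sum_(i < n) P`_i * (i == 1%N :> nat)%:R.
  have [n1|n1] := ltnP 1 n.
    rewrite (bigD1 (Ordinal n1))//= mulr1 big1 ?addr0// => i.
    by rewrite -val_eqE /= => /negbTE ->; rewrite mulr0.
  rewrite nth_default ?(leq_trans sP)// big1// => i _.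
  by rewrite (ltn_eqF (leq_trans (ltn_ord i) n1)) mulr0.
under [RHS]eq_bigr do rewrite (horner_coef_wide _ sP) mulr_sumr.
rewrite exchange_big /=; apply: eq_bigr => i _.
by rewrite -cE mulr_sumr; apply: eq_bigr => r _; ring.
Qed.

End Interpolation.

Section Completeness.
Variable R : realType.
Local Notation G := (SU2 R).
Local Notation C := R[i].
Implicit Types (p h : G).

Definition xc (m : 'I_4) p : R := nth 0 [:: x0 p; x1 p; x2 p; x3 p] m.

Lemma ord4P (P : 'I_4 -> Prop) : P 0 -> P 1 -> P 2%:R -> P 3%:R -> forall m, P m.
Proof.
move=> P0 P1 P2 P3 -[[|[|[|[|//]]]] Hm].
- by rewrite (_ : Ordinal Hm = 0)//; apply/val_inj.
- by rewrite (_ : Ordinal Hm = 1)//; apply/val_inj.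
- by rewrite (_ : Ordinal Hm = 2%:R)//; apply/val_inj.
- by rewrite (_ : Ordinal Hm = 3%:R)//; apply/val_inj.
Qed.

Lemma sum4 (V : nmodType) (F : 'I_4 -> V) :
  \sum_m F m = F 0 + F 1 + F 2%:R + F 3%:R.
Proof.
rewrite !big_ord_recl big_ord0 addr0 !addrA.
by congr (_ + F _ + F _ + F _); exact/val_inj.
Qed.

Lemma ucont_xc m : ucont (xc m).
Proof. by have [? ? ? ?] := ucont_coord R; move: m; apply: ord4P. Qed.

(** Quadratic forms on four-space split into the multiples of the squared norm,
    which are constant on the group, and the nine-dimensional space of traceless
    ones, which is the span of the adjoint entries. *)
Lemma quad_span (m n : 'I_4) : exists (c : R) (q : 'I_3 -> 'I_3 -> R),
  forall p, xc m p * xc n p = c + \sum_j \sum_k q j k * rot j k p.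
Proof.
pose q (s : seq (seq R)) (j k : 'I_3) : R := 4^-1 * nth 0 (nth [::] s j) k.
have E s c (x y : G -> R) : (forall p, x p * y p =
    c * (x0 p ^+ 2 + x1 p ^+ 2 + x2 p ^+ 2 + x3 p ^+ 2) +
    \sum_(j < 3) \sum_(k < 3) q s j k * rot j k p) ->
    exists (c : R) (q : 'I_3 -> 'I_3 -> R),
    forall p, x p * y p = c + \sum_j \sum_k q j k * rot j k p.
  by move=> h; exists c, (q s) => p; rewrite h sumsq1 mulr1.
have e00 := E [:: [:: 1; 0; 0]; [:: 0; 1; 0]; [:: 0; 0; 1]] 4^-1.
have e11 := E [:: [:: 1; 0; 0]; [:: 0; -1; 0]; [:: 0; 0; -1]] 4^-1.
have e22 := E [:: [:: -1; 0; 0]; [:: 0; 1; 0]; [:: 0; 0; -1]] 4^-1.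
have e33 := E [:: [:: -1; 0; 0]; [:: 0; -1; 0]; [:: 0; 0; 1]] 4^-1.
have e01 := E [:: [:: 0; 0; 0]; [:: 0; 0; -1]; [:: 0; 1; 0]] 0.
have e02 := E [:: [:: 0; 0; 1]; [:: 0; 0; 0]; [:: -1; 0; 0]] 0.
have e03 := E [:: [:: 0; -1; 0]; [:: 1; 0; 0]; [:: 0; 0; 0]] 0.
have e12 := E [:: [:: 0; 1; 0]; [:: 1; 0; 0]; [:: 0; 0; 0]] 0.
have e13 := E [:: [:: 0; 0; 1]; [:: 0; 0; 0]; [:: 1; 0; 0]] 0.
have e23 := E [:: [:: 0; 0; 0]; [:: 0; 0; 1]; [:: 0; 1; 0]] 0.
move: m n; apply: ord4P; apply: ord4P;
  [apply: e00|apply: e01|apply: e02|apply: e03|apply: e01|apply: e11|apply: e12|apply: e13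
  |apply: e02|apply: e12|apply: e22|apply: e23|apply: e03|apply: e13|apply: e23|apply: e33];
  by move=> p; rewrite !sum3 /q /rot /rotq /xc /=; field.
Qed.

Definition lin (c : 'I_4 -> C) p : C := \sum_m c m * (xc m p)%:C.

Lemma haarC_high_quad f (c d : 'I_4 -> C) : ucont f ->
  haarC (fun p => (high f p)%:C * (lin c p * lin d p)) = 0.
Proof.
move=> uf; have uh := ucontC_real (ucont_high uf).
have quad m n : haarC (fun p => (high f p)%:C * (xc m p * xc n p)%:C) = 0.
  have [s [q hq]] := quad_span m n.
  have u j k : ucontC (fun p => (high f p)%:C * (rot j k p)%:C).
    by apply: ucontCM => //; apply: ucontC_real; exact: ucont_rot.
  rewrite (eq_haarC (H := fun p => s%:C * (high f p)%:C +
     \sum_j \sum_k (q j k)%:C * ((high f p)%:C * (rot j k p)%:C))); last first.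
    move=> p; rewrite hq; move: (high f p)%:C => z.
    rewrite rmorphD mulrDr [z * _]mulrC; congr (_ + _).
    rewrite rmorph_sum mulr_sumr; apply: eq_bigr => j _.
    rewrite rmorph_sum mulr_sumr; apply: eq_bigr => k _.
    by rewrite rmorphM mulrCA.
  have u1 j : ucontC (fun p => \sum_k (q j k)%:C * ((high f p)%:C * (rot j k p)%:C)).
    by apply: ucontC_sum => k; exact: ucontCZ.
  rewrite haarC_D; [|exact: ucontCZ|exact: ucontC_sum].
  rewrite haarC_Z// haarC_high_cst// mulr0 add0r haarC_sum// big1// => j _.
  rewrite haarC_sum; last by move=> k; exact: ucontCZ.
  by rewrite big1// => k _; rewrite haarC_Z// haarC_high_rot// mulr0.
have u m n : ucontC (fun p => (high f p)%:C * (xc m p * xc n p)%:C).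
  by apply: ucontCM => //; apply: ucontC_real; apply: ucontM; exact: ucont_xc.
rewrite (eq_haarC (H := fun p => \sum_m \sum_n (c m * d n) *
    ((high f p)%:C * (xc m p * xc n p)%:C))); last first.
  move=> p; rewrite /lin mulr_suml mulr_sumr; apply: eq_bigr => m _.
  rewrite mulr_sumr mulr_sumr; apply: eq_bigr => n _.
  by rewrite rmorphM; ring.
rewrite haarC_sum; last by move=> m; apply: ucontC_sum => n; exact: ucontCZ.
rewrite big1// => m _; rewrite haarC_sum; last by move=> n; exact: ucontCZ.
by rewrite big1// => n _; rewrite haarC_Z// quad mulr0.
Qed.

Lemma xi_lin u v : exists c, xi u v = lin c.
Proof.
exists (fun m : 'I_4 => nth 0 [:: u + v; 'i * (u - v); u - v; 'i * (u + v)] m).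
apply/funext => p; rewrite /lin sum4 /xc /xi /ma /mb /ma' /mb' /=.
have E (a b : R) : a +i* b = a%:C + 'i * b%:C.
  by apply: complexP; rewrite /= ?ReD ?ImD ?ReM ?ImM /=; ring.
by rewrite !E !rmorphN; ring.
Qed.

Lemma eta_lin u v : exists c, eta u v = lin c.
Proof.
exists (fun m : 'I_4 => nth 0 [:: u - v; 'i * (u + v); - u - v; 'i * (v - u)] m).
apply/funext => p; rewrite /lin sum4 /xc /eta /ma /mb /ma' /mb' /=.
have E (a b : R) : a +i* b = a%:C + 'i * b%:C.
  by apply: complexP; rewrite /= ?ReD ?ImD ?ReM ?ImM /=; ring.
by rewrite !E !rmorphN; ring.
Qed.

(** In degree four and above the bound on the eigenvalue applies to [f], and also,
    for the round metric, to the constants and to the adjoint entries, whose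
    eigenvalues are zero and eight. In degree two the forms are quadratic. *)
Lemma high_ortho (a b c mu : R) f u v k i :
  0 < c -> c <= b -> b <= a -> eigfun (weight a b c) mu f ->
  mu < 8 * b ^+ 2 + 16 * c ^+ 2 -> (i <= k)%N -> ~~ odd k ->
  haarC (fun p => (high f p)%:C * form u v k i p) = 0.
Proof.
move=> c0 cb ba ef hmu ik ok; have uf : ucont f by case: ef.
have [k4|] := leqP 4 k.
  have uF := ucontC_form u v k i.
  have k4' : (4 : R) <= k%:R by rewrite ler_nat.
  rewrite haarC_high// haarC_low// (eigfun_ortho u v c0 cb ba ef)//; last first.
    apply: lt_le_trans hmu _.
    have h1 : 0 <= (k%:R - 4) * b ^+ 2 by rewrite mulr_ge0 ?sqr_ge0// subr_ge0.
    have h2 : 0 <= (k%:R - 4) * (k%:R + 4) * c ^+ 2.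
      by rewrite mulr_ge0 ?sqr_ge0// mulr_ge0 ?subr_ge0// addr_ge0.
    lra.
  have w1 mu' g : eigfun (weight 1 1 1) mu' g -> mu' <= 8 ->
      haarC (fun p => (g p)%:C * form u v k i p) = 0.
    move=> eg hm; apply: (eigfun_ortho u v _ _ _ eg) => //.
    by apply: le_lt_trans hm _; nra.
  have := w1 0 (fun=> 1) (eigfun_cst _ _); rewrite ler0n => /(_ isT).
  rewrite (eq_haarC (H := form u v k i)) => [->|p]; last by rewrite rmorph1 mul1r.
  rewrite mulr0 !add0r big1 ?oppr0// => j _; rewrite big1// => l _.
  rewrite (w1 _ _ (eigfun_rot _ j l)) ?mulr0//.
  rewrite /lam big_mkcond sum3 /weight; move: l; apply: ord3P => /=; lra.
case: k ok ik => [|[|[|[|//]]]] // _; last first.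
  have [d hd] := eta_lin u v; have [e he] := xi_lin u v.
  case: i => [|[|[|//]]] _ _.
  - apply: etrans (haarC_high_quad d d uf); apply: eq_haarC => p.
    by rewrite /form hd expr0 mul1r.
  - apply: etrans (haarC_high_quad e d uf); apply: eq_haarC => p.
    by rewrite /form hd he !expr1.
  - apply: etrans (haarC_high_quad e e uf); apply: eq_haarC => p.
    by rewrite /form he expr0 mulr1.
case: i => // _ _; apply: etrans (haarC_high_cst uf); apply: eq_haarC => p.
by rewrite /form !expr0 !mulr1.
Qed.

End Completeness.

Section Localization.
Variable R : realType.
Local Notation G := (SU2 R).
Local Notation C := R[i].
Implicit Types (p h : G).

Lemma xiD (u v u' v' s : C) p :
  xi (u + s * u') (v + s * v') p = xi u v p + s * xi u' v' p.
Proof. by rewrite /xi; ring. Qed.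

Lemma etaD (u v u' v' s : C) p :
  eta (u + s * u') (v + s * v') p = eta u v p + s * eta u' v' p.
Proof. by rewrite /eta; ring. Qed.

Lemma xi_eta_wedge (u v u' v' : C) p :
  xi u v p * eta u' v' p = eta u v p * xi u' v' p - 2 * (u * v' - v * u').
Proof.
have h : ma p * ma' p + mb p * mb' p = 1.
  apply: complexP; rewrite ?ReD ?ImD ?ReM ?ImM /ma /mb /ma' /mb' /=.
    by rewrite -(sumsq1 p); ring.
  by ring.
apply/eqP; rewrite -subr_eq0; apply/eqP.
transitivity (2 * (u * v' - v * u') * (1 - (ma p * ma' p + mb p * mb' p))).
  by rewrite /xi /eta; ring.
by rewrite h subrr mulr0.
Qed.

(** The first-order term of [form (u + s u') (v + s v') k i] in [s]. *)
Definition dform (u v u' v' : C) k i p : C :=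
  i%:R * xi u v p ^+ i.-1 * xi u' v' p * eta u v p ^+ (k - i) +
  (k - i)%:R * xi u v p ^+ i * eta u v p ^+ (k - i).-1 * eta u' v' p.

(** A derivative in [s] of a family of forms is a combination of members of the
    family, so that orthogonality to all forms passes to [dform]. *)
Lemma dform_interp k : exists c : 'I_k.+1 -> C, forall u v u' v' i p, (i <= k)%N ->
  dform u v u' v' k i p = \sum_r c r * form (u + r%:R * u') (v + r%:R * v') k i p.
Proof.
have [c hc] := deriv0_interp C k.+1; exists c => u v u' v' i p ik.
pose A : {poly C} := (xi u v p)%:P + (xi u' v' p)%:P * 'X.
pose B : {poly C} := (eta u v p)%:P + (eta u' v' p)%:P * 'X.
have sA (x y : C) : (size ((x%:P + y%:P * 'X)%R : {poly C}) <= 2)%N.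
  rewrite (leq_trans (size_polyD _ _))// geq_max (leq_trans (size_polyC_leq1 _))//=.
  by rewrite mul_polyC (leq_trans (size_scale_leq _ _))// size_polyX.
have sX (P : {poly C}) n : (size P <= 2)%N -> (size (P ^+ n)%R <= n.+1)%N.
  move=> sP; rewrite (leq_trans (size_poly_exp_leq _ _))// ltnS.
  by rewrite -[X in (_ <= X)%N]mul1n leq_mul2r; case: (size P) sP => [|[|[]]]//; rewrite orbT.
have sP : (size (A ^+ i * B ^+ (k - i))%R <= k.+1)%N.
  rewrite (leq_trans (size_polyMleq _ _))//.
  have := leq_add (sX A i (sA _ _)) (sX B (k - i)%N (sA _ _)).
  by rewrite addSn addnS subnKC//; case: (_ + _)%N => //= n; rewrite ltnS => /ltnW.
have AE s : A.[s] = xi u v p + s * xi u' v' p.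
  by rewrite /A hornerD hornerM !hornerC hornerX mulrC.
have BE s : B.[s] = eta u v p + s * eta u' v' p.
  by rewrite /B hornerD hornerM !hornerC hornerX mulrC.
have dA : A^`() = (xi u' v' p)%:P.
  by rewrite /A derivD derivM !derivC derivX mul0r !add0r mulr1.
have dB : B^`() = (eta u' v' p)%:P.
  by rewrite /B derivD derivM !derivC derivX mul0r !add0r mulr1.
move: A B sP AE BE dA dB => A B sP AE BE dA dB.
transitivity ((A ^+ i * B ^+ (k - i))^`().[0]).
  rewrite derivM !deriv_exp dA dB hornerD !hornerM !hornerMn !hornerM !horner_exp !hornerC.
  by rewrite AE BE !mul0r !addr0 -(mulr_natl _ i) -(mulr_natl _ (k - i)) /dform; ring.
rewrite (hc _ sP); apply: eq_bigr => r _; congr (_ * _).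
by rewrite /form xiD etaD hornerM !horner_exp AE BE.
Qed.

(** Both terms of [dform] are brought to the same product, up to a term of lower
    degree, by exchanging the rows with [xi_eta_wedge]. *)
Lemma xi_form u v u' v' k i p : (i <= k)%N ->
  k.+1%:R * (xi u' v' p * form u v k i p) = dform u v u' v' k.+1 i.+1 p +
  2 * (u * v' - v * u') * (k - i)%:R * form u v k.-1 i p.
Proof.
move=> ik; rewrite /dform /form subSS /=.
have W := xi_eta_wedge u v u' v' p.
have [k0|k0] := posnP (k - i)%N.
  have -> : k = i by apply/eqP; rewrite eqn_leq ik andbT -subn_eq0 k0.
  by rewrite subnn; ring.
have E : (k - i = (k - i).-1.+1)%N by rewrite prednK.
have -> : (k.-1 - i = (k - i).-1)%N by rewrite -subn1 subnAC subn1.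
transitivity ((i.+1%:R + (k - i)%:R) * (xi u' v' p * (xi u v p ^+ i * eta u v p ^+ (k - i)))).
  by congr (_ * _); rewrite -natrD addSn subnKC.
rewrite {2 3}E [in LHS]exprS [in X in _ * X + _]exprS.
transitivity (i.+1%:R * xi u v p ^+ i * xi u' v' p * (eta u v p * eta u v p ^+ (k - i).-1) +
  (k - i)%:R * xi u v p ^+ i * eta u v p ^+ (k - i).-1 * (eta u v p * xi u' v' p)).
  by ring.
have -> : eta u v p * xi u' v' p = xi u v p * eta u' v' p + 2 * (u * v' - v * u').
  by rewrite W; ring.
by rewrite exprSr; ring.
Qed.

Lemma eta_form u v u' v' k i p : (i <= k)%N ->
  k.+1%:R * (eta u' v' p * form u v k i p) = dform u v u' v' k.+1 i p -
  2 * (u * v' - v * u') * i%:R * form u v k.-1 i.-1 p.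
Proof.
move=> ik; rewrite /dform /form (subSn ik) /=.
have W := xi_eta_wedge u v u' v' p.
case: i ik => [|i] ik; first by rewrite subn0; ring.
have -> : (k.-1 - i = k - i.+1)%N by rewrite -subn1 -subnDA add1n.
rewrite /=; transitivity ((i.+1%:R + (k - i.+1).+1%:R) * (eta u' v' p * (xi u v p ^+ i.+1 * eta u v p ^+ (k - i.+1)))).
  by congr (_ * _); rewrite -natrD addnS subnKC.
rewrite !exprSr.
transitivity (i.+1%:R * xi u v p ^+ i * (xi u v p * eta u' v' p) * eta u v p ^+ (k - i.+1) +
  (k - i.+1).+1%:R * (xi u v p ^+ i * xi u v p) * eta u v p ^+ (k - i.+1) * eta u' v' p).
  by ring.
by rewrite W; ring.
Qed.

(** Multiplying a form by a linear function produces forms of the two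
    neighbouring degrees (the Clebsch-Gordan rule), so orthogonality to all
    forms propagates to the products with powers of a linear function. *)
Lemma ortho_power (F : G -> C) u1 v1 u2 v2 : ucontC F ->
  (forall k i u v, (i <= k)%N -> ~~ odd k -> haarC (fun p => F p * form u v k i p) = 0) ->
  forall n k i u v, (i <= k)%N -> ~~ odd (n + k) ->
    haarC (fun p => F p * (xi u1 v1 p + eta u2 v2 p) ^+ n * form u v k i p) = 0.
Proof.
move=> uF hF; elim=> [|n IH] k i u v ik onk.
  by rewrite -[RHS](hF k i u v ik onk); apply: eq_haarC => p; rewrite expr0 mulr1.
pose Y p := F p * (xi u1 v1 p + eta u2 v2 p) ^+ n.
have uY : ucontC Y by apply: ucontCM => //; apply: ucontCX; apply: ucontCD; [exact: ucontC_xi|exact: ucontC_eta].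
have uYf k' i' u' v' : ucontC (fun p => Y p * form u' v' k' i' p).
  by apply: ucontCM => //; exact: ucontC_form.
have ud k' i' u' v' : ucontC (fun p => Y p * dform u v u' v' k' i' p).
  have X := ucontC_xi u v; have E := ucontC_eta u v.
  have X' := ucontC_xi u' v'; have E' := ucontC_eta u' v'.
  have c m := ucontC_cst (m%:R : C); have Xn m := ucontCX m X; have En m := ucontCX m E.
  apply: (ucontCM uY); apply: ucontCD.
    exact: ucontCM (ucontCM (ucontCM (c i') (Xn i'.-1)) X') (En (k' - i')%N).
  exact: ucontCM (ucontCM (ucontCM (c (k' - i')%N) (Xn i')) (En (k' - i').-1)) E'.
have D i' u' v' : (i' <= k.+1)%N -> haarC (fun p => Y p * dform u v u' v' k.+1 i' p) = 0.
  move=> ik'; have [c hc] := dform_interp k.+1.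
  rewrite (eq_haarC (H := fun p => \sum_r c r *
    (Y p * form (u + r%:R * u') (v + r%:R * v') k.+1 i' p))); last first.
    by move=> p; rewrite hc// mulr_sumr; apply: eq_bigr => r _; rewrite mulrCA.
  rewrite haarC_sum; last by move=> r; exact: ucontCZ.
  rewrite big1// => r _; rewrite haarC_Z// IH ?mulr0//.
  by move: onk; rewrite addSn addnS.
have k1 : (k.+1%:R : C) != 0 by rewrite pnatr_eq0.
have lower (z : C) k' i' : ((k' < k)%N -> (i' <= k.-1)%N) -> (k' = k -> z = 0) ->
    (k' <= k)%N -> z * haarC (fun p => Y p * form u v k.-1 i' p) = 0.
  move=> h1 h2; rewrite leq_eqVlt => /predU1P[/h2 ->|lt]; first by rewrite mul0r.
  rewrite IH ?mulr0//; first exact: h1.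
  by case: k lt onk {ik ud D k1 h1 h2} => //= m _; rewrite addnS /= !negbK.
have X : haarC (fun p => Y p * (xi u1 v1 p * form u v k i p)) = 0.
  apply: (mulfI k1); rewrite mulr0 -haarC_Z; last first.
    by apply: ucontCM => //; apply: ucontCM; [exact: ucontC_xi|exact: ucontC_form].
  rewrite (eq_haarC (H := fun p => Y p * dform u v u1 v1 k.+1 i.+1 p +
     (2 * (u * v1 - v * u1) * (k - i)%:R) * (Y p * form u v k.-1 i p))); last first.
    by move=> p; rewrite mulrCA xi_form//; ring.
  rewrite haarC_D//; last exact: ucontCZ.
  rewrite D// add0r haarC_Z//; apply: (lower _ i) => //.
    by move=> ik'; rewrite -ltnS prednK// (leq_trans _ ik').
  by move=> ->; rewrite subnn mulr0.
have E : haarC (fun p => Y p * (eta u2 v2 p * form u v k i p)) = 0.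
  apply: (mulfI k1); rewrite mulr0 -haarC_Z; last first.
    by apply: ucontCM => //; apply: ucontCM; [exact: ucontC_eta|exact: ucontC_form].
  rewrite (eq_haarC (H := fun p => Y p * dform u v u2 v2 k.+1 i p +
     (- (2 * (u * v2 - v * u2) * i%:R)) * (Y p * form u v k.-1 i.-1 p))); last first.
    by move=> p; rewrite mulrCA eta_form//; ring.
  rewrite haarC_D//; last exact: ucontCZ.
  rewrite D ?(leqW ik)// add0r haarC_Z//; apply: (lower _ (k - i)%N) => //.
  - by move=> _; case: (i) (k) ik => [|j] [|l].
  - move=> ki; have -> : i = 0%N by apply/eqP; rewrite -(eqn_add2l (k - i)) subnK// ki addn0.
    by rewrite mulr0 oppr0.
  - exact: leq_subr.
rewrite (eq_haarC (H := fun p => Y p * (xi u1 v1 p * form u v k i p) +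
    Y p * (eta u2 v2 p * form u v k i p))); last first.
  by move=> p; rewrite /Y exprSr; ring.
rewrite haarC_D ?X ?E ?addr0//.
  exact: ucontCM uY (ucontCM (ucontC_xi u1 v1) (ucontC_form u v k i)).
exact: ucontCM uY (ucontCM (ucontC_eta u2 v2) (ucontC_form u v k i)).
Qed.

End Localization.

Section Expansion.
Variable R : realType.
Local Notation G := (SU2 R).
Local Notation C := R[i].
Implicit Types (p h : G).

Definition dot h p : R := x0 h * x0 p + x1 h * x1 p + x2 h * x2 p + x3 h * x3 p.

Lemma ucont_dot h : ucont (dot h).
Proof.
have [u0 u1 u2 u3] := ucont_coord R.
by repeat apply: ucontD; exact: ucontZ.
Qed.

Lemma dot_xi_eta h : exists u v u' v', forall p,
  (dot h p)%:C = xi u v p + eta u' v' p.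
Proof.
exists ((ma' h + mb' h) / 4), ((ma h - mb h) / 4),
  ((ma' h - mb' h) / 4), ((- ma h - mb h) / 4) => p.
transitivity ((ma' h * ma p + mb' h * mb p + mb h * mb' p + ma h * ma' p) / 2).
  apply: (mulIf (x := 2)); first by rewrite pnatr_eq0.
  rewrite divfK ?pnatr_eq0//; apply: complexP;
    rewrite -(rmorph_nat (real_complex R)) ?ReM ?ImM ?ReD ?ImD ?ReM ?ImM /ma /mb /ma' /mb' /dot /=; ring.
by rewrite /xi /eta; field.
Qed.

Lemma dist2_dot h p : dist2 h p = 2 - 2 * dot h p.
Proof. by rewrite /dist2 /dot; have := sumsq1 h; have := sumsq1 p; lra. Qed.

(** [dot h] is a spherical harmonic of degree one on the unit three-sphere; the
    last two relations determine its moments by integration by parts. *)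
Lemma isder_dot h : exists d : 'I_3 -> G -> R,
  [/\ forall j, ucont (d j), forall j, isder j (dot h) (d j),
      forall j, isder j (d j) (fun p => - dot h p) &
      forall p, \sum_j d j p ^+ 2 = 1 - dot h p ^+ 2].
Proof.
have [[a0 a1 a2 a3] [[b0 b1 b2 b3] [c0 c1 c2 c3]]] := isder_coord R.
have [u0 u1 u2 u3] := ucont_coord R.
pose d (j : 'I_3) p : R := nth 0
  [:: x0 h * - x1 p + x1 h * x0 p + x2 h * x3 p + x3 h * - x2 p;
      x0 h * - x2 p + x1 h * - x3 p + x2 h * x0 p + x3 h * x1 p;
      x0 h * - x3 p + x1 h * x2 p + x2 h * - x1 p + x3 h * x0 p] j.
have comb j (s0 s1 s2 s3 : R) (y0 y1 y2 y3 z0 z1 z2 z3 : G -> R) :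
   isder j y0 z0 -> isder j y1 z1 -> isder j y2 z2 -> isder j y3 z3 ->
   isder j (fun p => s0 * y0 p + s1 * y1 p + s2 * y2 p + s3 * y3 p)
     (fun p => s0 * z0 p + s1 * z1 p + s2 * z2 p + s3 * z3 p).
  by move=> *; repeat apply: isderD; exact: isderZ.
have N j (f f' : G -> R) : isder j f f' -> isder j (fun p => - f p) (fun p => - f' p).
  by move=> hf p; exact: is_deriveN (hf p).
have uN (f : G -> R) : ucont f -> ucont (fun p => - f p).
  by move=> hf; apply: ucont_ext (ucontZ (-1) hf) => p; rewrite mulN1r.
exists d; split.
- by apply: ord3P; rewrite /d /=; repeat apply: ucontD; apply: ucontZ => //; exact: uN.
- by apply: ord3P; [exact: comb a0 a1 a2 a3|exact: comb b0 b1 b2 b3|exact: comb c0 c1 c2 c3].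
- apply: ord3P.
  + apply: isder_eq (comb _ _ _ _ _ _ _ _ _ _ _ _ _ (N _ _ _ a1) a0 a3 (N _ _ _ a2)) _ => p.
    by rewrite /dot; ring.
  + apply: isder_eq (comb _ _ _ _ _ _ _ _ _ _ _ _ _ (N _ _ _ b2) (N _ _ _ b3) b0 b1) _ => p.
    by rewrite /dot; ring.
  + apply: isder_eq (comb _ _ _ _ _ _ _ _ _ _ _ _ _ (N _ _ _ c3) c2 (N _ _ _ c1) c0) _ => p.
    by rewrite /dot; ring.
- move=> p; rewrite sum3 /d /=.
  transitivity ((x0 h ^+ 2 + x1 h ^+ 2 + x2 h ^+ 2 + x3 h ^+ 2) *
     (x0 p ^+ 2 + x1 p ^+ 2 + x2 p ^+ 2 + x3 p ^+ 2) - dot h p ^+ 2).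
    by rewrite /dot; ring.
  by rewrite !sumsq1 mulr1.
Qed.

Lemma isderX j (f f' : G -> R) n : isder j f f' ->
  isder j (fun p => f p ^+ n) (fun p => n%:R * f p ^+ n.-1 * f' p).
Proof.
move=> hf; elim: n => [|n IH].
  by apply: isder_eq (isder_cst j 1) _ => p; rewrite !mul0r.
under eq_fun do rewrite exprS; apply: isder_eq (isderM hf IH) _ => p.
case: n {IH} => [|n]; first by rewrite !expr0; ring.
by rewrite /= exprS [in RHS]mulrSr; ring.
Qed.

(** Integrate the derivative of [dot h ^+ n.*2.+1 * d j] and sum over [j]. *)
Lemma haar_dot_pow h n : 2 * n.+2%:R * haar (fun p => dot h p ^+ (n.+1).*2) =
  (n.*2).+1%:R * haar (fun p => dot h p ^+ n.*2).
Proof.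
have [d [ud dd ddd sd]] := isder_dot h; have uh := ucont_dot h.
have uX m : ucont (fun p => dot h p ^+ m) by exact: ucontX.
have E j : (n.*2).+1%:R * haar (fun p => dot h p ^+ n.*2 * d j p ^+ 2) =
    haar (fun p => dot h p ^+ (n.+1).*2).
  have hX := isderM (isderX (n.*2).+1 (dd j)) (ddd j).
  have ux : ucont (fun p => dot h p ^+ n.*2 * d j p ^+ 2) by apply: ucontM => //; exact: ucontX.
  have u1 : ucont (fun p => (n.*2).+1%:R * (dot h p ^+ n.*2 * d j p ^+ 2)) by exact: ucontZ.
  rewrite -haarZ//; apply/eqP; rewrite -subr_eq0 -haarB//; apply/eqP.
  apply: (haar_isder _ _ (isder_eq hX _)) => [||p /=].
  - exact: ucontM.
  - exact: ucontB.
  - by rewrite doubleS !exprS; ring.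
have S : \sum_(j < 3) haar (fun p => dot h p ^+ n.*2 * d j p ^+ 2) =
    haar (fun p => dot h p ^+ n.*2) - haar (fun p => dot h p ^+ (n.+1).*2).
  rewrite -haar_sum; last by move=> j; apply: ucontM => //; exact: ucontX.
  rewrite -haarB//; congr haar; apply/funext => p; rewrite -mulr_sumr sd doubleS !exprS; ring.
have := congr1 (fun z => (n.*2).+1%:R * z) S.
rewrite mulr_sumr; under eq_bigr do rewrite E; rewrite sum3 => h3.
have e1 : ((n.*2).+1%:R : R) = 2 * n%:R + 1 by rewrite -natr1 -mul2n natrM.
have e2 : (n.+2%:R : R) = n%:R + 2 by rewrite -addn2 natrD.
move: h3; rewrite e1 e2; lra.
Qed.

Lemma haar_dot_pow_gt0 h n : 0 < haar (fun p => dot h p ^+ n.*2).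
Proof.
elim: n => [|n IH]; first by rewrite (_ : (fun p => _) = fun=> 1) ?haar_cst.
have e : 0 < 2 * n.+2%:R :> R by rewrite mulr_gt0.
by rewrite -(pmulr_rgt0 _ e) haar_dot_pow mulr_gt0.
Qed.

Definition neg p : G := p ** flow 0 pi.

Lemma neg_xE p : [/\ x0 (neg p) = - x0 p, x1 (neg p) = - x1 p,
  x2 (neg p) = - x2 p & x3 (neg p) = - x3 p].
Proof.
have [-> -> -> ->] := mulE p (flow 0 pi); have [-> -> -> ->] := flow_xE (R := R) 0 pi.
by rewrite cospi sinpi !mul0r; split; ring.
Qed.

(** The powers [dot h ^+ n.*2] concentrate at [h] and [neg h], slowly enough
    (their moments decay like a power of [n]) to detect the value at [h] of an
    even function. *)
Lemma localize (f : G -> R) h : ucont f -> (forall p, f (neg p) = f p) ->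
  (forall n, haar (fun p => f p * dot h p ^+ n.*2) = 0) -> f h <= 0.
Proof.
move=> uf ef hf; rewrite leNgt; apply/negP => e0; set e := f h in e0.
have [B B0 hB] := ucont_bounded uf; have e2 : 0 < e / 2 by rewrite divr_gt0.
have [d' d'0 hd'] := uf _ e2; pose d := Num.min 1 d'.
have d0 : 0 < d by rewrite lt_min ltr01.
have d1 : d <= 1 by rewrite ge_min lexx.
have hd p : dist2 h p < d -> e / 2 <= f p.
  move=> hp; have /hd' : dist2 h p < d' by rewrite (lt_le_trans hp)// ge_min lexx orbT.
  by rewrite ltr_distl -/e => /andP[_]; lra.
(* [K] makes the lower bound [low] trivial away from [h] and [neg h]. *)
pose K := 2 * (B + e / 2) / d; have K0 : 0 < K by rewrite divr_gt0// mulr_gt0// addr_gt0.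
have low p : e / 2 - K * (1 - dot h p ^+ 2) <= f p.
  have dn : dist2 h (neg p) = 2 + 2 * dot h p.
    by rewrite dist2_dot /dot; have [-> -> -> ->] := neg_xE p; ring.
  have ge0 q r : 0 <= @dist2 R q r by rewrite /dist2 !addr_ge0 ?sqr_ge0.
  have h1 := ge0 h p; have h2 := ge0 h (neg p); rewrite dn in h2.
  rewrite dist2_dot in h1.
  have sq : 0 <= 1 - dot h p ^+ 2 by nra.
  have Ksq : 0 <= K * (1 - dot h p ^+ 2) by rewrite mulr_ge0// ltW.
  have [near|far] := ltP (dist2 h p) d; first by have := hd p near; lra.
  have [near'|far'] := ltP (dist2 h (neg p)) d; first by have := hd _ near'; rewrite ef; lra.
  rewrite dist2_dot in far; rewrite dn in far'.
  have hs : d / 2 <= 1 - dot h p ^+ 2 by nra.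
  have : K * (d / 2) <= K * (1 - dot h p ^+ 2) by rewrite ler_wpM2l// ltW.
  have -> : K * (d / 2) = B + e / 2 by rewrite /K; field; rewrite gt_eqF.
  by have := hB p; rewrite ler_norml => /andP[]; lra.
have uX m : ucont (fun p => dot h p ^+ m) by apply: ucontX; exact: ucont_dot.
(* For the weight [dot h ^+ n.*2] with this [n], the average of the loss
   [K * (1 - dot h ^+ 2)] is less than [e / 2]. *)
pose n := Num.truncn (6 * K / e).
have mn := haar_dot_pow_gt0 h n; have rec := haar_dot_pow h n.
have : (e / 2 - K) * haar (fun p => dot h p ^+ n.*2) + K * haar (fun p => dot h p ^+ (n.+1).*2) <= 0.
  rewrite -!haarZ// -haarD; try exact: ucontZ.
  rewrite -(hf n); apply: haar_le.
  - by apply: ucontD; exact: ucontZ.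
  - exact: ucontM.
  move=> p; have s0 : 0 <= dot h p ^+ n.*2 by rewrite -mul2n exprM exprn_ge0 ?sqr_ge0.
  have -> : dot h p ^+ n.+1.*2 = dot h p ^+ 2 * dot h p ^+ n.*2 by rewrite doubleS !exprS; ring.
  by have := ler_wpM2r s0 (low p); lra.
have : 6 * K / e < n.+1%:R by exact: truncnS_gt.
rewrite ltr_pdivrMr// => hn.
have e1 : ((n.*2).+1%:R : R) = 2 * n%:R + 1 by rewrite -natr1 -mul2n natrM.
have e3 : (n.+2%:R : R) = n%:R + 2 by rewrite -addn2 natrD.
have e4 : (n.+1%:R : R) = n%:R + 1 by rewrite natr1.
move: rec hn; rewrite e1 e3 e4; set m := haar _ in mn *; set m' := haar _.
have n0 : 0 <= (n%:R : R) by [].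
move: (n%:R) n0 => N N0 rec hn hm.
have : 2 * (N + 2) * ((e / 2 - K) * m + K * m') <= 0.
  by rewrite mulr_ge0_le0// mulr_ge0// addr_ge0.
have -> : 2 * (N + 2) * ((e / 2 - K) * m + K * m') = m * (e * (N + 2) - 3 * K).
  transitivity (2 * (N + 2) * (e / 2 - K) * m + K * (2 * (N + 2) * m')); first by ring.
  by rewrite rec; field.
rewrite pmulr_rle0//; nra.
Qed.

(** [high f] is even and orthogonal to all even powers of all the [dot h]; it is
    therefore nonpositive at every point, and so is its opposite. *)
Lemma eigfun_low (a b c mu : R) f : 0 < c -> c <= b -> b <= a ->
  eigfun (weight a b c) mu f -> mu < 8 * b ^+ 2 + 16 * c ^+ 2 ->
  (forall p, f (neg p) = f p) -> forall h, f h = low f h.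
Proof.
move=> c0 cb ba ef hmu fe h; have uf : ucont f by case: ef.
have uh := ucont_high uf.
have he p : high f (neg p) = high f p.
  rewrite /high /low fe; congr (_ - (_ + _)); apply: eq_bigr => j _; apply: eq_bigr => k _.
  rewrite /rot; have [-> -> -> ->] := neg_xE p; congr (_ * _).
  by move: j k; apply: ord3P; apply: ord3P; rewrite /rotq /=; ring.
have h0 n : haar (fun p => high f p * dot h p ^+ n.*2) = 0.
  have [u [v [u' [v' hd]]]] := dot_xi_eta h.
  have := @ortho_power R (fun p => (high f p)%:C) u v u' v' (ucontC_real uh)
    (fun k i u v ik ok => high_ortho u v c0 cb ba ef hmu ik ok) n.*2 0%N 0%N 0 0 isT.
  rewrite addn0 odd_double => /(_ isT).
  rewrite (eq_haarC (H := fun p => (high f p * dot h p ^+ n.*2)%:C)); last first.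
    by move=> p; rewrite -hd /form !expr0 !mulr1 rmorphM rmorphXn.
  by rewrite haarC_real => -[].
apply/eqP; rewrite -subr_eq0 -/(high f h) eq_le; apply/andP; split.
  exact: localize.
rewrite -oppr_le0; apply: (@localize (fun p => - high f p)).
- by apply: ucont_ext (ucontZ (-1) uh) => p; rewrite mulN1r.
- by move=> p; rewrite he.
- move=> n; rewrite -[RHS](mulr0 (-1)) -(h0 n) -haarZ.
    by congr haar; apply/funext => p; rewrite mulN1r mulNr.
  by apply: ucontM => //; apply: ucontX; exact: ucont_dot.
Qed.

(** Eigenfunctions of different eigenvalues are orthogonal. *)
Lemma eigfun_coef (w : 'I_3 -> R) mu f j k : eigfun w mu f -> lam w k != mu -> coef f j k = 0.
Proof.
move=> ef ne; have uf : ucont f by case: ef.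
have [ur [r1 [r2 [hr er]]]] := eigfun_rot w j k.
have := @eigfun_green R w mu f (fun p => (rot j k p)%:C) (fun l p => (r1 l p)%:C)
  (fun l p => (r2 l p)%:C) ef (ucontC_real ur).
have h0 l : [/\ ucontC (fun p => (r1 l p)%:C), ucontC (fun p => (r2 l p)%:C),
    isderc l (fun p => (rot j k p)%:C) (fun p => (r1 l p)%:C) &
    isderc l (fun p => (r1 l p)%:C) (fun p => (r2 l p)%:C)].
  by have [u1 u2 d1 d2] := hr l; split; [exact: ucontC_real..|exact: isderc_real|exact: isderc_real].
move=> /(_ h0).
have ul l : ucontC (fun p => (f p)%:C * (r2 l p)%:C).
  by apply: ucontCM; apply: ucontC_real => //; case: (hr l).
have uR : ucontC (fun p => (f p)%:C * (rot j k p)%:C) by apply: ucontCM; exact: ucontC_real.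
under eq_bigr do rewrite -haarC_Z//.
rewrite -haarC_sum; last by move=> l; exact: ucontCZ.
rewrite (eq_haarC (H := fun p => - (lam w k)%:C * ((f p)%:C * (rot j k p)%:C))); last first.
  move=> p; rewrite [RHS]mulrCA -rmorphN -[in RHS]rmorphM -er rmorph_sum mulr_sumr.
  by apply: eq_bigr => l _; rewrite [in RHS](rmorphM (real_complex R)) mulrCA.
rewrite haarC_Z// => /eqP; rewrite -subr_eq0 -mulrBl mulf_eq0 => /orP[|].
  by rewrite subr_eq0 eqr_opp eq_complex /= (negbTE ne).
rewrite (eq_haarC (H := fun p => (f p * rot j k p)%:C)); last by move=> p; rewrite rmorphM.
by rewrite haarC_real eq_complex /= eqxx andbT /coef => /eqP ->; rewrite mulr0.
Qed.

Lemma eigfun_haar (w : 'I_3 -> R) mu f : eigfun w mu f -> mu != 0 -> haar f = 0.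
Proof.
move=> [uf [f1 [f2 [hf ef]]]] mu0.
apply: (mulfI (x := - mu)); first by rewrite oppr_eq0.
rewrite mulr0 -haarZ//; under eq_fun do rewrite -ef.
rewrite haar_sum; last by move=> j; apply: ucontZ; case: (hf j).
rewrite big1// => j _; have [u1 u2 _ d2] := hf j.
by rewrite haarZ// (haar_isder u1 u2 d2) mulr0.
Qed.

End Expansion.

(** * Smooth functions on the rotation group *)

Section CkTheory.
Variables (R : realType) (V : normedModType R).
Implicit Types (U : set V) (F H : V -> R).

Lemma near_eq_differentiable F H (x : V) : (\forall y \near x, F y = H y) ->
  differentiable F x -> differentiable H x.
Proof.
move=> FH /diff_locallyP[dc /eqaddoP h].
have FHx : F x = H x := nbhs_singleton FH.
have h' : H \o shift x = cst (H x) + 'd F x +o_ 0 id.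
  apply/eqaddoP => e e0; have := h e e0.
  have : \forall y \near 0, F (y + x) = H (y + x).
    by move: FH; rewrite (near_shift 0) /=; apply: filterS => y; rewrite subr0.
  by apply: filterS2 => y Ey; rewrite /= !fctE /= -Ey -FHx.
by apply/diff_locallyP; rewrite (diff_unique dc h').
Qed.

Lemma open_near_eq U F H x : open U -> (forall y, U y -> F y = H y) -> U x ->
  \forall y \near x, F y = H y.
Proof.
move=> oU FH Ux; have := open_nbhs_nbhs (conj oU Ux).
by apply: filterS => y /FH.
Qed.

(** The product rule only holds on [U], whereas the derivative of a derivative is
    that of a function on the whole space: germs have to be compared. *)
Lemma Ck_eq k U F H : open U -> (forall x, U x -> F x = H x) -> Ck k U F -> Ck k U H.
Proof.
move=> oU; elim: k F H => [|k IH] F H FH /=.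
  move=> cF x Ux; have n := open_near_eq oU FH Ux.
  rewrite /prop_for /continuous_at -(FH _ Ux).
  by apply: cvg_trans (cF x Ux); apply: near_eq_cvg.
move=> [dF cF]; split=> [x Ux|v].
  exact: near_eq_differentiable (open_near_eq oU FH Ux) (dF x Ux).
apply: IH (cF v) => x Ux; apply: near_eq_derive.
exact: open_near_eq Ux.
Qed.

Lemma CkW k U F : Ck k.+1 U F -> Ck k U F.
Proof.
elim: k F => [|k IH] F /=; first by move=> [dF _] x /dF/differentiable_continuous.
by move=> [dF cF]; split => // v; apply: IH; exact: cF.
Qed.

Lemma Ck_cst k U (c : R) : Ck k U (fun=> c).
Proof.
elim: k c => [|k IH] c /=; first by move=> x _; exact: cvg_cst.
split=> [x _|v]; first exact: differentiable_cst.
have -> : 'D_v ((fun=> c) : V -> R) = fun=> 0 by apply/funext => x; exact: derive_cst.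
exact: IH.
Qed.

Lemma CkD k U F H : open U -> Ck k U F -> Ck k U H -> Ck k U (fun x => F x + H x).
Proof.
move=> oU; elim: k F H => [|k IH] F H /=.
  by move=> cF cH x Ux; exact: cvgD (cF x Ux) (cH x Ux).
move=> [dF cF] [dH cH]; split=> [x Ux|v].
  exact: differentiableD (dF x Ux) (dH x Ux).
apply: Ck_eq oU _ (IH _ _ (cF v) (cH v)) => x Ux.
by rewrite (deriveD (diff_derivable (dF x Ux)) (diff_derivable (dH x Ux))).
Qed.

Lemma CkM k U F H : open U -> Ck k U F -> Ck k U H -> Ck k U (fun x => F x * H x).
Proof.
move=> oU; elim: k F H => [|k IH] F H.
  by move=> cF cH x Ux; exact: cvgM (cF x Ux) (cH x Ux).
move=> cF cH; have [dF cF'] := cF; have [dH cH'] := cH; split=> [x Ux|v].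
  exact: differentiableM (dF x Ux) (dH x Ux).
apply: Ck_eq oU _ (CkD oU (IH _ _ (CkW cF) (cH' v)) (IH _ _ (CkW cH) (cF' v))).
move=> x Ux.
by rewrite (deriveM (diff_derivable (dF x Ux)) (diff_derivable (dH x Ux))).
Qed.

Lemma Ck_linear k U (F : V -> R) : linear F -> continuous F -> Ck k U F.
Proof.
move=> lF cF; pose lFM := GRing.isLinear.Build _ _ _ _ _ lF.
pose L : {linear V -> R} := HB.pack F lFM.
have dF x : differentiable F x := @linear_differentiable _ _ _ L x cF.
case: k => [|k] /=; first by move=> x _; exact: cF.
split=> [x _|v]; first exact: dF.
have -> : 'D_v F = fun=> F v.
  by apply/funext => x; rewrite deriveE// (@diff_lin _ _ _ L).
exact: Ck_cst.
Qed.

End CkTheory.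

Section Ambient.
Variable R : realType.
Local Notation G := (SU2 R).
Local Notation E := ('M[R]_2 * 'M[R]_2)%type.
Implicit Types (p q g h : G).

Definition cE (m : 'I_4) (x : E) : R :=
  nth 0 [:: x.1 0 0; x.2 0 0; x.1 0 1; x.2 0 1] m.

Definition quatE (a b c d : R) : E :=
  (map_mx (@complex.Re R) (quat a b c d), map_mx (@complex.Im R) (quat a b c d)).

Definition bE (m : 'I_4) : E :=
  quatE (m == 0)%:R (m == 1)%:R (m == 2%:R)%:R (m == 3%:R)%:R.

Lemma SU2ambE g : SU2amb g = quatE (x0 g) (x1 g) (x2 g) (x3 g).
Proof. by rewrite /SU2amb /quatE -valE. Qed.

Lemma quatE_basis a b c d :
  quatE a b c d = a *: bE 0 + b *: bE 1 + c *: bE 2%:R + d *: bE 3%:R.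
Proof.
by congr (_, _); apply/matrixP; apply: ord2P; apply: ord2P; rewrite !mxE /=; ring.
Qed.

Lemma quatE_linear (s t a b c d a' b' c' d' : R) :
  quatE (s * a + t * a') (s * b + t * b') (s * c + t * c') (s * d + t * d') =
  s *: quatE a b c d + t *: quatE a' b' c' d'.
Proof.
by congr (_, _); apply/matrixP; apply: ord2P; apply: ord2P; rewrite !mxE /=; ring.
Qed.

Lemma cE_amb m g : cE m (SU2amb g) = xc m g.
Proof. by rewrite SU2ambE; move: m; apply: ord4P; rewrite /cE /xc /= !mxE. Qed.

Lemma Ck_cE k U m : Ck k U (cE m).
Proof.
apply: Ck_linear; first by move: m; apply: ord4P => s x y; rewrite /cE /= !mxE.
have c1 (i j : 'I_2) : continuous (fun x : E => x.1 i j).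
  by move=> x; apply: (@continuous_comp _ _ _ fst (fun N : 'M[R]_2 => N i j));
    [exact: cvg_fst|exact: coord_continuous].
have c2 (i j : 'I_2) : continuous (fun x : E => x.2 i j).
  by move=> x; apply: (@continuous_comp _ _ _ snd (fun N : 'M[R]_2 => N i j));
    [exact: cvg_snd|exact: coord_continuous].
by move: m; apply: ord4P; rewrite /cE /=.
Qed.

(** Right multiplication by the [j]-th imaginary unit, in coordinates. *)
Definition rmulj (j : 'I_3) (y : 'I_4 -> R) (m : 'I_4) : R := nth 0 (nth [::]
  [:: [:: - y 1; y 0; y 3%:R; - y 2%:R]; [:: - y 2%:R; - y 3%:R; y 0; y 1];
      [:: - y 3%:R; y 2%:R; - y 1; y 0]] j) m.

Lemma xc_flow j m g t :
  xc m (g ** flow j t) = xc m g * cos t + rmulj j (fun n => xc n g) m * sin t.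
Proof.
have [e0 e1 e2 e3] := mulE g (flow j t); have [f0 f1 f2 f3] := flow_xE j t.
by move: m j e0 e1 e2 e3 f0 f1 f2 f3; apply: ord4P; apply: ord3P => /=
  e0 e1 e2 e3 f0 f1 f2 f3; rewrite /rmulj /xc /= ?e0 ?e1 ?e2 ?e3 f0 f1 f2 f3; ring.
Qed.

Definition dirE j g : E := \sum_m rmulj j (fun n => xc n g) m *: bE m.

(** The orbits of the one-parameter subgroups are great circles. *)
Lemma amb_flow j g t : SU2amb (g ** flow j t) = cos t *: SU2amb g + sin t *: dirE j g.
Proof.
rewrite !SU2ambE.
have [-> -> -> ->] : [/\ x0 (g ** flow j t) = _, x1 (g ** flow j t) = _,
    x2 (g ** flow j t) = _ & x3 (g ** flow j t) = _ ] :=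
  And4 (xc_flow j 0 g t) (xc_flow j 1 g t) (xc_flow j 2%:R g t) (xc_flow j 3%:R g t).
by rewrite /dirE sum4 -quatE_basis -quatE_linear; congr quatE; rewrite mulrC [_ * sin t]mulrC.
Qed.

End Ambient.

Section Smooth.
Variable R : realType.
Local Notation G := (SU2 R).
Local Notation E := ('M[R]_2 * 'M[R]_2)%type.
Local Notation SO := (SO3 R).
Implicit Types (p q g h : G) (f : SO -> R).

Definition pullback f g : R := f (\pi_(SO3 R) g).

Lemma su2norm_basis (j : 'I_3) (s : R) : su2norm (s *: delta_mx 0 j) = `|s|.
Proof.
rewrite /su2norm !mxE -sqrtr_sqr; congr Num.sqrt.
by move: j; apply: ord3P => /=; ring.
Qed.

(** The closed form of the exponential depends on the even function [cos] and on
    [sin s / s], so that the sign of [s] does not matter. *)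
Lemma SU2exp_basis (j : 'I_3) (s : R) : SU2exp (s *: delta_mx 0 j) = flow j s.
Proof.
apply/val_inj; rewrite [RHS]valE /=; have [-> -> -> ->] := flow_xE j s.
have [s0|s0] := eqVneq s 0.
  rewrite s0 scale0r (_ : su2mx 0 = 0); last by rewrite /su2mx !mxE !scale0r !addr0.
  rewrite expmx0 cos0 sin0 !mul0r; apply/matrixP; apply: ord2P; apply: ord2P;
    rewrite !mxE //=; apply: complexP => //=; ring.
rewrite expmx_su2 su2norm_basis ?normr_eq0//.
have -> : cos `|s| = cos s.
  by case: (ger0P s) => // _; rewrite cosN.
have -> : sin `|s| / `|s| = sin s / s.
  by case: (ger0P s) => // _; rewrite sinN invrN mulrNN.
rewrite su2mxE !mxE.
move: j; apply: ord3P; apply/matrixP; apply: ord2P; apply: ord2P;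
  rewrite !mxE /=; apply: complexP; rewrite /= ?ReD ?ImD ?ReM ?ImM /=; field; exact: s0.
Qed.

Lemma Dfield_basis f (j : 'I_3) (w : R) g :
  Dfield (cst (w *: delta_mx 0 j)) (f : SO -> R^o) (\pi_(SO3 R) g) =
  derive1 (fun t : R => pullback f (g ** flow j (t * w))) 0.
Proof.
rewrite /Dfield; apply: (congr1 (fun k : R -> R^o => derive1 k 0)).
by apply/funext => t /=; rewrite /pullback /SO3exp /= SO3mul_pi scalerA SU2exp_basis.
Qed.

Lemma is_derive_scalel (V : normedModType R) (k : R -> R) (k' t : R) (A : V) :
  is_derive t 1 k k' -> is_derive t 1 (fun s => k s *: A) (k' *: A).
Proof.
move=> hk; have dk : differentiable k t.
  by apply/derivable1_diffP; exact: (@ex_derive _ _ _ _ _ _ _ hk).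
have dkA := differentiableZl A dk.
apply: DeriveDef; first exact/diff_derivable.
rewrite deriveE// (diffZl A dk) -deriveE//.
by rewrite (@derive_val _ _ _ _ _ _ _ hk).
Qed.

Lemma is_derive_circle (V : normedModType R) (A B : V) :
  is_derive (0 : R) 1 (fun t : R => cos t *: A + sin t *: B) B.
Proof.
have hc : is_derive (0 : R) 1 (fun t : R => cos t *: A + sin t *: B)
    (- sin 0 *: A + cos 0 *: B).
  apply: is_deriveD.
    exact: is_derive_scalel (is_derive_cos 0).
  exact: is_derive_scalel (is_derive_sin 0).
by rewrite sin0 cos0 oppr0 scale0r add0r scale1r in hc.
Qed.

(** Chain rule along the great circle through [g] in the direction [dirE j g],
    which stays in the open set [U] for small times. *)
Lemma local_der f g (U : set E) (F : E -> R) j : open U -> U (SU2amb g) ->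
  (forall x, U x -> differentiable F x) ->
  (forall h, U (SU2amb h) -> pullback f h = F (SU2amb h)) ->
  is_derive (0 : R) 1 (fun t : R => pullback f (g ** flow j t)) ('D_(dirE j g) F (SU2amb g)).
Proof.
move=> oU Ug dF hF; pose A := SU2amb g; pose B := dirE j g.
pose c (t : R) : E := cos t *: A + sin t *: B.
have hc : is_derive (0 : R) 1 c B := is_derive_circle A B.
have c0 : c 0 = A by rewrite /c cos0 sin0 scale1r scale0r addr0.
have dc : differentiable c 0.
  by apply/derivable1_diffP; exact: (@ex_derive _ _ _ _ _ _ _ hc).
have vc : 'd c 0 1 = B by rewrite -deriveE// (@derive_val _ _ _ _ _ _ _ hc).
have dF' : differentiable F (c 0) by rewrite c0; exact: dF.
have dFc : differentiable (F \o c) 0 := differentiable_comp dc dF'.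
have hFc : is_derive (0 : R) 1 (F \o c) ('D_B F A).
  apply: (@DeriveDef _ _ _ _ _ (F \o c)); first exact/diff_derivable.
  by rewrite deriveE// (diff_comp dc dF') /= vc c0 -deriveE//; exact: dF.
apply: near_eq_is_derive hFc.
have : \forall t \near (0 : R), U (c t).
  by apply: (differentiable_continuous dc); rewrite c0; exact: open_nbhs_nbhs.
apply: filterS => t Uct; rewrite hF.
  by rewrite /= amb_flow.
by rewrite amb_flow.
Qed.

Definition Xd (j : 'I_3) f : SO -> R := Dfield (cst (delta_mx 0 j)) (f : SO -> R^o).

Lemma pullback_Xd j f g :
  pullback (Xd j f) g = derive1 (fun t : R => pullback f (g ** flow j t)) 0.
Proof.
rewrite /pullback /Xd -[delta_mx 0 j]scale1r Dfield_basis.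
by apply: (congr1 (fun k : R -> R => derive1 k 0)); apply/funext => t; rewrite mulr1.
Qed.

Lemma Ck_rmulj k (U : set E) j m : open U ->
  Ck k U (fun x => rmulj j (fun n => cE n x) m).
Proof.
move=> oU; have N n : Ck k U (fun x => - cE n x).
  apply: Ck_eq oU _ (CkM oU (Ck_cst k U (-1)) (Ck_cE k U n)) => x _.
  by rewrite mulN1r.
by move: m j; apply: ord4P; apply: ord3P; rewrite /rmulj /=; first [exact: N|exact: Ck_cE].
Qed.

(** The local extension of the derivative is a combination of the directional
    derivatives of the local extension of [f], whose coefficients are linear. *)
Lemma smooth_Xd j f : smooth f -> smooth (Xd j f) /\ isder j (pullback f) (pullback (Xd j f)).
Proof.
move=> sf; have der g (U : set E) (F : E -> R) : open U -> U (SU2amb g) ->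
    (forall k, Ck k U F) -> (forall h, U (SU2amb h) -> pullback f h = F (SU2amb h)) ->
    is_derive (0 : R) 1 (fun t : R => pullback f (g ** flow j t)) ('D_(dirE j g) F (SU2amb g)).
  by move=> oU Ug cF hF; apply: local_der oU Ug _ hF; have [] := cF 1%N.
split=> [g|g]; last first.
  have [U [F [oU Ug cF hF]]] := sf g; have h := der g U F oU Ug cF hF.
  by rewrite pullback_Xd derive1E (@derive_val _ _ _ _ _ _ _ h).
have [U [F [oU Ug cF hF]]] := sf g.
exists U, (fun x => \sum_m rmulj j (fun n => cE n x) m * 'D_(bE R m) F x); split=> //.
  move=> k; under [X in Ck k U X]eq_fun do rewrite sum4.
  have [_ cF'] := cF k.+1.
  by do 3 ?(apply: CkD => //); (apply: CkM => //; [exact: Ck_rmulj|exact: cF']).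
move=> h Uh; rewrite -/(pullback (Xd j f) h) pullback_Xd derive1E.
rewrite (@derive_val _ _ _ _ _ _ _ (der h U F oU Uh cF hF)).
have dF : differentiable F (SU2amb h) by have [dF _] := cF 1%N; exact: dF.
rewrite deriveE// /dirE linear_sum; apply: eq_bigr => m _.
rewrite linearZ /= deriveE//; congr (_ * _); congr rmulj.
by apply/funext => n; rewrite cE_amb.
Qed.

(** ** Uniform continuity of smooth functions *)

Lemma smooth_cts f g (e : R) : smooth f -> 0 < e ->
  exists2 r : R, 0 < r & forall q, dist2 g q < r -> `|pullback f g - pullback f q| < e.
Proof.
move=> sf e0; have [U [F [oU Ug cF hF]]] := sf g.
have cFg : {for SU2amb g, continuous F} := cF 0%N _ Ug.
have nb : nbhs (SU2amb g) (U `&` [set x | `|F (SU2amb g) - F x| < e]).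
  apply: filterI; first exact: open_nbhs_nbhs.
  exact: ((cvgrPdist_lt _ _).1 cFg e e0).
have [r /= r0 hr] := (nbhs_ballP _ _).1 nb.
exists (r ^+ 2); first by rewrite exprn_gt0.
move=> q /(dist2_coord r0)[h0 h1 h2 h3].
have opp (s t : R) : `|s - t| < r -> `|- s + t| < r by rewrite distrC [- s + t]addrC.
have [Uq lt] : (U `&` [set x | `|F (SU2amb g) - F x| < e]) (SU2amb q).
  apply: hr; rewrite !SU2ambE; split; split=> //; apply: ord2P; apply: ord2P;
    by rewrite !mxE /= /ball /= ?opprK//; exact: opp.
by rewrite /pullback !hF.
Qed.

Definition rowc p : 'rV[R]_4 := \row_m xc m p.

Lemma compact_sphere : compact (range rowc).
Proof.
have -> : range rowc = [set v : 'rV[R]_4 | \sum_m v 0 m ^+ 2 = 1].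
  apply/seteqP; split=> [_ [p _ <-]|v /=].
    by rewrite /= sum4 !mxE /xc /= sumsq1.
  rewrite sum4 => hv; exists (mkSU2 hv) => //; apply/rowP => m; rewrite mxE.
  by have [e0 e1 e2 e3] := mkSU2E hv; move: m; apply: ord4P; rewrite /xc /=.
apply: bounded_closed_compact.
  exists 1; split; first exact: num_real.
  move=> M M1 v /= hv; rewrite [leLHS]/Num.Def.normr /= mx_normrE.
  apply: bigmax_le => [|[i m] _ /=]; first by rewrite ltW// (lt_trans ltr01).
  rewrite ord1 (le_trans _ (ltW M1))//.
  rewrite -(@ler_pXn2r _ 2) ?nnegrE// expr1n real_normK ?num_real//.
  by rewrite -hv (bigD1 m)//= lerDl sumr_ge0// => n _; rewrite sqr_ge0.
have c (m : 'I_4) : continuous (fun v : 'rV[R]_4 => v 0 m ^+ 2).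
  move=> v; apply: (@continuous_comp _ _ _ (fun v : 'rV[R]_4 => v 0 m) (fun x : R => x ^+ 2)).
    exact: coord_continuous.
  exact: exprn_continuous.
have -> : [set v : 'rV[R]_4 | \sum_m v 0 m ^+ 2 = 1] =
    (fun v : 'rV[R]_4 => v 0 0 ^+ 2 + v 0 1 ^+ 2 + v 0 2%:R ^+ 2 + v 0 3%:R ^+ 2) @^-1` [set 1].
  by apply/seteqP; split=> v /=; rewrite sum4.
apply: preimage_closed; last exact: closed_eq.
by move=> v _; exact: (continuousD (continuousD (continuousD (c 0 v) (c 1 v)) (c 2%:R v)) (c 3%:R v)).
Qed.

Lemma ucont_pullback f : smooth f -> ucont (pullback f).
Proof.
move=> sf e e0.
pose P (d : R) (v : 'rV[R]_4) := forall p q, v = rowc p -> dist2 p q < d ->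
  `|pullback f p - pullback f q| < e.
have near_cov := (compact_near_coveringP _).1 compact_sphere R (0 : R)^'+ P _.
have : \forall d \near (0 : R)^'+, range rowc `<=` P d.
  apply: near_cov => _ [p0 _ <-].
  have e2 : 0 < e / 2 by rewrite divr_gt0.
  have [r r0 hr] := smooth_cts p0 sf e2.
  have [s s0 hs] : exists2 s : R, 0 < s & 16 * s ^+ 2 <= r.
    exists (Num.min 1 r / 4); first by rewrite divr_gt0// lt_min ltr01.
    have h1 : Num.min 1 r <= 1 by rewrite ge_min lexx.
    have h2 : Num.min 1 r <= r by rewrite ge_min lexx orbT.
    have h3 : 0 < Num.min 1 r by rewrite lt_min ltr01.
    nra.
  exists (ball (rowc p0) s, [set d : R | d < r / 4]) => /=.
    split; first exact: nbhsx_ballx.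
    by apply: nbhs_right_lt; rewrite divr_gt0.
  move=> [v d] /= [[_ bv] dr] p q vp pq.
  have c m : (xc m p0 - xc m p) ^+ 2 < s ^+ 2.
    have := bv 0 m; rewrite vp !mxE /ball /= => h.
    by rewrite -real_normK ?num_real// ltr_pXn2r ?nnegrE// ltW.
  have p0p : dist2 p0 p < r / 4.
    have := c 0; have := c 1; have := c 2%:R; have := c 3%:R.
    by rewrite /xc /dist2 /=; lra.
  have p0q : dist2 p0 q < r by have := dist2D p0 p q; lra.
  have r4 : r / 4 <= r by lra.
  have h1 := hr p (lt_le_trans p0p r4); have h2 := hr q p0q.
  rewrite (le_lt_trans (ler_distD (pullback f p0) _ _))// distrC [e]splitr.
  exact: ltrD.
move=> hP; have hP' : \forall d \near (0 : R)^'+, range rowc `<=` P d /\ 0 < d.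
  by apply: filterI hP _; exact: nbhs_right_gt.
have [d [hd d0]] := @filter_ex _ _ (at_right_proper_filter (0 : R)) _ hP'.
exists d => // p q pq; apply: hd pq; last by [].
by exists p.
Qed.

End Smooth.

(** * The Laplacian in the left-invariant frame *)

Section Laplacian.
Variable R : realType.
Local Notation G := (SU2 R).
Local Notation SO := (SO3 R).
Implicit Types (p q g h : G) (f : SO -> R) (j k : 'I_3).

Lemma is_derive_scaled (V : normedModType R) (k : R -> V) (k' : V) (w : R) :
  is_derive (0 : R) 1 k k' -> is_derive (0 : R) 1 (fun t : R => k (t * w)) (w *: k').
Proof.
move=> hk; have dk : differentiable k 0.
  by apply/derivable1_diffP; exact: (@ex_derive _ _ _ _ _ _ _ hk).
have dm : is_derive (0 : R) 1 (fun t : R => t *: w) (1 *: w).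
  exact: is_derive_scalel (is_derive_id _ _).
rewrite scale1r in dm; have dm' : differentiable (fun t : R => t *: w) 0.
  by apply/derivable1_diffP; exact: (@ex_derive _ _ _ _ _ _ _ dm).
have z : (0 : R) *: w = 0 by rewrite scale0r.
have dk' : differentiable k ((fun t : R => t *: w) 0) by rewrite z.
have dc : differentiable (k \o (fun t : R => t *: w)) 0 := differentiable_comp dm' dk'.
apply: (@DeriveDef _ _ _ _ _ (k \o (fun t : R => t *: w))); first exact/diff_derivable.
have vm : 'd (fun t : R => t *: w) 0 1 = w.
  by rewrite -deriveE// (@derive_val _ _ _ _ _ _ _ dm).
have vk : 'd k 0 w = w *: k'.
  rewrite -{1}[w]mulr1 -[w * 1]/(w *: 1) linearZ /=; congr (_ *: _).
  by rewrite -deriveE// (@derive_val _ _ _ _ _ _ _ hk).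
by rewrite deriveE// (diff_comp dm' dk') -vk /= vm z.
Qed.

Lemma isder_pullback_Xd j f : smooth f -> isder j (pullback f) (pullback (Xd j f)).
Proof. by move=> /(smooth_Xd j)[]. Qed.

Lemma smooth_derived j f : smooth f -> smooth (Xd j f).
Proof. by move=> /(smooth_Xd j)[]. Qed.

Lemma su2bracket_coord (u v : su2 R) :
  [/\ su2bracket u v 0 0 = 2 * (u 0 1 * v 0 2%:R - u 0 2%:R * v 0 1),
      su2bracket u v 0 1 = 2 * (u 0 2%:R * v 0 0 - u 0 0 * v 0 2%:R) &
      su2bracket u v 0 2%:R = 2 * (u 0 0 * v 0 1 - u 0 1 * v 0 0)].
Proof.
by rewrite /su2bracket !su2mxE !mul_mx2 !mxE /=; split; ring.
Qed.

Lemma su2bracketC (u v : su2 R) : su2bracket u v = - su2bracket v u.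
Proof.
have [e0 e1 e2] := su2bracket_coord u v; have [f0 f1 f2] := su2bracket_coord v u.
have N (x : su2 R) k : (- x) 0 k = - x 0 k by rewrite mxE.
move: (su2bracket u v) (su2bracket v u) e0 e1 e2 f0 f1 f2 => x y e0 e1 e2 f0 f1 f2.
by apply: row3P; rewrite N ?e0 ?e1 ?e2 ?f0 ?f1 ?f2; ring.
Qed.

Section Koszul.
Variables (a b c : R) (a0 : 0 < a) (b0 : 0 < b) (c0 : 0 < c).
Local Notation w := (weight a b c).
Local Notation e := (frame a b c).

Lemma weight_gt0 j : 0 < w j.
Proof. by move: j; apply: ord3P; rewrite /weight. Qed.

Lemma frame_xE j k : e j 0 k = w j * (k == j)%:R.
Proof. by rewrite /frame !mxE eqxx. Qed.

Lemma frame_diag j : e j 0 j = w j.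
Proof. by rewrite frame_xE eqxx mulr1. Qed.

Lemma frame_off j k : k != j -> e j 0 k = 0.
Proof. by rewrite frame_xE => /negbTE ->; rewrite mulr0. Qed.

Lemma metricC u v : metric a b c u v = metric a b c v u.
Proof. by apply: eq_bigr => k _; rewrite [u 0 k * _]mulrC. Qed.

Lemma metric_frame u j : metric a b c u (e j) = u 0 j / w j.
Proof.
rewrite /metric (bigD1 j)//= big1 => [|k kj]; last first.
  by rewrite frame_off// mulr0 mul0r.
by rewrite frame_diag addr0; field; rewrite gt_eqF// weight_gt0.
Qed.

Lemma metric_nabla (V W : SO -> su2 R) j P :
  inner a b c (nabla a b c V W) (cst (e j)) P = koszul a b c V W (cst (e j)) P / 2.
Proof.
rewrite /inner metric_frame /nabla summxE (bigD1 j)//= big1 => [|k kj]; last first.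
  by rewrite mxE frame_off ?mulr0// eq_sym.
by rewrite mxE frame_diag addr0 mulfK// gt_eqF// weight_gt0.
Qed.

Lemma Dfield_cst (W : normedModType R) (V : SO -> su2 R) (z : W) P :
  Dfield V (cst z) P = 0.
Proof. exact: derive1_cst. Qed.

Lemma metric0l v : metric a b c 0 v = 0.
Proof. by rewrite /metric big1// => k _; rewrite mxE !mul0r. Qed.

Lemma metricD u u' v : metric a b c (u + u') v = metric a b c u v + metric a b c u' v.
Proof. by rewrite /metric -big_split; apply: eq_bigr => k _ /=; rewrite mxE; ring. Qed.

Lemma metricN u v : metric a b c (- u) v = - metric a b c u v.
Proof. by rewrite /metric -sumrN; apply: eq_bigr => k _ /=; rewrite mxE; ring. Qed.

(** In the frame only the derivative of the coefficients survives: the frame is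
    orthonormal, and the bracket with a frame vector is orthogonal to it. *)
Lemma koszul_frame (W : SO -> su2 R) j P :
  koszul a b c (cst (e j)) W (cst (e j)) P / 2 = Dfield (cst (e j)) W P 0 j / w j.
Proof.
have bj u : su2bracket (e j) u 0 j = 0.
  have [h0 h1 h2] := su2bracket_coord (e j) u.
  move: j h0 h1 h2; apply: ord3P => h0 h1 h2; [rewrite h0|rewrite h1|rewrite h2];
    by rewrite !frame_off//; ring.
have L1 : Lie (cst (e j)) W P = Dfield (cst (e j)) W P + su2bracket (e j) (W P).
  by rewrite /Lie Dfield_cst subr0.
have L2 : Lie W (cst (e j)) P = - Lie (cst (e j)) W P.
  by rewrite L1 /Lie Dfield_cst sub0r su2bracketC opprD.
have L3 : Lie (cst (e j)) (cst (e j)) P = 0.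
  rewrite /Lie Dfield_cst subrr add0r.
  have h : su2bracket (e j) (e j) = - su2bracket (e j) (e j) := su2bracketC _ _.
  by apply: row3P; move: h => /rowP h; [have := h 0|have := h 1|have := h 2%:R];
    rewrite !mxE; lra.
rewrite /koszul (_ : inner a b c (cst (e j)) W = inner a b c W (cst (e j))); last first.
  by apply/funext => Q; rewrite /inner metricC.
rewrite (_ : inner a b c (cst (e j)) (cst (e j)) = cst (metric a b c (e j) (e j)))//.
rewrite Dfield_cst addr0 subrr add0r /inner L2 L3 metric0l addr0 metricN opprK.
by rewrite L1 metricD !metric_frame bj mul0r addr0; field; rewrite gt_eqF// weight_gt0.
Qed.

Lemma divergence_frame (W : SO -> su2 R) P :
  divergence a b c W P = \sum_j Dfield (cst (e j)) W P 0 j / w j.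
Proof. by apply: eq_bigr => j _; rewrite metric_nabla koszul_frame. Qed.

Lemma Dfield_frame f j g : smooth f ->
  Dfield (cst (e j)) (f : SO -> R^o) (\pi_(SO3 R) g) = w j * pullback (Xd j f) g.
Proof.
move=> sf; rewrite /frame Dfield_basis derive1E.
have h := is_derive_scaled (w j) (isder_pullback_Xd j sf g).
by rewrite (@derive_val _ _ _ _ _ _ _ h).
Qed.

(** The gradient has the coordinate [w k ^+ 2 * Xd k f] on the [k]-th basis
    vector: one factor comes from the frame, the other from the derivative. *)
Lemma laplaceE f g : smooth f ->
  laplace a b c f (\pi_(SO3 R) g) = - \sum_j w j ^+ 2 * pullback (Xd j (Xd j f)) g.
Proof.
move=> sf; rewrite /laplace divergence_frame; congr (- _).
apply: eq_bigr => j _; rewrite /Dfield derive1E.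
have gradE h k : grad a b c f (\pi_(SO3 R) h) 0 k = w k ^+ 2 * pullback (Xd k f) h.
  rewrite /grad summxE (bigD1 k)//= big1 => [|l lk]; last first.
    by rewrite mxE frame_off ?mulr0// eq_sym.
  by rewrite mxE frame_diag Dfield_frame//; ring.
set T := (fun t : R => _).
have TE t k : T t 0 k = w k ^+ 2 * pullback (Xd k f) (g ** flow j (t * w j)).
  by rewrite /T /SO3exp SO3mul_pi gradE /frame /= scalerA SU2exp_basis.
have dT k : is_derive (0 : R) 1 (fun t => T t 0 k)
    (w k ^+ 2 * (w j * pullback (Xd j (Xd k f)) g)).
  rewrite (_ : (fun t => T t 0 k) = w k ^+ 2 \*: (fun t => pullback (Xd k f) (g ** flow j (t * w j)))).
    apply: is_deriveZ.
    exact: is_derive_scaled (isder_pullback_Xd j (smooth_derived k sf) g).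
  by apply/funext => t; rewrite TE.
have DT : derivable T 0 1.
  apply/derivable_mxP => i k; rewrite ord1; exact: (@ex_derive _ _ _ _ _ _ _ (dT k)).
rewrite (derive_mx DT) mxE (@derive_val _ _ _ _ _ _ _ (dT j)).
by field; rewrite gt_eqF// weight_gt0.
Qed.

End Koszul.
End Laplacian.

(** * Eigenspaces *)

Section Eigenspaces.
Variable R : realType.
Local Notation G := (SU2 R).
Local Notation SO := (SO3 R).
Implicit Types (p q g h : G) (f : SO -> R) (j k : 'I_3) (P : SO).

Lemma repr_sign g : let h := repr (\pi_(SO3 R) g) in
  [/\ x0 h = x0 g, x1 h = x1 g, x2 h = x2 g & x3 h = x3 g] \/
  [/\ x0 h = - x0 g, x1 h = - x1 g, x2 h = - x2 g & x3 h = - x3 g].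
Proof.
move=> h; have /eqP := reprK (\pi_(SO3 R) g); rewrite eqmodE /= /eq_sign -/h.
rewrite /x0 /x1 /x2 /x3 => /orP[] /eqP ->; [left|right] => //.
by rewrite !mxE; case: (val g 0 0) (val g 0 1) => [??] [].
Qed.

Lemma pullback_neg f p : pullback f (neg p) = pullback f p.
Proof.
rewrite /pullback; congr f; apply/eqP; rewrite eqmodE /= /eq_sign; apply/orP; right.
apply/eqP; rewrite !valE; have [-> -> -> ->] := neg_xE p.
by apply/matrixP; apply: ord2P; apply: ord2P; rewrite !mxE; apply: complexP => /=; ring.
Qed.

(** The entries of the adjoint representation are even, hence descend. *)
Definition rotS j k P : R := rot j k (repr P).

Lemma pullback_rotS j k g : pullback (rotS j k) g = rot j k g.
Proof.
rewrite /pullback /rotS /rot.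
by have [[-> -> -> ->]|[-> -> -> ->]] := repr_sign g => //;
  move: j k; apply: ord3P; apply: ord3P; rewrite /rotq /=; ring.
Qed.

Lemma smooth_rotS j k : smooth (rotS j k).
Proof.
move=> g; exists setT, (fun x => rotq j k (cE 0 x) (cE 1 x) (cE 2%:R x) (cE 3%:R x)).
split=> //; first exact: openT.
  move=> l; have c m : Ck l setT (cE (R := R) m) := Ck_cE l setT m.
  have oT : open [set: 'M[R]_2 * 'M[R]_2] by exact: openT.
  have N F : Ck l [set: 'M[R]_2 * 'M[R]_2] F -> Ck l setT (fun x => - F x).
    move=> cF; apply: Ck_eq oT _ (CkM oT (Ck_cst l setT (-1)) cF) => x _.
    by rewrite mulN1r.
  have B F H : Ck l [set: 'M[R]_2 * 'M[R]_2] F -> Ck l setT H -> Ck l setT (fun x => F x - H x).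
    by move=> cF cH; apply: CkD => //; exact: N.
  have Z (s : R) F : Ck l [set: 'M[R]_2 * 'M[R]_2] F -> Ck l setT (fun x => s * F x).
    by move=> cF; apply: CkM => //; exact: Ck_cst.
  by move: j k; apply: ord3P; apply: ord3P; rewrite /rotq /=;
    repeat first [apply: B|apply: Z|apply: (CkD oT)|apply: (CkM oT)|apply: N|exact: c].
move=> h _; rewrite -/(pullback (rotS j k) h) pullback_rotS /rot.
by rewrite !cE_amb.
Qed.

Lemma smooth_lin (s : R) f f' : smooth f -> smooth f' -> smooth (fun P => s * f P + f' P).
Proof.
move=> sf sf' g; have [U [F [oU Ug cF hF]]] := sf g.
have [U' [F' [oU' Ug' cF' hF']]] := sf' g.
have sub n (V W : set ('M[R]_2 * 'M[R]_2)) H : Ck n V H -> W `<=` V -> Ck n W H.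
  elim: n H => [|n IH] H /=; first by move=> cH WV x /WV; exact: cH.
  by move=> [dH cH] WV; split=> [x /WV|v]; [exact: dH|apply: IH => //; exact: cH].
exists (U `&` U'), (fun x => s * F x + F' x); split=> //.
- exact: openI.
- move=> n; have oI := openI oU oU'.
  apply: CkD => //; last by apply: sub (cF' n) _ => x [].
  by apply: CkM => //; [exact: Ck_cst|apply: sub (cF n) _ => x []].
- by move=> h [Uh Uh']; rewrite hF// hF'.
Qed.

Lemma smooth0 : smooth (fun=> 0 : R).
Proof.
move=> g; exists setT, (fun=> 0); split=> //; first exact: openT.
by move=> n; exact: Ck_cst.
Qed.

Lemma eigfun_lin (w : 'I_3 -> R) mu (s : R) (f f' : G -> R) :
  eigfun w mu f -> eigfun w mu f' -> eigfun w mu (fun p => s * f p + f' p).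
Proof.
move=> [uf [f1 [f2 [hf ef]]]] [uf' [f1' [f2' [hf' ef']]]].
split; first by apply: ucontD => //; exact: ucontZ.
exists (fun j p => s * f1 j p + f1' j p), (fun j p => s * f2 j p + f2' j p); split.
  move=> j; have [u1 u2 d1 d2] := hf j; have [u1' u2' d1' d2'] := hf' j.
  split; [| |apply: isderD => //; exact: isderZ..]; apply: ucontD => //; exact: ucontZ.
move=> p; rewrite mulrDr mulrCA -ef -ef' mulr_sumr -big_split.
by apply: eq_bigr => j _ /=; ring.
Qed.

Section Metric.
Variables (a b c : R) (hab : b <= a) (hbc : c <= b) (hc : 0 < c).
Local Notation w := (weight a b c).

Let hb : 0 < b := lt_le_trans hc hbc.
Let ha : 0 < a := lt_le_trans hb hab.

Lemma eigenspace_eigfun mu f : Defs.eigenspace a b c mu f <-> smooth f /\ eigfun w mu (pullback f).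
Proof.
split=> [[sf hf]|[sf [uf [f1 [f2 [hf ef]]]]]]; split=> //.
  split; first exact: ucont_pullback.
  exists (fun j => pullback (Xd j f)), (fun j => pullback (Xd j (Xd j f))); split=> [j|p].
    have s1 := smooth_derived j sf; have s2 := smooth_derived j s1.
    by split; [exact: ucont_pullback|exact: ucont_pullback|exact: isder_pullback_Xd|exact: isder_pullback_Xd].
  by rewrite mulNr -[mu * _](hf (\pi_(SO3 R) p)) laplaceE// opprK.
move=> P; rewrite -[P]reprK laplaceE// -/(pullback f (repr P)).
apply: oppr_inj; rewrite opprK -mulNr -ef; apply: eq_bigr => j _; congr (_ * _).
have [_ _ d1 d2] := hf j.
have E1 := isder_uniq (isder_pullback_Xd j sf) d1.
apply: isder_uniq d2 _; have := isder_pullback_Xd j (smooth_derived j sf).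
by move/funext: E1 => ->.
Qed.

Lemma lam_weight : [/\ lam w 0 = 4 * (b ^+ 2 + c ^+ 2),
  lam w 1 = 4 * (a ^+ 2 + c ^+ 2) & lam w 2%:R = 4 * (a ^+ 2 + b ^+ 2)].
Proof. by split; rewrite /lam big_mkcond sum3 /weight /=; ring. Qed.

Definition lam1 : R := 4 * (b ^+ 2 + c ^+ 2).

Lemma lam1_gt0 : 0 < lam1.
Proof. by rewrite mulr_gt0// addr_gt0// exprn_gt0. Qed.

Lemma lam1_le k : lam1 <= lam w k.
Proof.
have [e0 e1 e2] := lam_weight; rewrite /lam1.
have ba2 : b ^+ 2 <= a ^+ 2 by rewrite ler_pXn2r// nnegrE ltW.
have cb2 : c ^+ 2 <= b ^+ 2 by rewrite ler_pXn2r// nnegrE ltW.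
by move: k; apply: ord3P; rewrite ?e0 ?e1 ?e2; lra.
Qed.

(** The right-hand side is the bound of [eigfun_ortho] in degree four. *)
Lemma lam1_bound : lam1 < 8 * b ^+ 2 + 16 * c ^+ 2.
Proof.
have := exprn_gt0 2 hb; have := exprn_gt0 2 hc; rewrite /lam1; lra.
Qed.

Definition low_pairs mu : {pred 'I_3 * 'I_3} := [predX predT & [pred k | lam w k == mu]].

(** Eigenfunctions of different eigenvalues are orthogonal, so the constants drop
    out, and the columns of the adjoint matrix whose eigenvalue is not [mu]. *)
Lemma eigenspace_expand mu f : mu != 0 -> mu < 8 * b ^+ 2 + 16 * c ^+ 2 ->
  Defs.eigenspace a b c mu f -> forall P,
  f P = \sum_(jk in low_pairs mu)
     coef (pullback f) jk.1 jk.2 * rotS jk.1 jk.2 P.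
Proof.
move=> mu0 hmu /eigenspace_eigfun[sf ef] P.
have := eigfun_low hc hbc hab ef hmu (pullback_neg f) (repr P).
rewrite {1}/pullback reprK /low (eigfun_haar ef mu0) add0r => ->.
rewrite pair_bigA /= [RHS]big_mkcond; apply: eq_bigr => -[j k] _ /=.
rewrite !inE /= /rotS; case: ifPn => // ne.
by rewrite (eigfun_coef _ ef ne) mul0r.
Qed.

Lemma eigenspace_rotS j k : Defs.eigenspace a b c (lam w k) (rotS j k).
Proof.
apply/eigenspace_eigfun; split; first exact: smooth_rotS.
rewrite (_ : pullback (rotS j k) = rot j k); last by apply/funext => p; exact: pullback_rotS.
exact: eigfun_rot.
Qed.

Lemma eigenspace_sum mu n (x : 'I_n -> R) (F : 'I_n -> SO -> R) :
  (forall i, Defs.eigenspace a b c mu (F i)) ->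
  Defs.eigenspace a b c mu (fun P => \sum_i x i * F i P).
Proof.
move=> hF; apply/eigenspace_eigfun.
elim: n x F hF => [|n IH] x F hF.
  have E : (fun P => \sum_(i < 0) x i * F i P) = fun=> 0 by apply/funext => P; rewrite big_ord0.
  rewrite E; split; first exact: smooth0.
  split; first exact: ucont_cst.
  exists (fun _ _ => 0), (fun _ _ => 0); split=> [j|p].
    by split; [exact: ucont_cst|exact: ucont_cst|exact: isder_cst|exact: isder_cst].
  by rewrite /pullback mulr0 big1// => j _; rewrite mulr0.
have E : (fun P => \sum_(i < n.+1) x i * F i P) =
    fun P => x ord0 * F ord0 P + \sum_(i < n) x (lift ord0 i) * F (lift ord0 i) P.
  by apply/funext => P; rewrite big_ord_recl.
have [s1 e1] := IH (fun i => x (lift ord0 i)) (fun i => F (lift ord0 i)) (fun i => hF _).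
have /eigenspace_eigfun[s0 e0] := hF ord0.
by rewrite E; split; [exact: smooth_lin|exact: eigfun_lin].
Qed.

(** Schur orthogonality. *)
Lemma rotS_free (A : {pred 'I_3 * 'I_3}) (x : 'I_#|A| -> R) :
  (forall P, \sum_i x i * rotS (enum_val i).1 (enum_val i).2 P = 0) ->
  forall i, x i = 0.
Proof.
move=> h i; pose r (l : 'I_#|A|) : G -> R := rot (enum_val l).1 (enum_val l).2.
have h' p : \sum_i x i * r i p = 0.
  rewrite -[RHS](h (\pi_(SO3 R) p)); apply: eq_bigr => l _.
  by rewrite -[rotS _ _ _]/(pullback (rotS _ _) p) pullback_rotS.
have u l : ucont (fun p => x l * (r l p * r i p)) by apply: ucontZ; apply: ucontM; exact: ucont_rot.
have : haar (fun p => \sum_l x l * (r l p * r i p)) = 0.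
  rewrite -[RHS](haar_cst 0); congr haar; apply/funext => p.
  transitivity ((\sum_l x l * r l p) * r i p); last by rewrite h' mul0r.
  by rewrite mulr_suml; apply: eq_bigr => l _; rewrite mulrA.
rewrite haar_sum// (bigD1 i)//= big1 => [|l li]; rewrite haarZ ?haar_rot_rot; try by apply: ucontM; exact: ucont_rot.
  by rewrite !eqxx addr0 !mul1r => /eqP; rewrite mulf_eq0 invr_eq0 pnatr_eq0 orbF => /eqP.
suff -> : ((enum_val l).1 == (enum_val i).1)%:R * ((enum_val l).2 == (enum_val i).2)%:R = 0 :> R.
  by rewrite mul0r mulr0.
rewrite -natrM mulnb -xpair_eqE -!surjective_pairing (inj_eq enum_val_inj).
by rewrite (negbTE li).
Qed.

Lemma multiplicity_lam mu : mu != 0 -> mu < 8 * b ^+ 2 + 16 * c ^+ 2 ->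
  multiplicity a b c mu (3 * #|[pred k | lam w k == mu]|).
Proof.
move=> mu0 hmu; pose A := low_pairs mu.
have -> : (3 * #|[pred k | lam w k == mu]| = #|A|)%N.
  by rewrite cardX card_ord.
exists (fun i : 'I_#|A| => rotS (enum_val i).1 (enum_val i).2); split.
  exact: rotS_free.
apply/seteqP; split=> [f hf|f /= [x hx]] /=.
  exists (fun i => coef (pullback f) (enum_val i).1 (enum_val i).2) => P.
  rewrite (eigenspace_expand mu0 hmu hf) big_enum_val.
  by apply: eq_bigr.
rewrite (_ : f = fun P => \sum_i x i * rotS (enum_val i).1 (enum_val i).2 P); last first.
  exact/funext.
apply: eigenspace_sum => i.
have /andP[_ /eqP e] : true && (lam w (enum_val i).2 == mu) := enum_valP i.
by have := eigenspace_rotS (enum_val i).1 (enum_val i).2; rewrite e.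
Qed.

Lemma is_lambda1_lam1 : is_lambda1 a b c lam1.
Proof.
split.
- exists (rotS 0 0); first by rewrite /lam1; have [<- _ _] := lam_weight; exact: eigenspace_rotS.
  exists (\pi_(SO3 R) (SU2one R)).
  rewrite -[rotS _ _ _]/(pullback (rotS _ _) _) pullback_rotS /rot.
  have [-> -> -> ->] := SU2one_xE R.
  by rewrite /rotq /= !mulr0 mulr1 addr0 !subr0 oner_eq0.
- by rewrite gt_eqF// lam1_gt0.
- move=> mu [f ef [P fP]] mu0; rewrite leNgt; apply/negP => lt.
  have := eigenspace_expand mu0 (lt_trans lt lam1_bound) ef P.
  rewrite big1 => [f0|[j k]]; first by rewrite f0 eqxx in fP.
  rewrite !inE /= => /eqP e; have := lam1_le k; rewrite e => le.
  by have := lt_le_trans lt le; rewrite ltxx.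
Qed.

End Metric.
End Eigenspaces.

Unset Implicit Arguments.

Theorem theorem1p2 (R : realType) (a b c : R)
    (hab : b <= a) (hbc : c <= b) (hc : 0 < c) :
  is_lambda1 a b c (4 * (b ^+ 2 + c ^+ 2)) /\
  (b < a -> multiplicity a b c (4 * (b ^+ 2 + c ^+ 2)) 3) /\
  (a = b -> c < b -> multiplicity a b c (4 * (b ^+ 2 + c ^+ 2)) 6) /\
  (a = b -> b = c -> multiplicity a b c (4 * (b ^+ 2 + c ^+ 2)) 9).
Proof.
rewrite -/(lam1 b c); split; first exact: is_lambda1_lam1.
have mult n : #|[pred k | lam (weight a b c) k == lam1 b c]| = n ->
    multiplicity a b c (lam1 b c) (3 * n).
  move=> <-; apply: (multiplicity_lam hab hbc hc); last exact: lam1_bound.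
  by rewrite gt_eqF// lam1_gt0.
have sq (s t : R) : 0 < s -> s < t -> s ^+ 2 < t ^+ 2.
  by move=> s0 st; rewrite ltr_pXn2r// nnegrE ltW// (lt_trans s0).
have b0 : 0 < b := lt_le_trans hc hbc.
have [e0 e1 e2] := lam_weight a b c.
have card (K : {pred 'I_3}) : (forall k, (lam (weight a b c) k == lam1 b c) = (k \in K)) ->
    multiplicity a b c (lam1 b c) (3 * #|K|).
  by move=> h; apply: mult; apply: eq_card => k; rewrite inE h.
split; [|split].
- move=> ba; have := sq _ _ b0 ba; have := sq _ _ b0 (le_lt_trans (lexx b) ba) => h1 h2.
  have := card (pred1 0); rewrite card1; apply.
  have cb2 : c ^+ 2 <= b ^+ 2 by rewrite ler_pXn2r// nnegrE ltW.
  apply: ord3P; rewrite inE ?e0 ?e1 ?e2 /lam1 ?eqxx// gt_eqF//; lra.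
- move=> ab cb; have := sq _ _ hc cb => h1.
  have := card (pred2 0 1); rewrite card2 /=; apply.
  by apply: ord3P; rewrite !inE ?e0 ?e1 ?e2 /lam1 ?ab ?eqxx// gt_eqF//; lra.
- move=> ab bc; have := card predT; rewrite card_ord; apply.
  by apply: ord3P; rewrite !inE ?e0 ?e1 ?e2 /lam1 ?ab ?bc ?eqxx.
Qed.
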